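(* Let $\Omega\subset\mathbb{R}^2\cong\mathbb{C}$, $(\Omega_n)_{n\in\mathbb{N}}$ and $(\nu_n)_{n\in\mathbb{N}}$ satisfy the standing setup, Condition W and Condition D (parts (a), (b), (c)) described in the context, assume $I_{214}(n)\ge I_{14}(n+1)$ and that $-\ln\nu_n$ is subharmonic on $\Omega$ for every $n\in\mathbb{N}$. Then $\bar\partial\colon\mathcal{EV}(\Omega)\to\mathcal{EV}(\Omega)$ is surjective.
   Context: Standing setup: identify $\mathbb{R}^2$ with $\mathbb{C}$; $|\cdot|$ Euclidean norm, $\|\cdot\|_\infty$ max-norm, $\mathbb{B}_r(x)$ open Euclidean ball, $\operatorname{dist}(M_0,M_1):=\inf_{x\in M_0,y\in M_1}|x-y|$ ($\infty$ if a set is empty). $\Omega\subset\mathbb{R}^2$ open, $(\Omega_n)_{n\in\mathbb{N}}$ non-empty open with $\Omega_n\neq\mathbb{R}^2$, $\Omega_n\subset\Omega_{n+1}$, $\Omega=\bigcup_n\Omega_n$, $d_{n,k}:=\operatorname{dist}(\Omega_n,\partial\Omega_k)>0$ for $k>n$; $\nu_n\colon\Omega\to(0,\infty)$ continuous, $\nu_n\le\nu_{n+1}$. $|f|_{n,m}:=\sup_{x\in\Omega_n,\beta\in\mathbb{N}_0^2,|\beta|\le m}|\partial^\beta f(x)|\nu_n(x)$; $\mathcal{E}\nu_n(\Omega_n)$: smooth $\mathbb{C}$-valued $f$ on $\Omega_n$ with all $|f|_{n,m}<\infty$; $\mathcal{E}\nu_{n,\bar\partial}(\Omega_n)$: those with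 $\bar\partial f=0$, $\bar\partial=\frac12(\partial_1+i\partial_2)$. $\mathcal{EV}(\Omega):=\{f\in\mathcal{C}^\infty(\Omega,\mathbb{C})\mid f|_{\Omega_n}\in\mathcal{E}\nu_n(\Omega_n)\ \forall n\}$. Condition W: for every $k\in\mathbb{N}$ there is $\rho_k$ with $0<\rho_k<\inf\{\|x-y\|_\infty\mid y\in\partial\Omega_{k+1}\}$ for all $x\in\Omega_k$, and for every $k,n\in\mathbb{N}$ there are $J_1(n),J_2(n)\ge n$ and $C_1(n),C_2(n)>0$ (possibly depending on $k$) such that for all $x\in\Omega_k$: $\sup_{\|\zeta\|_\infty\le\rho_k}\nu_n(x+\zeta)\le C_1(n)\inf_{\|\zeta\|_\infty\le\rho_k}\nu_{J_1(n)}(x+\zeta)$ and $\nu_n(x)\le C_2(n)(1+|x|^2)^{-2}\nu_{J_2(n)}(x)$. Condition D: (a) for every $n$ there are $g_n\in\mathcal{O}(\mathbb{C})$ with $g_n(0)=1$ and integers $I_1(n),I_2(n)>n$ such that (i) for every $\varepsilon>0$ there is compact $K\subset\overline{\Omega_n}$ with $\nu_n\le\varepsilon\nu_{I_1(n)}$ on $\Omega_n\setminus K$; (ii) there is an open $X_{I_2(n)}\subset\mathbb{R}^2\setminus\overline{\Omega_{I_2(n)}}$, reals $R_n,r_n$ with $0<2R_n<\delta_n:=\operatorname{dist}(X_{I_2(n)},\Omega_{I_2(n)})$, $R_n<r_n<\delta_n-R_n$, and $A_2(\cdot,n)\colon X_{I_2(n)}+\mathbb{B}_{R_n}(0)\to(0,\infty)$,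 locally bounded on $X_{I_2(n)}$, with $\max\{|g_n(\zeta)|\nu_{I_2(n)}(z)\mid|\zeta-(z-x)|=r_n\}\le A_2(x,n)$ for all $z\in\Omega_{I_2(n)}$, $x\in X_{I_2(n)}+\mathbb{B}_{R_n}(0)$; (iii) for every compact $K$ there is $A_3(n,K)>0$ with $\int_K\frac{|g_n(x-y)|\nu_n(x)}{|x-y|}dy\le A_3(n,K)$ for all $x\in\Omega_n$. (b) for every $n$ there are $I_4(n)>n$, $A_4(n)>0$ such that, with $I_{14}(n):=I_1(I_4(n))$, $\int_{\Omega_{I_4(n)}}\frac{|g_{I_{14}(n)}(x-y)|\nu_p(x)}{|x-y|\nu_k(y)}dy\le A_4(n)$ for all $x\in\Omega_p$, for $(k,p)=(I_4(n),n)$ and $(k,p)=(I_{14}(n),I_{14}(n))$. (c) with $I_{214}(n):=I_2(I_{14}(n))$ and $X_{I_{214}(n)}$ the open set of (a)(ii) for the index $I_{14}(n)$: for every $n$, every closed $M\subset\overline{\Omega_n}$ and every connected component $N$ of $\mathbb{R}^2\setminus M$ with $N\cap(\mathbb{R}^2\setminus\overline{\Omega_n})\ne\emptyset$ one has $N\cap X_{I_{214}(n)}\ne\emptyset$. *)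

(* Defs.v *)
From HB Require Import structures.
From mathcomp Require Import all_boot all_order all_algebra.
From mathcomp Require Import all_classical all_reals all_analysis.
Set Implicit Arguments. Unset Strict Implicit. Unset Printing Implicit Defensive.
Import Order.TTheory GRing.Theory Num.Theory.
Import numFieldNormedType.Exports.
Local Open Scope classical_set_scope.
Local Open Scope ring_scope.

Section Defs.
Variable R : realType.
Local Notation P := (R * R)%type.

Definition cmul (z w : P) : P := (z.1 * w.1 - z.2 * w.2, z.1 * w.2 + z.2 * w.1).
Definition cinv (z : P) : P :=
  ((z.1 / (z.1 ^+ 2 + z.2 ^+ 2)), - (z.2 / (z.1 ^+ 2 + z.2 ^+ 2))).
Definition cI : P := (0, 1).
Definition cone : P := (1, 0).
Definition creal (a : R) : P := (a, 0).
Definition eucl (z : P) : R := Num.sqrt (z.1 ^+ 2 + z.2 ^+ 2).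
Definition maxnorm (z : P) : R := Num.max `|z.1| `|z.2|.
Definition eball (x : P) (r : R) : set P := [set y | eucl (y - x) < r].

(* dist(M0,M1) in \bar R, = +oo if a set is empty *)
Definition dist (M0 M1 : set P) : \bar R :=
  ereal_inf [set (eucl (x - y))%:E | x in M0 & y in M1].

Definition bd (A : set P) : set P := closure A `\` interior A.

Definition pd (b : bool) (f : P -> P) : P -> P := fun x =>
  if b then derive1 (fun t : R => f (x.1, t)) x.2
  else derive1 (fun t : R => f (t, x.2)) x.1.
Definition pdable (b : bool) (f : P -> P) (x : P) : Prop :=
  if b then derivable (fun t : R => f (x.1, t)) x.2 1
  else derivable (fun t : R => f (t, x.2)) x.1 1.
Definition pds (s : seq bool) (f : P -> P) : P -> P := foldr pd f s.
Definition pbeta (beta : nat * nat) (f : P -> P) : P -> P :=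
  pds (nseq beta.1 false ++ nseq beta.2 true) f.

Definition smooth_on (U : set P) (f : P -> P) : Prop :=
  forall (s : seq bool) (x : P), U x ->
    {for x, continuous (pds s f)} /\ (forall b, pdable b (pds s f) x).

Definition dbar (f : P -> P) : P -> P := fun x =>
  cmul (creal 2^-1) (pd false f x + cmul cI (pd true f x)).

Definition seminorm (Om : nat -> set P) (nu : nat -> P -> R) (n m : nat)
    (f : P -> P) : \bar R :=
  ereal_sup [set (eucl (pbeta beta f x) * nu n x)%:E |
             x in Om n & beta in [set beta : nat * nat | (beta.1 + beta.2 <= m)%N]].

Definition EV (Omega : set P) (Om : nat -> set P) (nu : nat -> P -> R)
    (f : P -> P) : Prop :=
  smooth_on Omega f /\ forall n m, (seminorm Om nu n m f < +oo)%E.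

Definition entire (g : P -> P) : Prop :=
  forall z : P, exists l : P,
    (fun h : P => cmul (g (z + h) - g z) (cinv h)) @ (0 : P)^' --> l.

(* subharmonic real-valued function on an open set U (Ransford, Def. 2.2.1):
   upper semicontinuous and satisfying the local submean inequality *)
Definition circ (x : P) (r t : R) : P := (x.1 + r * cos t, x.2 + r * sin t).
Definition subharmonic_on (U : set P) (u : P -> R) : Prop :=
  (forall x, U x -> forall e : R, 0 < e -> \forall y \near x, u y < u x + e) /\
  (forall x, U x -> exists2 rho : R, 0 < rho &
     forall r : R, 0 < r < rho ->
       ((u x)%:E <= ((2 * pi)^-1)%:E *
          \int[lebesgue_measure]_(t in `[0%R, (2 * pi)%R]) (u (circ x r t))%:E)%E).

Definition leb2 := ((@lebesgue_measure R) \x (@lebesgue_measure R))%E.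

End Defs.

(* Main.v *)
(** The equation is solved locally by the integral of [f(y) g(x - y) / (x - y)]
    over [Om (I4 n)], where condition (b) gives the weighted bound.  Two such
    solutions differ by a holomorphic function, so a Mittag-Leffler argument
    reduces the theorem to the density, in the [nu n]-norm over [Om n], of the
    weighted holomorphic functions on [Om (I214 n)] among those on [Om (I14 n)].

    Given [h] on [Om (I14 n)], let [psi] be a cutoff equal to 1 on a large
    square and [chi] a cutoff equal to 1 near the closure of [Om n] and supported
    in [Om (I4 n)].  The Cauchy-Pompeiu formula for [psi chi h] with kernel
    [k = g / z] writes [psi h] on [Om n] as
    [int (psi h dbar chi + chi h dbar psi)(y) k(x - y) dy].  The second term is
    small by (b), and [psi h] is close to [h] by (a)(i).  In the first one [y] stays
    in a compact set off the closure of [Om n], so that it suffices to approximate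
    each [k(. - y)].  For [y] in [X] this function is itself admissible: averaging
    the bound (a)(ii) over the circles centred near [y] controls an annulus, hence
    [g(. - y)] itself by Cauchy-Pompeiu.  Taylor expansion in [y], uniform in the
    weighted norm by (a)(iii), propagates approximability along the connected
    components of the complement, all of which meet [X] by (c). *)
Require Import Defs.
From HB Require Import structures.
From mathcomp Require Import all_boot all_order all_algebra.
From mathcomp Require Import all_classical all_reals all_analysis.
From mathcomp Require Import measurable_realfun.
From mathcomp Require Import ring lra.
Import Order.TTheory GRing.Theory Num.Theory.
Import numFieldNormedType.Exports.
Local Open Scope classical_set_scope.
Local Open Scope ring_scope.
Set Implicit Arguments. Unset Strict Implicit. Unset Printing Implicit Defensive.

(** * The complex plane as [R * R] *)

Local Notation "z *c w" := (cmul z w) (at level 40, left associativity).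

(** Complex analysis is built here on partial derivatives and area integrals. The integral formulas
    all come from one fact: the dbar derivative of a compactly supported C1 function has integral
    zero. Cutoffs take the place of contours, so that a Cauchy integral over a curve becomes an area
    integral over the set where a cutoff varies. Only first derivatives of cutoffs occur, hence C1
    splines suffice, and smoothness of a solution is recovered from that of the right-hand side.

    On unbounded sets functions with a weighted bound need not be integrable, and weights at
    different points need not be comparable. Therefore approximation is phrased as membership in the
    closure of an abstract linear space for a weighted sup norm, bounds on kernels are kept in the
    form constant over [nu x], and Taylor expansions are made in the pole [y] with [x] as a
    parameter, so that the weight at [x] stays a constant factor. Only the last step, from a bound
    on [u] to bounds on its derivatives, compares values at different points, and there Condition W
    compares the weights. *)

Section ComplexAlgebra.
Variable R : realType.
Local Notation P := (R * R)%type.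
Implicit Types z w u x y : P.

Lemma pair_ext z w : z.1 = w.1 -> z.2 = w.2 -> z = w.
Proof. by case: z w => [a b] [c d] /= -> ->. Qed.

Lemma scale1E (a : R) z : (a *: z).1 = a * z.1. Proof. by []. Qed.
Lemma scale2E (a : R) z : (a *: z).2 = a * z.2. Proof. by []. Qed.

Lemma cmulC z w : z *c w = w *c z.
Proof. by apply: pair_ext => /=; ring. Qed.
Lemma cmulA z w u : z *c (w *c u) = z *c w *c u.
Proof. by apply: pair_ext => /=; ring. Qed.
Lemma cmulAC z w u : z *c w *c u = z *c u *c w.
Proof. by apply: pair_ext => /=; ring. Qed.
Lemma cmulDl z w u : (z + w) *c u = z *c u + w *c u.
Proof. by apply: pair_ext => /=; ring. Qed.
Lemma cmulDr z w u : u *c (z + w) = u *c z + u *c w.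
Proof. by apply: pair_ext => /=; ring. Qed.
Lemma cmulNl z u : (- z) *c u = - (z *c u).
Proof. by apply: pair_ext => /=; ring. Qed.
Lemma cmulNr z u : u *c (- z) = - (u *c z).
Proof. by apply: pair_ext => /=; ring. Qed.
Lemma cmulBl z w u : (z - w) *c u = z *c u - w *c u.
Proof. by rewrite cmulDl cmulNl. Qed.
Lemma cmulBr z w u : u *c (z - w) = u *c z - u *c w.
Proof. by rewrite cmulDr cmulNr. Qed.
Lemma cmul0l u : 0 *c u = 0.
Proof. by apply: pair_ext => /=; ring. Qed.
Lemma cmul0r u : u *c 0 = 0.
Proof. by apply: pair_ext => /=; ring. Qed.
Lemma cmul1l u : cone R *c u = u.
Proof. by apply: pair_ext => /=; ring. Qed.
Lemma cmul1r u : u *c cone R = u.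
Proof. by apply: pair_ext => /=; ring. Qed.
Lemma crealM (a : R) z : creal a *c z = a *: z.
Proof. by apply: pair_ext; rewrite ?scale1E ?scale2E /=; ring. Qed.
Lemma scale_cmull (a : R) z w : (a *: z) *c w = a *: (z *c w).
Proof. by rewrite -!crealM cmulA. Qed.
Lemma scale_cmulr (a : R) z w : z *c (a *: w) = a *: (z *c w).
Proof. by rewrite cmulC scale_cmull cmulC. Qed.
Lemma cI2 z : cI R *c (cI R *c z) = - z.
Proof. by apply: pair_ext => /=; ring. Qed.

Lemma sqsum_neq0 z : z != 0 -> z.1 ^+ 2 + z.2 ^+ 2 != 0.
Proof.
apply: contra_neq => z0.
have z1 : z.1 ^+ 2 = 0 by have := sqr_ge0 z.1; have := sqr_ge0 z.2; lra.
have z2 : z.2 ^+ 2 = 0 by have := sqr_ge0 z.1; have := sqr_ge0 z.2; lra.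
by apply: pair_ext; apply/eqP; rewrite -sqrf_eq0; apply/eqP.
Qed.

Lemma cmulV z : z != 0 -> z *c cinv z = cone R.
Proof.
by move=> /sqsum_neq0 z0; apply: pair_ext; rewrite /=; field; move: z0; rewrite !expr2.
Qed.

(** The convention that [0^-1] is 0 makes [cinv] total, so the pole of a kernel needs no exceptional
    set under an integral. *)
Lemma cinv0 : cinv (0 : P) = 0.
Proof. by apply: pair_ext; rewrite /= !mul0r ?oppr0. Qed.

Lemma cinvN z : cinv (- z) = - cinv z.
Proof. by apply: pair_ext; rewrite /= !sqrrN mulNr. Qed.

Lemma cinv_sub z w : z != 0 -> w != 0 -> cinv z - cinv w = (w - z) *c (cinv z *c cinv w).
Proof.
move=> z0 w0; rewrite cmulBl cmulA (cmulAC w) cmulV // cmul1l.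
by rewrite cmulA cmulV // cmul1l.
Qed.

Fixpoint cexp z (n : nat) : P := if n is m.+1 then z *c cexp z m else cone R.

Lemma normPE z : `|z| = Num.max `|z.1| `|z.2|. Proof. by []. Qed.

Lemma norm1_le z : `|z.1| <= `|z|. Proof. by rewrite normPE le_max lexx. Qed.
Lemma norm2_le z : `|z.2| <= `|z|. Proof. by rewrite normPE le_max lexx orbT. Qed.
Lemma normP_le z (a : R) : `|z.1| <= a -> `|z.2| <= a -> `|z| <= a.
Proof. by move=> h1 h2; rewrite normPE ge_max h1. Qed.
Lemma normP_lt z (a : R) : `|z.1| < a -> `|z.2| < a -> `|z| < a.
Proof. by move=> h1 h2; rewrite normPE gt_max h1. Qed.

(** The max norm is submultiplicative only up to a factor 2, the origin of many factors 2 in the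
    kernel bounds. Weighted estimates use the multiplicative [eucl] instead. *)
Lemma norm_cmul z w : `|z *c w| <= 2 * (`|z| * `|w|).
Proof.
have [[[h1 h2] h3] h4] := (norm1_le z, norm2_le z, norm1_le w, norm2_le w).
have e (a b c d : R) : `|a| <= `|z| -> `|b| <= `|w| -> `|c| <= `|z| -> `|d| <= `|w| ->
    `|a * b| + `|c * d| <= 2 * (`|z| * `|w|).
  by move=> *; rewrite !normrM mulr_natl mulr2n lerD // ler_pM.
apply: normP_le; rewrite /=.
  by rewrite (le_trans (ler_normB _ _)) // e.
by rewrite (le_trans (ler_normD _ _)) // e.
Qed.

Lemma eucl_ge0 z : 0 <= eucl z. Proof. exact: sqrtr_ge0. Qed.

Lemma eucl_sq z : eucl z ^+ 2 = z.1 ^+ 2 + z.2 ^+ 2.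
Proof. by rewrite sqr_sqrtr // addr_ge0 ?sqr_ge0. Qed.

Lemma eucl0 : eucl (0 : P) = 0.
Proof. by rewrite /eucl /= expr0n addr0 sqrtr0. Qed.

Lemma norm_le_eucl z : `|z| <= eucl z.
Proof.
apply: normP_le; rewrite -sqrtr_sqr ler_wsqrtr //.
  by rewrite lerDl sqr_ge0.
by rewrite lerDr sqr_ge0.
Qed.

Lemma eucl_le_norm z : eucl z <= 2 * `|z|.
Proof.
rewrite -(ger0_norm (eucl_ge0 z)) -[leRHS]ger0_norm; last by rewrite mulr_ge0.
rewrite -ler_sqr ?nnegrE // !real_normK ?num_real // eucl_sq exprMn.
have := norm1_le z; have := norm2_le z => h2 h1.
have : `|z.1| ^+ 2 <= `|z| ^+ 2 by rewrite lerXn2r ?nnegrE.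
have : `|z.2| ^+ 2 <= `|z| ^+ 2 by rewrite lerXn2r ?nnegrE.
rewrite !real_normK ?num_real //.
have : 0 <= `|z| ^+ 2 by rewrite exprn_ge0.
lra.
Qed.

Lemma eucl_eq0 z : eucl z = 0 -> z = 0.
Proof.
by move=> z0; apply/eqP; rewrite -normr_le0 -z0 norm_le_eucl.
Qed.

Lemma eucl_gt0 z : z != 0 -> 0 < eucl z.
Proof.
move=> z0; rewrite lt_neqAle eucl_ge0 andbT eq_sym.
by apply: contra_neq z0 => /eucl_eq0.
Qed.

Lemma eucl_cmul z w : eucl (z *c w) = eucl z * eucl w.
Proof.
rewrite /eucl -sqrtrM; last by rewrite addr_ge0 ?sqr_ge0.
by congr Num.sqrt; rewrite /=; ring.
Qed.

Lemma eucl_cinv z : eucl (cinv z) = (eucl z)^-1.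
Proof.
have [->|z0] := eqVneq z 0; first by rewrite cinv0 eucl0 invr0.
have e0 := lt0r_neq0 (eucl_gt0 z0).
apply: (mulfI e0); rewrite -eucl_cmul cmulV // divff //.
by rewrite /eucl /= expr1n expr0n addr0 sqrtr1.
Qed.

Lemma eucl_scale (a : R) z : eucl (a *: z) = `|a| * eucl z.
Proof.
by rewrite -crealM eucl_cmul; congr (_ * _); rewrite /eucl /= expr0n addr0 sqrtr_sqr.
Qed.

Lemma norm_cinv z : `|cinv z| <= `|z|^-1.
Proof.
have [->|z0] := eqVneq z 0; first by rewrite cinv0 normr0 invr0.
apply: (le_trans (norm_le_eucl _)); rewrite eucl_cinv lef_pV2 ?posrE ?normr_gt0 ?eucl_gt0 //.
exact: norm_le_eucl.
Qed.

Lemma eucl_ltD z w (a b : R) : eucl z <= a -> eucl w <= b -> eucl (z + w) <= a + b.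
Proof.
move=> za wb.
have a0 := le_trans (eucl_ge0 z) za; have b0 := le_trans (eucl_ge0 w) wb.
(* Cauchy-Schwarz: the squares of the two sides differ by [(z.1 * w.2 - z.2 * w.1) ^+ 2]. *)
have zw : z.1 * w.1 + z.2 * w.2 <= eucl z * eucl w.
  apply: le_trans (ler_norm _) _.
  rewrite -[leRHS]ger0_norm ?mulr_ge0 ?eucl_ge0 //.
  rewrite -ler_sqr ?nnegrE // !real_normK ?num_real // exprMn !eucl_sq.
  have := sqr_ge0 (z.1 * w.2 - z.2 * w.1); rewrite -subr_ge0; move=> h.
  by rewrite (le_trans h) // le_eqVlt; apply/orP; left; apply/eqP; ring.
rewrite -[leRHS]ger0_norm ?addr_ge0 // -(ger0_norm (eucl_ge0 (z + w))).
rewrite -ler_sqr ?nnegrE // !real_normK ?num_real // eucl_sq /=.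
have h1 : eucl z ^+ 2 <= a ^+ 2 by rewrite lerXn2r ?nnegrE ?eucl_ge0.
have h2 : eucl w ^+ 2 <= b ^+ 2 by rewrite lerXn2r ?nnegrE ?eucl_ge0.
have h3 : eucl z * eucl w <= a * b by rewrite ler_pM ?eucl_ge0.
rewrite !eucl_sq in h1 h2; rewrite !sqrrD; lra.
Qed.

Lemma eucl_tri z w : eucl (z + w) <= eucl z + eucl w.
Proof. exact: eucl_ltD. Qed.

Lemma euclN z : eucl (- z) = eucl z.
Proof. by rewrite /eucl /= !sqrrN. Qed.

Lemma eucl_cexp z n : eucl (cexp z n) = eucl z ^+ n.
Proof.
elim: n => [|n IH] /=; last by rewrite eucl_cmul IH exprS.
by rewrite expr0 /eucl /= expr1n expr0n addr0 sqrtr1.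
Qed.

End ComplexAlgebra.

(* [pD] and [dB] are opaque copies of [pd] and [dbar]: unification would otherwise
   compare distinct partial derivatives by unfolding them down to limits. *)
Fact pD_key : unit. Proof. exact: tt. Qed.
Definition pD (R : realType) : bool -> (R * R -> R * R) -> R * R -> R * R :=
  locked_with pD_key (@pd R).
Lemma pDE (R : realType) (b : bool) (f : R * R -> R * R) : pD b f = pd b f.
Proof. by rewrite [@pD R]unlock. Qed.
Definition dB (R : realType) : (R * R -> R * R) -> R * R -> R * R :=
  locked_with pD_key (@dbar R).
Lemma dB_dbar (R : realType) (f : R * R -> R * R) : dB f = dbar f.
Proof. by rewrite [@dB R]unlock. Qed.
Lemma dBE (R : realType) (f : R * R -> R * R) (x : R * R) :
  dB f x = creal 2^-1 *c (pD false f x + cI R *c pD true f x).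
Proof. by rewrite dB_dbar !pDE. Qed.

(** * Partial derivatives along coordinate lines *)

Section PartialDerivatives.
Variable R : realType.
Local Notation P := (R * R)%type.
Implicit Types (z w u x y : P) (f g : P -> P) (b : bool).

Definition line b x (t : R) : P := if b then (x.1, t) else (t, x.2).
Definition co b x : R := if b then x.2 else x.1.
Definition rpd b (h : P -> R) x (d : R) : Prop := is_derive (co b x) (1 : R) (h \o line b x) d.
(** Existence and value are carried together, so that the rules of calculus compose, whereas [pD]
    takes a default value where there is no derivative. *)
Definition hasp b f x (l : P) : Prop := is_derive (co b x) (1 : R) (f \o line b x) l.

Lemma cvg_prod (T : Type) (F : set_system T) {FF : Filter F} (f g : T -> R) (a c : R) :
  f @ F --> a -> g @ F --> c -> (f t, g t) @[t --> F] --> ((a, c) : P).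
Proof. by move=> fa gc; have h := cvg_pair fa gc; exact: h. Qed.

Lemma cvg_fstP (T : Type) (F : set_system T) {FF : Filter F} (f : T -> P) (l : P) :
  f @ F --> l -> (f t).1 @[t --> F] --> l.1.
Proof.
move=> fl; have h := cvg_comp _ _ fl (@cvg_fst _ _ (nbhs l.1) (nbhs l.2) _); exact: h.
Qed.

Lemma cvg_sndP (T : Type) (F : set_system T) {FF : Filter F} (f : T -> P) (l : P) :
  f @ F --> l -> (f t).2 @[t --> F] --> l.2.
Proof.
move=> fl; have h := cvg_comp _ _ fl (@cvg_snd _ _ (nbhs l.1) (nbhs l.2) _); exact: h.
Qed.

Lemma line_co b x : line b x (co b x) = x.
Proof. by case: b x => [] []. Qed.

Lemma is_derive_pairP (f : R -> P) (t : R) (l : P) : is_derive t (1 : R) f l <->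
  is_derive t (1 : R) (fst \o f) l.1 /\ is_derive t (1 : R) (snd \o f) l.2.
Proof.
split.
  move=> [df dl].
  have h : (fun h => h^-1 *: ((f \o shift t) (h *: (1:R)) - f t)) @ 0^' --> l by rewrite -dl.
  have h1 := cvg_comp _ _ h (@cvg_fst _ _ (nbhs l.1) (nbhs l.2) _).
  have h2 := cvg_comp _ _ h (@cvg_snd _ _ (nbhs l.1) (nbhs l.2) _).
  split; apply: DeriveDef.
  - by apply/cvg_ex; exists l.1; exact: h1.
  - by apply/cvg_lim => //; exact: h1.
  - by apply/cvg_ex; exists l.2; exact: h2.
  - by apply/cvg_lim => //; exact: h2.
move=> [[d1 l1] [d2 l2]].
have h1 : (fun h => h^-1 *: (((fst \o f) \o shift t) (h *: (1:R)) - (fst \o f) t)) @ 0^' --> l.1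
  by rewrite -l1; exact: d1.
have h2 : (fun h => h^-1 *: (((snd \o f) \o shift t) (h *: (1:R)) - (snd \o f) t)) @ 0^' --> l.2
  by rewrite -l2; exact: d2.
have h : (fun h => h^-1 *: ((f \o shift t) (h *: (1:R)) - f t)) @ 0^' --> l.
  rewrite [l]surjective_pairing; apply: cvg_trans (cvg_pair h1 h2).
  by apply: near_eq_cvg; apply: nearW => e; apply: pair_ext.
by apply: DeriveDef; [apply/cvg_ex; exists l|apply/cvg_lim].
Qed.

Lemma hasp_rpd b f x l : hasp b f x l <-> rpd b (fst \o f) x l.1 /\ rpd b (snd \o f) x l.2.
Proof. exact: is_derive_pairP. Qed.

Lemma haspP b f x l : hasp b f x l -> pdable b f x /\ pD b f x = l.
Proof.
move=> h; have d := @ex_derive _ _ _ _ _ _ _ h; have e := @derive_val _ _ _ _ _ _ _ h.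
case: b h d e => h d e; (split; first exact: d); rewrite pDE /pd derive1E; exact: e.
Qed.

Lemma hasp_pd b f x l : hasp b f x l -> pD b f x = l.
Proof. by move=> /haspP[]. Qed.

Lemma pdable_hasp b f x : pdable b f x -> hasp b f x (pD b f x).
Proof.
by case: b => d; rewrite pDE /pd derive1E; exact: derivableP.
Qed.

Lemma hasp_eq b f x l l' : hasp b f x l -> l = l' -> hasp b f x l'.
Proof. by move=> h <-. Qed.

Lemma line_cvg b x : line b x t @[t --> co b x] --> x.
Proof.
case: b x => [] [x1 x2].
  exact: (cvg_prod (cvg_cst x1) cvg_id).
exact: (cvg_prod cvg_id (cvg_cst x2)).
Qed.

Lemma hasp_near b f g x l : (\near x, f x = g x) -> hasp b f x l -> hasp b g x l.
Proof.
move=> hk hd; apply: (near_eq_is_derive _ hd).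
exact: (@line_cvg b x _ hk).
Qed.

Lemma rpd_cst b (c : R) x : rpd b (cst c) x 0.
Proof. exact: is_derive_cst. Qed.
Lemma rpdD b (h k : P -> R) x c d : rpd b h x c -> rpd b k x d ->
  rpd b (fun z => h z + k z) x (c + d).
Proof. exact: is_deriveD. Qed.
Lemma rpdN b (h : P -> R) x c : rpd b h x c -> rpd b (fun z => - h z) x (- c).
Proof. exact: is_deriveN. Qed.
Lemma rpdB b (h k : P -> R) x c d : rpd b h x c -> rpd b k x d ->
  rpd b (fun z => h z - k z) x (c - d).
Proof. exact: is_deriveB. Qed.
Lemma rpdM b (h k : P -> R) x c d : rpd b h x c -> rpd b k x d ->
  rpd b (fun z => h z * k z) x (h x * d + k x * c).
Proof.
move=> hc kd; have := is_deriveM hc kd; rewrite /= line_co.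
by move/is_derive_eq; apply.
Qed.
Lemma rpdV b (h : P -> R) x c : h x != 0 -> rpd b h x c ->
  rpd b (fun z => (h z)^-1) x (- (h x) ^- 2 * c).
Proof.
move=> h0 hc; have := @is_deriveV R (h \o line b x) (co b x) c 1.
by rewrite /= line_co => /(_ h0 hc).
Qed.
Lemma rpd_comp b (k : R -> R) (h : P -> R) x c d : rpd b h x c -> is_derive (h x) (1:R) k d ->
  rpd b (k \o h) x (d * c).
Proof.
move=> hc kd.
have := @is_derive1_comp R k (h \o line b x) (co b x) d c.
by rewrite /= line_co => /(_ kd hc).
Qed.
Lemma rpd_fst b x : rpd b fst x (if b then 0 else 1).
Proof. by case: b; [exact: is_derive_cst | exact: is_derive_id]. Qed.
Lemma rpd_snd b x : rpd b snd x (if b then 1 else 0).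
Proof. by case: b; [exact: is_derive_id | exact: is_derive_cst]. Qed.

Lemma hasp_cst b (c : P) x : hasp b (cst c) x 0.
Proof. exact: is_derive_cst. Qed.
Lemma haspD b f g x l m : hasp b f x l -> hasp b g x m -> hasp b (fun z => f z + g z) x (l + m).
Proof. exact: is_deriveD. Qed.
Lemma haspN b f x l : hasp b f x l -> hasp b (fun z => - f z) x (- l).
Proof. exact: is_deriveN. Qed.
Lemma haspB b f g x l m : hasp b f x l -> hasp b g x m -> hasp b (fun z => f z - g z) x (l - m).
Proof. exact: is_deriveB. Qed.
Lemma haspM b f g x l m : hasp b f x l -> hasp b g x m ->
  hasp b (fun z => f z *c g z) x (l *c g x + f x *c m).
Proof.
move=> /hasp_rpd[f1 f2] /hasp_rpd[g1 g2]; apply/hasp_rpd; split.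
  have := rpdB (rpdM f1 g1) (rpdM f2 g2); move/is_derive_eq; apply.
  by rewrite /=; ring.
have := rpdD (rpdM f1 g2) (rpdM f2 g1); move/is_derive_eq; apply.
by rewrite /=; ring.
Qed.

Lemma hasp_cinv b f x l : f x != 0 -> hasp b f x l ->
  hasp b (fun z => cinv (f z)) x (- (cinv (f x) *c cinv (f x) *c l)).
Proof.
move=> fx0 /hasp_rpd[f1 f2].
have n0 := sqsum_neq0 fx0.
have nV := @rpdV b (fun z => (f z).1 * (f z).1 + (f z).2 * (f z).2) x _ _
   (rpdD (rpdM f1 f1) (rpdM f2 f2)).
rewrite -!expr2 in nV; have {}nV := nV n0; rewrite /= in nV.
apply/hasp_rpd; split.
  apply: (is_derive_eq (rpdM f1 nV)); rewrite /=; field.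
  by move: n0; rewrite !expr2.
apply: (is_derive_eq (rpdN (rpdM f2 nV))); rewrite /=; field.
by move: n0; rewrite !expr2.
Qed.

End PartialDerivatives.

(** * C1 and holomorphic functions *)

Section C1Functions.
Variable R : realType.
Local Notation P := (R * R)%type.
Implicit Types (z w u x y : P) (f g : P -> P) (b : bool) (U V : set P).

Lemma cvg_cmul (T : Type) (F : set_system T) {FF : Filter F} (f g : T -> P) (l m : P) :
  f @ F --> l -> g @ F --> m -> (f t *c g t) @[t --> F] --> l *c m.
Proof.
move=> fl gm; apply: cvg_prod.
  by apply: cvgB; apply: cvgM; first [exact: cvg_fstP | exact: cvg_sndP].
by apply: cvgD; apply: cvgM; first [exact: cvg_fstP | exact: cvg_sndP].
Qed.

Lemma cvg_cinv (T : Type) (F : set_system T) {FF : Filter F} (f : T -> P) (l : P) :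
  l != 0 -> f @ F --> l -> cinv (f t) @[t --> F] --> cinv l.
Proof.
move=> l0 fl.
have h : ((f t).1 ^+ 2 + (f t).2 ^+ 2)^-1 @[t --> F] --> (l.1 ^+ 2 + l.2 ^+ 2)^-1.
  apply: cvgV; first exact: sqsum_neq0.
  by apply: cvgD; rewrite expr2; under eq_fun do rewrite expr2; apply: cvgM;
    first [exact: cvg_fstP | exact: cvg_sndP].
apply: cvg_prod; first by apply: cvgM h; exact: cvg_fstP.
by apply: cvgN; apply: cvgM h; exact: cvg_sndP.
Qed.

(* A record rather than a plain definition, to keep unification from unfolding it. *)
Record C1 U f : Prop := BuildC1 { C1P : forall x, U x ->
  {for x, continuous f} /\ forall b, pdable b f x /\ {for x, continuous (pD b f)} }.

Lemma C1_cont U f x : C1 U f -> U x -> {for x, continuous f}.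
Proof. by move=> /C1P h /h[]. Qed.

Lemma C1_hasp U f b x : C1 U f -> U x -> hasp b f x (pD b f x).
Proof. by move=> /C1P h /h[_ /(_ b)[/pdable_hasp]]. Qed.

Lemma C1_pd_cont U f b x : C1 U f -> U x -> {for x, continuous (pD b f)}.
Proof. by move=> /C1P h /h[_ /(_ b)[]]. Qed.

Lemma cont_near f g x : (\near x, f x = g x) -> {for x, continuous f} -> {for x, continuous g}.
Proof.
move=> fg h; have e : f x = g x := nbhs_singleton fg.
have : g @ x --> f x by apply: cvg_trans h; exact: near_eq_cvg.
by rewrite e.
Qed.

Lemma pd_near b f g x : (\near x, f x = g x) -> pD b f x = pD b g x.
Proof.
move=> fg.
have h (D : R -> P) (E : R -> P) (t : R) : (\near t, D t = E t) -> derive1 D t = derive1 E t.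
  by move=> DE; rewrite !derive1E; exact: near_eq_derive.
by rewrite !pDE /pd; case: b; apply: h; [exact: (@line_cvg _ true x _ fg) | exact: (@line_cvg _ false x _ fg)].
Qed.

Lemma near_pd b f g x : (\near x, f x = g x) -> \near x, pD b f x = pD b g x.
Proof.
move=> fg; have := nbhs_interior fg; apply: filterS => y; exact: pd_near.
Qed.

(** Openness of [U] makes [pD b f] agree with [D b] on a neighbourhood of each point, from which it
    inherits continuity. *)
Lemma C1I U f (D : bool -> P -> P) : open U ->
  (forall x, U x -> {for x, continuous f}) ->
  (forall b x, U x -> hasp b f x (D b x)) ->
  (forall b x, U x -> {for x, continuous (D b)}) -> C1 U f.
Proof.
move=> oU fc fD Dc; split => x Ux; split; first exact: fc.
move=> b; split; first by have /haspP[] := fD b x Ux.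
apply: (@cont_near (D b)); last exact: Dc.
have : \near x, U x by exact: open_nbhs_nbhs.
by apply: filterS => y Uy; rewrite (hasp_pd (fD b y Uy)).
Qed.

Lemma C1_near U f g : (forall x, U x -> \near x, f x = g x) -> C1 U f -> C1 U g.
Proof.
move=> fg h; split => x Ux; split; first exact: (cont_near (fg x Ux)) (C1_cont h Ux).
move=> b; split; first by have /haspP[] := hasp_near (fg x Ux) (C1_hasp b h Ux).
by apply: (cont_near (near_pd b (fg x Ux))); exact: C1_pd_cont h Ux.
Qed.

Lemma open_near U (Q : P -> Prop) x : open U -> (forall y, U y -> Q y) -> U x -> \near x, Q x.
Proof.
move=> oU UQ Ux; have : \near x, U x by exact: open_nbhs_nbhs.
exact: filterS.
Qed.

Lemma C1_eq U f g : open U -> (forall x, U x -> f x = g x) -> C1 U f -> C1 U g.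
Proof. by move=> oU fg; apply: C1_near => x; exact: open_near. Qed.

Lemma C1_sub U V f : U `<=` V -> C1 V f -> C1 U f.
Proof. by move=> UV [h]; split => x /UV /h. Qed.

Lemma C1_cst U (c : P) : C1 U (cst c).
Proof.
have e b : pD b (cst c) = cst 0 by apply/funext => y; exact: (hasp_pd (hasp_cst b c y)).
split => x _; split; first exact: cst_continuous.
move=> b; split; first by have /haspP[] := hasp_cst b c x.
by rewrite e; exact: cst_continuous.
Qed.

Lemma C1D U f g : open U -> C1 U f -> C1 U g -> C1 U (fun z => f z + g z).
Proof.
move=> oU hf hg; apply: (C1I (D := fun b z => pD b f z + pD b g z) oU) => [x Ux|b x Ux|b x Ux].
- exact: (cvgD (C1_cont hf Ux) (C1_cont hg Ux)).
- exact: (haspD (C1_hasp b hf Ux) (C1_hasp b hg Ux)).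
- exact: (cvgD (C1_pd_cont (b:=b) hf Ux) (C1_pd_cont (b:=b) hg Ux)).
Qed.

Lemma C1N U f : open U -> C1 U f -> C1 U (fun z => - f z).
Proof.
move=> oU hf; apply: (C1I (D := fun b z => - pD b f z) oU) => [x Ux|b x Ux|b x Ux].
- exact: (cvgN (C1_cont hf Ux)).
- exact: (haspN (C1_hasp b hf Ux)).
- exact: (cvgN (C1_pd_cont (b:=b) hf Ux)).
Qed.

Lemma C1B U f g : open U -> C1 U f -> C1 U g -> C1 U (fun z => f z - g z).
Proof. by move=> oU hf hg; exact: (C1D oU hf (C1N oU hg)). Qed.

Lemma C1M U f g : open U -> C1 U f -> C1 U g -> C1 U (fun z => f z *c g z).
Proof.
move=> oU hf hg; apply: (C1I (D := fun b z => pD b f z *c g z + f z *c pD b g z) oU) => [x Ux|b x Ux|b x Ux].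
- exact: (cvg_cmul (C1_cont hf Ux) (C1_cont hg Ux)).
- exact: (haspM (C1_hasp b hf Ux) (C1_hasp b hg Ux)).
- have [cf cg] := (C1_cont hf Ux, C1_cont hg Ux).
  have [df dg] := (C1_pd_cont (b:=b) hf Ux, C1_pd_cont (b:=b) hg Ux).
  exact: (cvgD (cvg_cmul df cg) (cvg_cmul cf dg)).
Qed.

Lemma C1_cinv U f : open U -> (forall x, U x -> f x != 0) -> C1 U f -> C1 U (fun z => cinv (f z)).
Proof.
move=> oU f0 hf; apply: (C1I (D := fun b z => - (cinv (f z) *c cinv (f z) *c pD b f z)) oU) => [x Ux|b x Ux|b x Ux].
- exact: (cvg_cinv (f0 _ Ux) (C1_cont hf Ux)).
- exact: (hasp_cinv (f0 _ Ux) (C1_hasp b hf Ux)).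
- have cf := C1_cont hf Ux; have df := C1_pd_cont (b:=b) hf Ux.
  have ci : cinv (f t) @[t --> x] --> cinv (f x) by exact: (cvg_cinv (f0 _ Ux) cf).
  by apply: cvgN; exact: (cvg_cmul (cvg_cmul ci ci) df).
Qed.

Lemma hasp_id b x : hasp b id x (if b then cI R else cone R).
Proof.
by apply/hasp_rpd; split; case: b; first [exact: rpd_fst | exact: rpd_snd
  | exact: (rpd_fst true) | exact: (rpd_fst false) | exact: (rpd_snd true) | exact: (rpd_snd false)].
Qed.

Lemma C1_id U : open U -> C1 U id.
Proof.
move=> oU; apply: (C1I (D := fun b _ => if b then cI R else cone R) oU) => [x Ux|b x Ux|b x Ux].
- exact: cvg_id.
- exact: hasp_id.
- exact: cvg_cst.
Qed.

Lemma smooth_onP U f : smooth_on U f <-> forall s, C1 U (pds s f).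
Proof.
split.
  move=> h s; split => x Ux; have [c d] := h s x Ux; split; first exact: c.
  by move=> b; split; [exact: d | rewrite pDE; have [] := h (b :: s) x Ux].
by move=> h s x Ux; have [c d] := C1P (h s) Ux; split; [exact: c | move=> b; have [] := d b].
Qed.

Lemma smooth_C1 U f : smooth_on U f -> C1 U f.
Proof. by move/smooth_onP => /(_ [::]). Qed.

Lemma smooth_sub U V f : U `<=` V -> smooth_on V f -> smooth_on U f.
Proof. by move=> UV h s x /UV; exact: h. Qed.

Lemma pds_rcons s b f : pds (rcons s b) f = pds s (pD b f).
Proof. by rewrite /pds foldr_rcons pDE. Qed.

Lemma pds_cons s b f : pds (b :: s) f = pD b (pds s f).
Proof. by rewrite pDE. Qed.

Lemma smooth_pd U f b : smooth_on U f -> smooth_on U (pD b f).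
Proof. by move=> /smooth_onP h; apply/smooth_onP => s; rewrite -pds_rcons; exact: h. Qed.

Lemma dbarE f x l m : hasp false f x l -> hasp true f x m ->
  dB f x = creal 2^-1 *c (l + cI R *c m).
Proof. by move=> h1 h2; rewrite !dBE (hasp_pd h1) (hasp_pd h2). Qed.

Lemma dbar_near f g x : (\near x, f x = g x) -> dB f x = dB g x.
Proof. by move=> fg; rewrite !dBE !(pd_near _ fg). Qed.

Lemma dbar_cst (c : P) x : dB (cst c) x = 0.
Proof. by rewrite (dbarE (hasp_cst _ _ _) (hasp_cst _ _ _)) cmul0r addr0 cmul0r. Qed.

Lemma dbar_id x : dB id x = 0.
Proof.
rewrite (dbarE (hasp_id _ _) (hasp_id _ _)) -[cI R *c cI R]cmul1r -cmulA cI2.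
by rewrite subrr cmul0r.
Qed.

Lemma dbarD U f g x : C1 U f -> C1 U g -> U x ->
  dB (fun z => f z + g z) x = dB f x + dB g x.
Proof.
move=> hf hg Ux; rewrite (dbarE (haspD (C1_hasp _ hf Ux) (C1_hasp _ hg Ux))
  (haspD (C1_hasp _ hf Ux) (C1_hasp _ hg Ux))) !dBE.
move: (pD _ f x) (pD _ f x) (pD _ g x) (pD _ g x) (f x) (g x) => f1 f2 g1 g2 f0 g0.
by apply: pair_ext; rewrite /=; ring.
Qed.

Lemma dbarN U f x : C1 U f -> U x -> dB (fun z => - f z) x = - dB f x.
Proof.
move=> hf Ux; rewrite (dbarE (haspN (C1_hasp _ hf Ux)) (haspN (C1_hasp _ hf Ux))).
rewrite !dBE; move: (pD _ f x) (pD _ f x) => f1 f2.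
by apply: pair_ext; rewrite /=; ring.
Qed.

Lemma dbarB U f g x : open U -> C1 U f -> C1 U g -> U x ->
  dB (fun z => f z - g z) x = dB f x - dB g x.
Proof. by move=> oU hf hg Ux; rewrite (dbarD hf (C1N oU hg) Ux) (dbarN hg Ux). Qed.

Lemma dbarM U f g x : C1 U f -> C1 U g -> U x ->
  dB (fun z => f z *c g z) x = dB f x *c g x + f x *c dB g x.
Proof.
move=> hf hg Ux; rewrite (dbarE (haspM (C1_hasp _ hf Ux) (C1_hasp _ hg Ux))
  (haspM (C1_hasp _ hf Ux) (C1_hasp _ hg Ux))) !dBE.
move: (pD _ f x) (pD _ f x) (pD _ g x) (pD _ g x) (f x) (g x) => f1 f2 g1 g2 f0 g0.
by apply: pair_ext; rewrite /=; ring.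
Qed.

(** The Cauchy-Riemann form of holomorphy, suited to integration by parts. Complex
    differentiability, in the sense of [entire], is brought to this form by Goursat's argument in
    [entire_hol]. *)
Definition hol U f := C1 U f /\ forall x, U x -> dB f x = 0.

Lemma dbar_cinv U f x : (forall x, U x -> f x != 0) -> C1 U f -> U x -> dB f x = 0 ->
  dB (fun z => cinv (f z)) x = 0.
Proof.
move=> f0 hf Ux e.
have h b := hasp_cinv (f0 _ Ux) (C1_hasp b hf Ux).
rewrite (dbarE (h _) (h _)); rewrite -[RHS](cmul0r (- (cinv (f x) *c cinv (f x)))) -e !dBE.
move: (pD _ f x) (pD _ f x) (cinv _) => f1 f2 w.
by apply: pair_ext; rewrite /=; ring.
Qed.

Lemma holD U f g : open U -> hol U f -> hol U g -> hol U (fun z => f z + g z).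
Proof.
move=> oU [f1 f2] [g1 g2]; split; first exact: C1D.
by move=> x Ux; rewrite (dbarD f1 g1 Ux) f2 // g2 // addr0.
Qed.
Lemma holN U f : open U -> hol U f -> hol U (fun z => - f z).
Proof.
move=> oU [f1 f2]; split; first exact: C1N.
by move=> x Ux; rewrite (dbarN f1 Ux) f2 // oppr0.
Qed.
Lemma holM U f g : open U -> hol U f -> hol U g -> hol U (fun z => f z *c g z).
Proof.
move=> oU [f1 f2] [g1 g2]; split; first exact: C1M.
by move=> x Ux; rewrite (dbarM f1 g1 Ux) f2 // g2 // cmul0l cmul0r addr0.
Qed.
Lemma hol_cinv U f : open U -> (forall x, U x -> f x != 0) -> hol U f -> hol U (fun z => cinv (f z)).
Proof.
move=> oU f0 [f1 f2]; split; first exact: C1_cinv.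
by move=> x Ux; apply: (dbar_cinv f0 f1 Ux); exact: f2.
Qed.
Lemma hol_cst U (c : P) : hol U (cst c).
Proof. by split; [exact: C1_cst | move=> x _; exact: dbar_cst]. Qed.
Lemma hol_id U : open U -> hol U id.
Proof. by move=> oU; split; [exact: C1_id | move=> x _; exact: dbar_id]. Qed.
Lemma hol_sub U V f : U `<=` V -> hol V f -> hol U f.
Proof. by move=> UV [f1 f2]; split; [exact: C1_sub f1 | move=> x /UV; exact: f2]. Qed.
Lemma hol_near U f g : (forall x, U x -> \near x, f x = g x) -> hol U f -> hol U g.
Proof.
move=> fg [f1 f2]; split; first exact: C1_near f1.
by move=> x Ux; rewrite -(dbar_near (fg x Ux)) f2.
Qed.
Lemma hol_eq U f g : open U -> (forall x, U x -> f x = g x) -> hol U f -> hol U g.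
Proof. by move=> oU fg; apply: hol_near => x; exact: open_near. Qed.

End C1Functions.

(** * Planar integration *)

Section PlaneMeasure.
Variable R : realType.
Local Notation P := (R * R)%type.
Local Notation mu := (@leb2 R).
Local Notation leb := (@lebesgue_measure R).
Implicit Types (z w u x y : P) (U V : set P) (F G : P -> P).

Definition sq (a : P) (r : R) : set P := [set z | `|z - a| <= r].

Lemma square_nbhs x U : nbhs x U <-> exists2 r : R, 0 < r & forall y, `|y - x| < r -> U y.
Proof.
split.
  move=> /nbhs_ballP[r /= r0 h]; exists r => // y yx; apply: h.
  by rewrite -ball_normE /= distrC.
move=> [r r0 h]; apply/nbhs_ballP; exists r => //= y.
by rewrite -ball_normE /= distrC; exact: h.
Qed.

Lemma open_square U x : open U -> U x -> exists2 r : R, 0 < r & forall y, `|y - x| < r -> U y.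
Proof. by move=> oU Ux; apply/square_nbhs; exact: open_nbhs_nbhs. Qed.

Lemma openP_square U : (forall x, U x -> exists2 r : R, 0 < r & forall y, `|y - x| < r -> U y) ->
  open U.
Proof. by move=> h; rewrite openE => x Ux; apply/square_nbhs; exact: h. Qed.

Lemma open_measurable2 U : open U -> measurable (U : set (measurableTypeR R * measurableTypeR R)).
Proof.
move=> oU.
pose S (p : rat * rat * rat) : set P :=
  ball (ratr p.1.1 : R) (ratr p.2) `*` ball (ratr p.1.2 : R) (ratr p.2).
pose T p := if `[< S p `<=` U >] then S p else set0.
have -> : U = \bigcup_p T p.
  apply/seteqP; split => [x Ux|x [p _]]; last first.
    by rewrite /T; case: ifPn => // /asboolP; exact.
  have [r r0 rU] := open_square oU Ux.
  (* The rational centre is within [r / 4] of [x] and the rational radius lies between [r / 4] and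
     [r / 2]: the square contains [x] and stays within [3 r / 4] of it. *)
  have [q1] : exists q, ratr q \in `]x.1, x.1 + r / 4[ by apply: rat_in_itvoo; lra.
  have [q2] : exists q, ratr q \in `]x.2, x.2 + r / 4[ by apply: rat_in_itvoo; lra.
  have [q] : exists q, ratr q \in `](r / 4), (r / 2)[ by apply: rat_in_itvoo; lra.
  rewrite !in_itv /= => /andP[q3 q4] /andP[q5 q6] /andP[q7 q8].
  exists (q1, q2, q) => //; rewrite /T asboolT.
    by split; rewrite -ball_normE /= ltr_norml; apply/andP; split; lra.
  move=> y [] /=; rewrite -!ball_normE /= !ltr_norml => /andP[h1 h2] /andP[h3 h4].
  by apply: rU; apply: normP_lt; rewrite /= ltr_norml; apply/andP; split; lra.
apply: countable_bigcupT_measurable => // p; rewrite /T; case: ifPn => // _.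
by apply: measurableX; exact: measurable_ball.
Qed.

Lemma closed_measurable2 U : closed U -> measurable (U : set (measurableTypeR R * measurableTypeR R)).
Proof. by move/closed_openC/open_measurable2/measurableC; rewrite setCK. Qed.

Lemma cont_measurable_on U (f : P -> R) : open U -> (forall x, U x -> {for x, continuous f}) ->
  measurable_fun U f.
Proof.
move=> oU fc; apply: (measurability _ (RGenOpens.measurableE R)).
move=> _ [_ [a [b ->] <-]]; apply: open_measurable2.
rewrite openE => x [Ux fx]; apply: filterI; first exact: open_nbhs_nbhs.
apply: (fc x Ux); apply: open_nbhs_nbhs; split; first exact: interval_open.
by [].
Qed.

Definition cmeas (F : P -> P) := measurable_fun [set: P] (fun y => (F y).1) /\
  measurable_fun [set: P] (fun y => (F y).2).

(** Extension by zero, which lets integrals of plane-valued functions run over the whole plane. *)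
Definition cext U (F : P -> P) : P -> P := fun y => if `[< U y >] then F y else 0.

Lemma cext_in U F x : U x -> cext U F x = F x.
Proof. by move=> Ux; rewrite /cext asboolT. Qed.
Lemma cext_out U F x : ~ U x -> cext U F x = 0.
Proof. by move=> Ux; rewrite /cext asboolF. Qed.

Lemma cmeas_ext U F : measurable (U : set (measurableTypeR R * measurableTypeR R)) ->
  measurable_fun U (fun y => (F y).1) -> measurable_fun U (fun y => (F y).2) -> cmeas (cext U F).
Proof.
move=> mU m1 m2; split.
  have := (measurable_restrictT _ mU).1 m1; congr measurable_fun.
  by apply/funext => y; rewrite /cext /patch; case: asboolP => h; rewrite ?(mem_set h) ?(memNset h).
have := (measurable_restrictT _ mU).1 m2; congr measurable_fun.
by apply/funext => y; rewrite /cext /patch; case: asboolP => h; rewrite ?(mem_set h) ?(memNset h).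
Qed.

Lemma cmeas_cont U F : open U -> (forall x, U x -> {for x, continuous F}) -> cmeas (cext U F).
Proof.
move=> oU Fc; apply: cmeas_ext; first exact: open_measurable2.
  apply: (cont_measurable_on oU) => x Ux; exact: (cvg_fstP (Fc x Ux)).
apply: (cont_measurable_on oU) => x Ux; exact: (cvg_sndP (Fc x Ux)).
Qed.

Lemma cmeas_eq F G : F =1 G -> cmeas F -> cmeas G.
Proof. by move=> /funext ->. Qed.

Lemma cmeas_contT F : (forall x, {for x, continuous F}) -> cmeas F.
Proof.
move=> h; apply: (@cmeas_eq (cext setT F)); first by move=> y; rewrite cext_in.
by apply: cmeas_cont => //; exact: openT.
Qed.

Lemma cmeasD F G : cmeas F -> cmeas G -> cmeas (fun y => F y + G y).
Proof. by move=> [f1 f2] [g1 g2]; split; exact: measurable_funD. Qed.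
Lemma cmeasN F : cmeas F -> cmeas (fun y => - F y).
Proof.
by move=> [f1 f2]; split; [exact: measurable_funN f1 | exact: measurable_funN f2].
Qed.
Lemma cmeasB F G : cmeas F -> cmeas G -> cmeas (fun y => F y - G y).
Proof. by move=> hF hG; exact: (cmeasD hF (cmeasN hG)). Qed.
Lemma cmeasM F G : cmeas F -> cmeas G -> cmeas (fun y => F y *c G y).
Proof.
move=> [f1 f2] [g1 g2]; split => /=.
  by apply: measurable_funB; exact: measurable_funM.
by apply: measurable_funD; exact: measurable_funM.
Qed.
Lemma cmeas_cst (c : P) : cmeas (cst c).
Proof. by split; exact: measurable_cst. Qed.

Lemma cmeas_cext U F : measurable (U : set (measurableTypeR R * measurableTypeR R)) ->
  cmeas F -> cmeas (cext U F).
Proof. by move=> mU [f1 f2]; apply: cmeas_ext => //; exact: measurable_funTS. Qed.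

Lemma cmeas_pair F : cmeas F <-> measurable_fun [set: P] F.
Proof.
split=> [[a b]|h].
  have := measurable_fun_pair a b; congr measurable_fun.
  by apply/funext => x; rewrite -surjective_pairing.
by split; [exact: (measurableT_comp measurable_fst h) | exact: (measurableT_comp measurable_snd h)].
Qed.

Lemma cmeas_comp F G : cmeas F -> cmeas G -> cmeas (F \o G).
Proof. by move=> /cmeas_pair f /cmeas_pair g; apply/cmeas_pair; exact: measurableT_comp. Qed.

Lemma cmeas_reflect x : cmeas (fun y => x - y).
Proof.
apply: cmeasB; first exact: cmeas_cst.
by apply/cmeas_pair; exact: measurable_id.
Qed.

Lemma cmeas_norm F : cmeas F -> measurable_fun [set: P] (fun y => `|F y|).
Proof.
move=> [f1 f2]; rewrite (_ : (fun y => _) = (fun y => Num.max `|(F y).1| `|(F y).2|)) //.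
by apply: measurable_maxr; exact: measurableT_comp.
Qed.

Lemma open_neq0 : open [set~ (0 : P)].
Proof.
apply: openP_square => x /eqP; rewrite -normr_gt0 => x0; exists `|x| => // y h y0.
by move: h; rewrite y0 sub0r normrN ltxx.
Qed.

Lemma cmeas_cinv : cmeas (@cinv R).
Proof.
have o := open_neq0.
apply: (@cmeas_eq (cext [set~ (0 : P)] (@cinv R))).
  move=> y; rewrite /cext; case: asboolP => // /contrapT ->.
  by rewrite cinv0.
by apply: cmeas_cont => // x /eqP x0; apply: cvg_cinv => //; exact: cvg_id.
Qed.

(** The preimage of []c, d]] is [[a - d, a - c[], of the same length, and half-open intervals
    determine the measure. *)
Lemma leb_reflect (a : R) (A : set (measurableTypeR R)) : measurable A ->
  pushforward leb (fun t => a - t : measurableTypeR R) A = leb A.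
Proof.
move=> mA.
have mf : measurable_fun [set: measurableTypeR R] (fun t => a - t : measurableTypeR R).
  by apply: measurable_funB => //; exact: measurable_cst.
apply/esym/lebesgue_measure_unique => //= _ [[c d]] _ <-.
rewrite /pushforward /=.
rewrite (_ : _ @^-1` _ = `[a - d, a - c[%classic); last first.
  by apply/seteqP; split=> t /=; rewrite !in_itv /= => /andP[h1 h2]; apply/andP; split; lra.
rewrite !lebesgue_measure_itv /= !lte_fin ltrD2l ltrN2.
by case: ifP => // _; congr (_%:E); ring.
Qed.

Lemma leb2_reflect x A : measurable (A : set (measurableTypeR R * measurableTypeR R)) ->
  pushforward mu (fun y : measurableTypeR R * measurableTypeR R =>
    x - y : measurableTypeR R * measurableTypeR R) A = mu A.
Proof.
move=> mA.
have mf : measurable_fun [set: measurableTypeR R * measurableTypeR R]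
    (fun y : P => x - y : measurableTypeR R * measurableTypeR R).
  by apply/cmeas_pair; exact: cmeas_reflect.
apply/esym/product_measure_unique => //= B C mB mC.
rewrite /pushforward /=.
rewrite (_ : _ @^-1` _ = ((fun t => x.1 - t) @^-1` B) `*` ((fun t => x.2 - t) @^-1` C)) //.
have m1 (a : R) : measurable_fun [set: measurableTypeR R] (fun t => a - t : measurableTypeR R).
  by apply: measurable_funB => //; exact: measurable_cst.
have m2 (a : R) (D : set (measurableTypeR R)) : measurable D ->
    measurable ((fun t => a - t) @^-1` D : set (measurableTypeR R)).
  by move=> mD; rewrite -[X in measurable X]setTI; exact: m1.
rewrite /leb2 product_measure1E; [|exact: m2|exact: m2].
by congr (_ * _)%E; exact: leb_reflect.
Qed.

Lemma ge0_integral_reflect x (h : P -> \bar R) : measurable_fun [set: P] h ->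
  (forall y, 0 <= h y)%E -> (\int[mu]_y h (x - y)%R = \int[mu]_y h y)%E.
Proof.
move=> mh h0.
have mf : measurable_fun [set: measurableTypeR R * measurableTypeR R]
    (fun y : P => x - y : measurableTypeR R * measurableTypeR R).
  by apply/cmeas_pair; exact: cmeas_reflect.
have := ge0_integral_pushforward mf mu measurableT mh (fun y _ => h0 y).
rewrite preimage_setT => <-.
by apply: eq_measure_integral => A mA _; exact: leb2_reflect.
Qed.

Lemma leb2_square (a : P) (r : R) : (mu (sq a r) < +oo)%E.
Proof.
rewrite /sq; have -> : [set z | `|z - a| <= r] = `[a.1 - r, a.1 + r]%classic `*` `[a.2 - r, a.2 + r]%classic.
  apply/seteqP; split => z /=; rewrite !in_itv /=.
    move=> h; have := le_trans (norm1_le _) h; have := le_trans (norm2_le _) h.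
    by rewrite /= !ler_norml => /andP[h1 h2] /andP[h3 h4]; split; apply/andP; split; lra.
  move=> [/andP[h1 h2] /andP[h3 h4]].
  by apply: normP_le; rewrite /= ler_norml; apply/andP; split; lra.
have e (c d : R) : exists k : R, leb `[c, d]%classic = k%:E.
  rewrite lebesgue_measure_itv /=; case: ifP => _; last by exists 0.
  by exists (d - c); rewrite EFinB.
have [k1 e1] := e (a.1 - r) (a.1 + r); have [k2 e2] := e (a.2 - r) (a.2 + r).
suff : (leb `[(a.1 - r)%R, (a.1 + r)%R]%classic * leb `[(a.2 - r)%R, (a.2 + r)%R]%classic < +oo)%E.
  by apply: le_lt_trans; rewrite /leb2 product_measure1E.
by rewrite e1 e2 -EFinM ltry.
Qed.


Fact cint_key : unit. Proof. exact: tt. Qed.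
(** The componentwise integral, locked so that unification does not unfold it to Lebesgue
    integrals. *)
Definition cint : (P -> P) -> P :=
  locked_with cint_key (fun F => (\int[mu]_y (F y).1, \int[mu]_y (F y).2)).

Lemma cintE F : cint F = (\int[mu]_y (F y).1, \int[mu]_y (F y).2).
Proof. by rewrite [cint]unlock. Qed.
Lemma cint1E F : (cint F).1 = \int[mu]_y (F y).1. Proof. by rewrite cintE. Qed.
Lemma cint2E F : (cint F).2 = \int[mu]_y (F y).2. Proof. by rewrite cintE. Qed.

Definition cintegrable (F : P -> P) := cmeas F /\ mu.-integrable setT (fun y => (`|F y|)%:E).

Lemma cintegrable1 F : cintegrable F -> mu.-integrable setT (fun y => ((F y).1)%:E).
Proof.
move=> [[m1 _]]; apply: le_integrable => //; first exact/measurable_EFinP.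
by move=> y _ /=; rewrite lee_fin normr_id norm1_le.
Qed.

Lemma cintegrable2 F : cintegrable F -> mu.-integrable setT (fun y => ((F y).2)%:E).
Proof.
move=> [[_ m2]]; apply: le_integrable => //; first exact/measurable_EFinP.
by move=> y _ /=; rewrite lee_fin normr_id norm2_le.
Qed.

Lemma cintegrable_le F (G : P -> R) : cmeas F -> (forall y, `|F y| <= G y) ->
  mu.-integrable setT (EFin \o G) -> cintegrable F.
Proof.
move=> mF FG hG; split => //; apply: le_integrable hG => //.
  by apply/measurable_EFinP; exact: cmeas_norm.
by move=> y _ /=; rewrite lee_fin normr_id (le_trans (FG y)) // ler_norm.
Qed.

Lemma cintegrableP F : cmeas F -> (\int[mu]_y (`|F y|)%:E < +oo)%E -> cintegrable F.
Proof.
move=> mF h; split => //; apply/integrableP; split.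
  by apply/measurable_EFinP; exact: cmeas_norm.
by under eq_integral do rewrite /= normr_id.
Qed.

Lemma cintegrable_eq F G : F =1 G -> cintegrable F -> cintegrable G.
Proof. by move=> /funext ->. Qed.

Lemma cint_eq F G : F =1 G -> cint F = cint G.
Proof. by move=> /funext ->. Qed.

Lemma cintegrableD F G : cintegrable F -> cintegrable G -> cintegrable (fun y => F y + G y).
Proof.
move=> [mF iF] [mG iG]; apply: (cintegrable_le (G := fun y => `|F y| + `|G y|)).
- exact: cmeasD.
- by move=> y; exact: ler_normD.
- by have := integrableD measurableT iF iG; apply: eq_integrable.
Qed.

Lemma cintD F G : cintegrable F -> cintegrable G -> cint (fun y => F y + G y) = cint F + cint G.
Proof.
move=> hF hG; apply: pair_ext; rewrite /= ?cint1E ?cint2E.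
  by rewrite -RintegralD //; exact: cintegrable1.
by rewrite -RintegralD //; exact: cintegrable2.
Qed.

Lemma cintegrableM (c : P) F : cintegrable F -> cintegrable (fun y => c *c F y).
Proof.
move=> [mF iF]; apply: (cintegrable_le (G := fun y => 2 * `|c| * `|F y|)).
- by apply: cmeasM => //; exact: cmeas_cst.
- by move=> y; rewrite -mulrA norm_cmul.
- by have := integrableZl measurableT (2 * `|c|) iF; apply: eq_integrable.
Qed.

Lemma cintM (c : P) F : cintegrable F -> cint (fun y => c *c F y) = c *c cint F.
Proof.
move=> hF; have [h1 h2] := (cintegrable1 hF, cintegrable2 hF).
have e (a b : R) (k l : P -> R) : mu.-integrable setT (fun y => (k y)%:E) ->
    mu.-integrable setT (fun y => (l y)%:E) ->
    \int[mu]_y (a * k y + b * l y) = a * \int[mu]_y k y + b * \int[mu]_y l y.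
  move=> hk hl; rewrite RintegralD //.
  - by rewrite !RintegralZl.
  - by have := integrableZl measurableT a hk; apply: eq_integrable.
  - by have := integrableZl measurableT b hl; apply: eq_integrable.
apply: pair_ext; rewrite /= ?cint1E ?cint2E; last exact: e.
by rewrite -mulNr -(e _ _ _ _ h1 h2); apply: eq_Rintegral => y _; rewrite mulNr.
Qed.

Lemma cintegrableN F : cintegrable F -> cintegrable (fun y => - F y).
Proof.
move=> hF; have := cintegrableM (- cone R) hF; apply: cintegrable_eq => y.
by rewrite cmulNl cmul1l.
Qed.

Lemma cintN F : cintegrable F -> cint (fun y => - F y) = - cint F.
Proof.
move=> hF; rewrite -[in RHS](cmul1l (cint F)) -cmulNl -cintM //; apply: cint_eq => y.
by rewrite cmulNl cmul1l.
Qed.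

Lemma cintegrableB F G : cintegrable F -> cintegrable G -> cintegrable (fun y => F y - G y).
Proof. by move=> hF hG; exact: (cintegrableD hF (cintegrableN hG)). Qed.

Lemma cintB F G : cintegrable F -> cintegrable G -> cint (fun y => F y - G y) = cint F - cint G.
Proof. by move=> hF hG; rewrite (cintD hF (cintegrableN hG)) cintN. Qed.

Lemma norm_cint F : cintegrable F -> `|cint F| <= \int[mu]_y `|F y|.
Proof.
move=> hF; have [h1 h2] := (cintegrable1 hF, cintegrable2 hF).
have [mF iF] := hF.
by apply: normP_le; rewrite ?cint1E ?cint2E (le_trans (le_normr_Rintegral _ _)) // le_Rintegral //;
  [exact: integrable_norm | move=> y _; exact: norm1_le |
   exact: integrable_norm | move=> y _; exact: norm2_le].
Qed.

Lemma norm_cint_le F (G : P -> R) : cmeas F -> (forall y, `|F y| <= G y) ->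
  mu.-integrable setT (EFin \o G) -> `|cint F| <= \int[mu]_y G y.
Proof.
move=> mF FG iG; have hF := cintegrable_le mF FG iG.
by apply: (le_trans (norm_cint hF)); apply: le_Rintegral => //; case: hF.
Qed.

Lemma norm_cint_ub F (A : R) : cmeas F -> (\int[mu]_y (`|F y|)%:E <= A%:E)%E -> `|cint F| <= A.
Proof.
move=> mF h; have hF : cintegrable F by apply: cintegrableP => //; apply: le_lt_trans h _; exact: ltry.
apply: (le_trans (norm_cint hF)).
rewrite -lee_fin /Rintegral fineK //; apply: integrable_fin_num => //; by case: hF.
Qed.

Lemma cint_dct (F : nat -> P -> P) G (H : P -> R) : (forall n, cmeas (F n)) ->
  (forall y, F n y @[n --> \oo] --> G y) -> (forall n y, `|F n y| <= H y) ->
  mu.-integrable setT (EFin \o H) ->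
  cintegrable G /\ cint (F n) @[n --> \oo] --> cint G.
Proof.
move=> mF FG FH iH.
have c1 y : (F n y).1 @[n --> \oo] --> (G y).1 by exact: cvg_fstP (FG y).
have c2 y : (F n y).2 @[n --> \oo] --> (G y).2 by exact: cvg_sndP (FG y).
have mG : cmeas G.
  split.
    by apply: (measurable_fun_cvg (h := fun n y => (F n y).1)) => [n|y _]; [have [] := mF n | exact: c1].
  by apply: (measurable_fun_cvg (h := fun n y => (F n y).2)) => [n|y _]; [have [] := mF n | exact: c2].
have iG : cintegrable G.
  apply: (cintegrable_le mG _ iH) => y.
  have h : `|F n y| @[n --> \oo] --> `|G y| by apply: cvg_norm; exact: FG.
  rewrite -(cvg_lim _ h) //; apply: limr_le; first by apply/cvg_ex; eexists; exact: h.
  by apply: nearW => n; exact: FH.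
have [i1 i2] := (cintegrable1 iG, cintegrable2 iG).
split=> //; rewrite cintE; under eq_fun do rewrite cintE.
apply: cvg_prod.
  apply: fine_cvg; rewrite fineK; last exact: integrable_fin_num.
  apply: (@dominated_cvg _ _ _ mu _ measurableT (fun n y => ((F n y).1)%:E) _ (EFin \o H)) => //.
  - by move=> n; apply/measurable_EFinP; have [] := mF n.
  - by move=> y _; apply: cvg_EFin; [exact: nearW | exact: c1].
  - by move=> n y _; rewrite /= lee_fin (le_trans (norm1_le _)).
apply: fine_cvg; rewrite fineK; last exact: integrable_fin_num.
apply: (@dominated_cvg _ _ _ mu _ measurableT (fun n y => ((F n y).2)%:E) _ (EFin \o H)) => //.
- by move=> n; apply/measurable_EFinP; have [] := mF n.
- by move=> y _; apply: cvg_EFin; [exact: nearW | exact: c2].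
- by move=> n y _; rewrite /= lee_fin (le_trans (norm2_le _)).
Qed.

Lemma Rintegral_reflect x (h : P -> R) : mu.-integrable setT (fun y => (h y)%:E) ->
  mu.-integrable setT (fun y => (h (x - y))%:E) /\ \int[mu]_y h (x - y) = \int[mu]_y h y.
Proof.
move=> ih; have [mh hoo] := integrableP _ _ _ ih.
have mh1 : measurable_fun [set: P] h by exact/measurable_EFinP.
have mr : measurable_fun [set: P] (fun y => h (x - y)).
  apply: (measurableT_comp mh1); apply/cmeas_pair; exact: cmeas_reflect.
have ma : measurable_fun [set: P] (fun y => `|(h y)%:E|%E) by exact: measurableT_comp.
have hr : mu.-integrable setT (fun y => (h (x - y))%:E).
  apply/integrableP; split; first exact/measurable_EFinP.
  by rewrite (@ge0_integral_reflect x (fun y => `|(h y)%:E|%E)).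
split=> //; rewrite /Rintegral [in LHS]integralE [in RHS]integralE.
congr (fine (_ - _)%E).
  rewrite -(@ge0_integral_reflect x (fun y => (h y)%:E)^\+%E (measurable_funepos mh) (funepos_ge0 _)).
  by apply: eq_integral => y _; rewrite !funeposE.
rewrite -(@ge0_integral_reflect x (fun y => (h y)%:E)^\-%E (measurable_funeneg mh) (funeneg_ge0 _)).
  by apply: eq_integral => y _; rewrite !funenegE.
Qed.

Lemma cintegrable_reflect x F : cintegrable F -> cintegrable (fun y => F (x - y)).
Proof.
move=> [mF iF]; split; last by have [] := Rintegral_reflect x iF.
by apply: (cmeas_comp mF); exact: cmeas_reflect.
Qed.

Lemma cint_reflect x F : cintegrable F -> cint (fun y => F (x - y)) = cint F.
Proof.
move=> hF; have [_ h1] := Rintegral_reflect x (cintegrable1 hF).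
have [_ h2] := Rintegral_reflect x (cintegrable2 hF).
by apply: pair_ext; rewrite ?cint1E ?cint2E.
Qed.

Lemma measurable_square (a : P) (r : R) :
  measurable (sq a r : set (measurableTypeR R * measurableTypeR R)).
Proof.
apply: closed_measurable2.
rewrite /sq; have -> : [set z | `|z - a| <= r] = (fun z => `|z - a|) @^-1` [set t | t <= r] by [].
apply: preimage_closed; last exact: closed_le.
by move=> z _; apply: cvg_norm; apply: cvgB; [exact: cvg_id | exact: cvg_cst].
Qed.

Lemma integrable_square (a : P) (r c : R) :
  mu.-integrable setT (EFin \o (fun y => c * \1_(sq a r) y)).
Proof.
have mS := measurable_square a r.
have h : mu.-integrable setT (EFin \o \1_(sq a r)).
  apply/integrableP; split; first exact/measurable_EFinP/measurable_indic.
  under eq_integral do rewrite /= ger0_norm //.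
  by rewrite integral_indic // setIT leb2_square.
have := integrableZl measurableT c h.
by apply: eq_integrable.
Qed.

Lemma bounded_le_indic F (a : P) (r c : R) : (forall y, `|F y| <= c) ->
  (forall y, r < `|y - a| -> F y = 0) -> forall y, `|F y| <= c * \1_(sq a r) y.
Proof.
move=> Fc F0 y; rewrite indicE; have [h|h] := leP `|y - a| r; first by rewrite mem_set // mulr1.
by rewrite F0 // normr0 memNset ?mulr0 //= => /le_lt_trans /(_ h); rewrite ltxx.
Qed.

Lemma cintegrable_bounded F (a : P) (r c : R) : cmeas F -> (forall y, `|F y| <= c) ->
  (forall y, r < `|y - a| -> F y = 0) -> cintegrable F.
Proof.
by move=> mF Fc F0; apply: (cintegrable_le mF (bounded_le_indic Fc F0)); exact: integrable_square.
Qed.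

Lemma norm_cint_bounded F (a : P) (r c : R) : cmeas F -> (forall y, `|F y| <= c) ->
  (forall y, r < `|y - a| -> F y = 0) ->
  `|cint F| <= c * fine (mu (sq a r)).
Proof.
move=> mF Fc F0.
apply: (le_trans (norm_cint_le mF (bounded_le_indic Fc F0) (integrable_square a r c))).
have h : mu.-integrable setT (EFin \o \1_(sq a r)).
  by have := integrable_square a r 1; apply: eq_integrable => // y _; rewrite /= mul1r.
rewrite RintegralZl // /Rintegral integral_indic //; last exact: measurable_square.
by rewrite setIT.
Qed.

End PlaneMeasure.

(** * Local integrability of the Cauchy kernel *)

Section CauchyKernel.
Variable R : realType.
Local Notation P := (R * R)%type.
Local Notation mu := (@leb2 R).
Local Notation leb := (@lebesgue_measure R).
Implicit Types (z w u x y : P) (U V : set P) (F G : P -> P).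

Lemma leb2_sq (a : P) (r : R) : 0 <= r -> mu (sq a r) = ((2 * r) ^+ 2)%:E.
Proof.
move=> r0.
have -> : sq a r = `[a.1 - r, a.1 + r]%classic `*` `[a.2 - r, a.2 + r]%classic.
  apply/seteqP; split => z; rewrite /sq /= !in_itv /=.
    move=> h; have := le_trans (norm1_le _) h; have := le_trans (norm2_le _) h.
    by rewrite /= !ler_norml => /andP[h1 h2] /andP[h3 h4]; split; apply/andP; split; lra.
  move=> [/andP[h1 h2] /andP[h3 h4]].
  by apply: normP_le; rewrite /= ler_norml; apply/andP; split; lra.
have e (c : R) : leb `[c - r, c + r]%classic = (2 * r)%:E.
  rewrite lebesgue_measure_itv /= lte_fin; case: ifPn => h; last by congr (_%:E); lra.
  by rewrite -EFinB; congr (_%:E); ring.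
transitivity (leb `[(a.1 - r)%R, (a.1 + r)%R]%classic * leb `[(a.2 - r)%R, (a.2 + r)%R]%classic)%E.
  by rewrite /leb2 product_measure1E.
by rewrite !e -EFinM expr2.
Qed.

Lemma dyadic (M t : R) : 0 < t -> t <= M -> exists k : nat, M / 2 ^+ k.+1 < t <= M / 2 ^+ k.
Proof.
move=> t0 tM.
have ex : exists k : nat, M / 2 ^+ k.+1 < t.
  exists (Num.truncn (M / t)); rewrite ltr_pdivrMr ?exprn_gt0 // mulrC -ltr_pdivrMr //.
  apply: (lt_trans (truncnS_gt _)).
  by rewrite -natrX ltr_nat ltn_expl.
case: (ex_minnP ex) => k h kmin; exists k; rewrite h /=.
case: k h kmin => [|k] h kmin; first by rewrite expr0 divr1.
by rewrite leNgt; apply/negP => /kmin; rewrite ltnn.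
Qed.

(* Dyadic annuli: 1/|y| <= 2^(k+1)/M on the k-th one, whose area is O(4^-k). *)
Lemma integrable_norm_inv (M : R) : 0 < M ->
  mu.-integrable setT (EFin \o (fun y => `|y|^-1 * \1_(sq 0 M) y)).
Proof.
move=> M0; have M20 k : 0 < M / 2 ^+ k by rewrite divr_gt0 ?exprn_gt0.
have mS r := measurable_square (0 : P) r.
have m1 r : measurable_fun [set: P] (\1_(sq 0 r) : P -> R) by exact: measurable_indic (mS r).
have mh : measurable_fun [set: P] (fun y => `|y|^-1 * \1_(sq 0 M) y).
  apply: measurable_funM; last exact: m1.
  have e : open [set~ (0 : P)] := @open_neq0 R.
  have h : measurable_fun [set~ (0 : P)] (fun y => `|y|^-1).
    apply: (cont_measurable_on e) => x /eqP x0; apply: cvgV; first by rewrite normr_eq0.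
    by apply: cvg_norm; exact: cvg_id.
  have := (measurable_restrictT _ (open_measurable2 e)).1 h; congr measurable_fun.
  apply/funext => y; rewrite /patch; have [->|y0] := eqVneq y 0.
    by rewrite memNset ?normr0 ?invr0 //= => /(_ erefl).
  by rewrite mem_set //=; apply/eqP.
apply/integrableP; split; first exact/measurable_EFinP.
pose f k y : \bar R := (2 ^+ k.+1 / M * \1_(sq 0 (M / 2 ^+ k)) y)%:E.
have f0 k y : (0 <= f k y)%E.
  by rewrite lee_fin mulr_ge0 // divr_ge0 ?exprn_ge0 // ltW.
have mf k : measurable_fun setT (f k).
  by apply/measurable_EFinP; apply: measurable_funM => //; exact: m1.
apply: (@le_lt_trans _ _ (\int[mu]_y (\sum_(k <oo) f k y))%E).
  apply: ge0_le_integral => //.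
  - by apply: measurableT_comp => //; exact/measurable_EFinP.
  - have h : measurable_fun setT (fun y => (\sum_(k <oo | k \in xpredT) f k y)%E).
      by apply: ge0_emeasurable_sum => [k y _ _|k _]; [exact: f0 | exact: mf].
    exact: h.
  - move=> y _ /=; rewrite ger0_norm ?mulr_ge0 ?invr_ge0 //.
    have [y0|y0] := eqVneq y 0.
      by rewrite y0 normr0 invr0 mul0r; apply: nneseries_ge0.
    rewrite indicE; have [h|h] := boolP (y \in sq 0 M); last by rewrite mulr0; exact: nneseries_ge0.
    move: h; rewrite inE /sq /= subr0 => yM.
    have [|k /andP[k1 k2]] := dyadic _ yM; first by rewrite normr_gt0.
    apply: (@le_trans _ _ (f k y)).
      rewrite /f indicE mem_set; last by rewrite /sq /= subr0.
      rewrite !mulr1 lee_fin -[leRHS]invrK lef_pV2 ?posrE ?normr_gt0 ?invr_gt0 ?divr_gt0 ?exprn_gt0 //.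
      by rewrite invf_div ltW.
    have := @nneseries_lim_ge R (f ^~ y) xpredT 0 k.+1 (fun n _ _ => f0 n y).
    apply: le_trans; rewrite big_nat_recr //= leeDr //.
    by apply: sume_ge0.
rewrite integral_nneseries //.
(* Height [2 ^+ k.+1 / M] times the area [(2 * M / 2 ^+ k) ^+ 2] of the square; the series then sums
   to [16 * M]. *)
have e k : (\int[mu]_y f k y = (8 * M / 2 ^+ k)%:E)%E.
  rewrite /f; under eq_integral do rewrite EFinM.
  rewrite ge0_integralZl //.
  - rewrite integral_indic // setIT.
    transitivity ((2 ^+ k.+1 / M)%:E * ((2 * (M / 2 ^+ k)) ^+ 2)%:E)%E.
      by congr (_ * _)%E; exact: leb2_sq (ltW (M20 k)).
    rewrite -EFinM; congr (_%:E); rewrite exprS.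
    have : (2 ^+ k : R) != 0 by rewrite expf_neq0.
    by move: M0 => /lt0r_neq0; move: (2 ^+ k) => c ? ?; field; apply/andP.
  - by apply/measurable_EFinP; exact: m1.
  - by rewrite lee_fin divr_ge0 ?exprn_ge0 // ltW.
under eq_eseriesr do rewrite e.
have h := @cvg_geometric_eseries_half R (16 * M) 0.
rewrite (_ : (\sum_(0 <= k <oo) (8 * M / 2 ^+ k)%:E)%E = (16 * M / 2 ^+ 0)%:E) ?ltry //.
rewrite -(cvg_lim _ h) //; congr (limn _); apply/funext => n; apply: eq_bigr => k _.
rewrite natrX addn1 exprS; congr (_%:E).
have : (2 ^+ k : R) != 0 by rewrite expf_neq0.
by move: (2 ^+ k) => c ?; field.
Qed.
End CauchyKernel.

(** * Integration by parts in the plane *)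

Section PlaneIBP.
Variable R : realType.
Local Notation P := (R * R)%type.
Local Notation mu := (@leb2 R).
Local Notation leb := (@lebesgue_measure R).
Implicit Types (z w u x y : P) (U V : set P) (F G : P -> P).

Lemma sq_compact (a : P) (r : R) : compact (sq a r).
Proof.
have -> : sq a r = `[a.1 - r, a.1 + r]%classic `*` `[a.2 - r, a.2 + r]%classic.
  apply/seteqP; split => z; rewrite /sq /= !in_itv /=.
    move=> h; have := le_trans (norm1_le _) h; have := le_trans (norm2_le _) h.
    by rewrite /= !ler_norml => /andP[h1 h2] /andP[h3 h4]; split; apply/andP; split; lra.
  move=> [/andP[h1 h2] /andP[h3 h4]].
  by apply: normP_le; rewrite /= ler_norml; apply/andP; split; lra.
by apply: compact_setX; exact: segment_compact.
Qed.

Lemma compact_bound (K : set P) F : compact K -> (forall x, K x -> {for x, continuous F}) ->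
  exists2 C : R, 0 < C & forall x, K x -> `|F x| <= C.
Proof.
move=> cK Fc.
have cF : compact (F @` K).
  by apply: continuous_compact => //; apply: continuous_in_subspaceT => x /set_mem; exact: Fc.
have [M [Mr MF]] := compact_bounded cF.
exists (Num.max M 0 + 1); first by rewrite ltr_pwDr // le_max lexx orbT.
by move=> x Kx; apply: MF; [rewrite ltr_pwDr // le_max lexx | exists x].
Qed.

Lemma support_bound F (a : P) (r : R) : (forall x, {for x, continuous F}) ->
  (forall x, r < `|x - a| -> F x = 0) -> exists2 C : R, 0 < C & forall x, `|F x| <= C.
Proof.
move=> Fc F0; have [C C0 FC] := compact_bound (@sq_compact a r) (fun x _ => Fc x).
exists C => // x; have [h|h] := leP `|x - a| r; first exact: FC.
by rewrite F0 // normr0 ltW.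
Qed.

Lemma integral_derive0 (h d : R -> R) (M : R) : 0 < M -> (forall t, is_derive t (1:R) h (d t)) ->
  (forall t, {for t, continuous d}) -> (forall t, M <= `|t| -> h t = 0 /\ d t = 0) ->
  (\int[leb]_t (d t)%:E = 0)%E.
Proof.
move=> M0 hd dc h0.
have dh t : derivable h t 1 by exact: (@ex_derive _ _ _ _ _ _ _ (hd t)).
have ch t : {for t, continuous h} by exact/differentiable_continuous/derivable1_diffP.
transitivity (\int[leb]_(t in `[(- M)%R, M]) (d t)%:E)%E.
  rewrite [RHS]integral_mkcond; apply: eq_integral => t _.
  rewrite /patch; case: ifPn => //; rewrite notin_setE /= in_itv /= => /negP.
  by rewrite -ler_norml -ltNge => /ltW /h0[_ ->].
rewrite (@continuous_FTC2 _ d h).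
- have [-> _] : h M = 0 /\ d M = 0 by apply: h0; rewrite gtr0_norm.
  have [-> _] : h (- M) = 0 /\ d (- M) = 0 by apply: h0; rewrite normrN gtr0_norm.
  by rewrite subee.
- lra.
- by apply: continuous_subspaceT => t; exact: dc.
- split; first by move=> t _; exact: dh.
  + by apply: cvg_at_right_filter; exact: ch.
  + by apply: cvg_at_left_filter; exact: ch.
- by move=> t _; rewrite derive1E; exact: (@derive_val _ _ _ _ _ _ _ (hd t)).
Qed.

Lemma cvg_line b x t (f : P -> R) : {for line b x t, continuous f} ->
  {for t, continuous (fun s => f (line b x s))}.
Proof.
move=> fc; apply: (@cvg_comp _ _ _ (line b x) f _ (nbhs (line b x t))); last exact: fc.
have := @line_cvg R b (line b x t); case: b {fc} => /=; exact.
Qed.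

(** Fubini with the differentiated variable innermost: each inner integral is that of the derivative
    of a compactly supported function of one variable. *)
Lemma integral_rpd0 b (h d : P -> R) (M : R) : 0 < M -> (forall x, rpd b h x (d x)) ->
  (forall x, {for x, continuous d}) -> mu.-integrable setT (EFin \o d) ->
  (forall x, M <= `|x| -> h x = 0 /\ d x = 0) ->
  \int[mu]_y d y = 0.
Proof.
move=> M0 hd dc id h0.
have line (x : P) : (\int[leb]_t (d (line b x t))%:E = 0)%E.
  apply: (@integral_derive0 (fun t => h (line b x t)) (fun t => d (line b x t)) M) => // [t|t|t Mt].
  - have := hd (line b x t); rewrite /rpd; case: b {hd} => /=; exact.
  - exact: cvg_line.
  - apply: h0; apply: (le_trans Mt).
    by case: b {hd} => /=; [exact: (norm2_le (x.1, t)) | exact: (norm1_le (t, x.2))].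
rewrite /Rintegral; case: b line {hd} => line.
  rewrite -(integral12_prod_meas1 id).
  rewrite integral0_eq // => x _; exact: (line (x, 0)).
rewrite -(integral21_prod_meas1 id).
rewrite integral0_eq // => y _; exact: (line (0, y)).
Qed.

Lemma pd_out b F (a : P) (r : R) : (forall x, r < `|x - a| -> F x = 0) ->
  forall x, r < `|x - a| -> pD b F x = 0.
Proof.
move=> F0 x rx; rewrite (@pd_near _ b F (cst 0)); first exact: (hasp_pd (hasp_cst b 0 x)).
apply/square_nbhs; exists (`|x - a| - r); first by rewrite subr_gt0.
move=> y yx; apply: F0; have := ler_normB (y - a) (y - x).
rewrite (_ : y - a - (y - x) = x - a); last by apply: pair_ext => /=; ring.
by move: yx; lra.
Qed.

Lemma dbar_out F (a : P) (r : R) : (forall x, r < `|x - a| -> F x = 0) ->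
  forall x, r < `|x - a| -> dB F x = 0.
Proof.
move=> F0 x rx; rewrite !dBE !(pd_out _ F0) //.
by rewrite cmul0r addr0 cmul0r.
Qed.

Lemma C1_dbar_cont U F x : C1 U F -> U x -> {for x, continuous (dB F)}.
Proof.
move=> hF Ux; have [h1 h2] := (C1_pd_cont (b:=false) hF Ux, C1_pd_cont (b:=true) hF Ux).
have -> : dB F = fun y => creal 2^-1 *c (pD false F y + cI R *c pD true F y).
  by apply/funext => y; rewrite dBE.
apply: cvg_cmul; first exact: cvg_cst.
apply: cvgD; first exact: h1.
by apply: cvg_cmul; [exact: cvg_cst | exact: h2].
Qed.

Lemma cintegrable_cont F (a : P) (r : R) : (forall x, {for x, continuous F}) ->
  (forall x, r < `|x - a| -> F x = 0) -> cintegrable F.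
Proof.
move=> Fc F0; have [C _ FC] := support_bound Fc F0.
exact: (cintegrable_bounded (cmeas_contT Fc) FC F0).
Qed.

Lemma cint_pd0 b F (M : R) : C1 setT F -> (forall x, M < `|x| -> F x = 0) ->
  cint (pD b F) = 0.
Proof.
move=> hF F0; pose M1 := Num.max M 0 + 1.
have M10 : 0 < M1 by rewrite ltr_pwDr // le_max lexx orbT.
have MM1 x : M1 <= `|x| -> M < `|x|.
  by apply: lt_le_trans; rewrite ltr_pwDr // le_max lexx.
have F0' x : M < `|x - 0| -> F x = 0 by rewrite subr0; exact: F0.
have pc x : {for x, continuous (pD b F)} by exact: (C1_pd_cont hF).
have ip := cintegrable_cont pc (pd_out b F0').
have p0 x : M1 <= `|x| -> pD b F x = 0 by move=> /MM1 h; apply: (pd_out b F0'); rewrite subr0.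
have hp x := (hasp_rpd b F x (pD b F x)).1 (C1_hasp b hF I).
apply: pair_ext; rewrite ?cint1E ?cint2E.
  apply: (@integral_rpd0 b (fun y => (F y).1) _ M1 M10 _ _ (cintegrable1 ip)) => [x|x|x h].
  - by case: (hp x).
  - exact: (cvg_fstP (pc x)).
  - by rewrite p0 // F0 //; exact: MM1.
apply: (@integral_rpd0 b (fun y => (F y).2) _ M1 M10 _ _ (cintegrable2 ip)) => [x|x|x h].
- by case: (hp x).
- exact: (cvg_sndP (pc x)).
- by rewrite p0 // F0 //; exact: MM1.
Qed.

(** Stokes' formula with compact support, hence without boundary term. *)
Lemma cint_dbar0 F (M : R) : C1 setT F -> (forall x, M < `|x| -> F x = 0) ->
  cint (dB F) = 0.
Proof.
move=> hF F0.
have F0' x : M < `|x - 0| -> F x = 0 by rewrite subr0; exact: F0.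
have ip b : cintegrable (pD b F).
  by apply: (@cintegrable_cont _ 0 M); [move=> x; exact: (C1_pd_cont hF) | exact: pd_out].
have iI := cintegrableM (cI R) (ip true).
rewrite (cint_eq (dBE F)) (cintM _ (cintegrableD (ip false) iI)) (cintD (ip false) iI) (cintM _ (ip true)).
by rewrite !(cint_pd0 _ hF F0) cmul0r addr0 cmul0r.
Qed.

End PlaneIBP.

(** * Fundamental solution *)

Section RegularisedKernel.
Variable R : realType.
Local Notation P := (R * R)%type.
Local Notation mu := (@leb2 R).
Local Notation leb := (@lebesgue_measure R).
Implicit Types (z w u x y : P) (U V : set P) (F G : P -> P).

(** The mean value theorem with the slope [c] subtracted and the end points in either order: [c = 0]
    gives Lipschitz bounds, and a nonzero [c] isolates the affine part of a function in Goursat's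
    argument. *)
Lemma mvt_le (h d : R -> R) (s t c L : R) :
  (forall u : R, (s <= u <= t) || (t <= u <= s) -> is_derive u (1:R) h (d u) /\ `|d u - c| <= L) ->
  `|h t - h s - c * (t - s)| <= L * `|t - s|.
Proof.
have gen (a b : R) : a <= b ->
    (forall u : R, a <= u <= b -> is_derive u (1:R) h (d u) /\ `|d u - c| <= L) ->
    `|h b - h a - c * (b - a)| <= L * `|b - a|.
  move=> ab hd.
  have df v : v \in `]a, b[ -> is_derive v (1:R) h (d v).
    by rewrite in_itv /= => /andP[v1 v2]; have [] := hd v; rewrite ?(ltW v1) ?(ltW v2).
  have cf : {within `[a, b], continuous h}.
    apply: continuous_in_subspaceT => v; rewrite inE /= in_itv /= => vab.
    have [dv _] := hd v vab.
    by apply/differentiable_continuous/derivable1_diffP; exact: (@ex_derive _ _ _ _ _ _ _ dv).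
  have [v] := MVT_segment ab df cf; rewrite in_itv /= => vab ->.
  by have [_ dv] := hd v vab; rewrite -mulrBl normrM ler_wpM2r.
move=> H; have [st|ts] := leP s t.
  by apply: gen => // u su; apply: H; rewrite su.
have -> : h t - h s - c * (t - s) = - (h s - h t - c * (s - t)) by ring.
by rewrite normrN (distrC t); apply: gen; [exact: ltW | move=> u su; apply: H; rewrite su orbT].
Qed.

Lemma mvt_line b F x (s t : R) (c : P) (L : R) :
  (forall u : R, (s <= u <= t) || (t <= u <= s) ->
    hasp b F (line b x u) (pD b F (line b x u)) /\ `|pD b F (line b x u) - c| <= L) ->
  `|F (line b x t) - F (line b x s) - (t - s) *: c| <= L * `|t - s|.
Proof.
move=> H.
have e (u : R) : co b (line b x u) = u by case: (b).
have l (u v : R) : line b (line b x u) v = line b x v by case: (b).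
apply: normP_le.
  have := @mvt_le (fun u : R => (F (line b x u)).1) (fun u : R => (pD b F (line b x u)).1) s t c.1 L.
  rewrite [(t - s) *: c]/(_ *: _) /= mulrC; apply => u /H[/hasp_rpd[h _] h2]; split.
    by move: h; rewrite /rpd e /comp; under eq_fun do rewrite l.
  exact: le_trans (norm1_le _) h2.
have := @mvt_le (fun u : R => (F (line b x u)).2) (fun u : R => (pD b F (line b x u)).2) s t c.2 L.
rewrite [(t - s) *: c]/(_ *: _) /= mulrC; apply => u /H[/hasp_rpd[_ h] h2]; split.
  by move: h; rewrite /rpd e /comp; under eq_fun do rewrite l.
exact: le_trans (norm2_le _) h2.
Qed.

Lemma lipschitz0 F (L : R) : C1 setT F -> (forall b x, `|pD b F x| <= L) -> F 0 = 0 ->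
  forall y, `|F y| <= 2 * L * `|y|.
Proof.
move=> hF FL F0 y.
have L0 : 0 <= L := le_trans (normr_ge0 _) (FL false 0).
have h b x s t : `|F (line b x t) - F (line b x s)| <= L * `|t - s|.
  have := @mvt_line b F x s t 0 L; rewrite scaler0 subr0; apply => u _.
  by rewrite subr0; split; [exact: (C1_hasp b hF) | exact: FL].
have h1 := h false y 0 y.1; have h2 := h true 0 0 y.2.
rewrite /= F0 in h1 h2; rewrite !subr0 in h1 h2.
have -> : F y = (F (y.1, y.2) - F (0, y.2)) + F (0, y.2) by rewrite subrK -surjective_pairing.
apply: (le_trans (ler_normD _ _)); rewrite mulrAC -mulrA mulr_natl mulr2n.
apply: lerD; [apply: (le_trans h1) | apply: (le_trans h2)].
  by rewrite mulrC ler_wpM2r // norm1_le.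
by rewrite mulrC ler_wpM2r // norm2_le.
Qed.

(* The regularisation [conj y / (|y|^2 + e)] of [1 / y]. *)
Definition regK (e : R) y : P :=
  (y.1 * (y.1 * y.1 + y.2 * y.2 + e)^-1, - (y.2 * (y.1 * y.1 + y.2 * y.2 + e)^-1)).

Lemma regK_den (e : R) y : 0 < e -> 0 < y.1 * y.1 + y.2 * y.2 + e.
Proof. by move=> e0; rewrite -!expr2 ltr_wpDl // addr_ge0 ?sqr_ge0. Qed.

(** Since dbar of [conj y] is 1 and dbar of [|y|^2] is [y], the quotient rule leaves
    [e / (|y|^2 + e)^2], which concentrates at 0 as [e] tends to 0. *)
Lemma regK_C1 (e : R) : 0 < e -> C1 setT (regK e) /\
  forall y, dB (regK e) y = creal (e / (y.1 * y.1 + y.2 * y.2 + e) ^+ 2).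
Proof.
move=> e0.
have d0 y := lt0r_neq0 (regK_den y e0).
pose q y := y.1 * y.1 + y.2 * y.2 + e.
pose D b y : P := if b then (- (2 * y.1 * y.2) * (q y) ^- 2, - ((q y - 2 * y.2 ^+ 2) * (q y) ^- 2))
   else ((q y - 2 * y.1 ^+ 2) * (q y) ^- 2, 2 * y.1 * y.2 * (q y) ^- 2).
have hD b y : hasp b (regK e) y (D b y).
  have hq := rpdV (d0 y) (rpdD (rpdD (rpdM (rpd_fst b y) (rpd_fst b y)) (rpdM (rpd_snd b y) (rpd_snd b y)))
     (rpd_cst b e y)).
  have dy := d0 y.
  apply/hasp_rpd; split.
    apply: (is_derive_eq (rpdM (rpd_fst b y) hq)); rewrite /D /q /=.
    by case: (b) => /=; field.
  apply: (is_derive_eq (rpdN (rpdM (rpd_snd b y) hq))); rewrite /D /q /=.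
  by case: (b) => /=; field.
have c1 : forall y, (z.1 @[z --> y] --> y.1) by move=> y; exact: cvg_fstP cvg_id.
have c2 : forall y, (z.2 @[z --> y] --> y.2) by move=> y; exact: cvg_sndP cvg_id.
have cq y : q z @[z --> y] --> q y.
  exact: (cvgD (cvgD (cvgM (c1 y) (c1 y)) (cvgM (c2 y) (c2 y))) (cvg_cst e)).
have cqV y : (q z)^-1 @[z --> y] --> (q y)^-1 by exact: (cvgV (d0 y) (cq y)).
split.
  apply: (C1I (D := D) openT) => [y _|b y _|b y _].
  - exact: (cvg_prod (cvgM (c1 y) (cqV y)) (cvgN (cvgM (c2 y) (cqV y)))).
  - exact: hD.
  - have cq2 : (q z) ^- 2 @[z --> y] --> (q y) ^- 2.
      exact: (cvgV (expf_neq0 2 (d0 y)) (cvgM (cq y) (cq y))).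
    have c12 : 2 * z.1 * z.2 @[z --> y] --> 2 * y.1 * y.2.
      exact: (cvgM (cvgM (cvg_cst (2:R)) (c1 y)) (c2 y)).
    have s1 : q z - 2 * z.1 ^+ 2 @[z --> y] --> q y - 2 * y.1 ^+ 2.
      exact: (cvgB (cq y) (cvgM (cvg_cst (2:R)) (cvgM (c1 y) (c1 y)))).
    have s2 : q z - 2 * z.2 ^+ 2 @[z --> y] --> q y - 2 * y.2 ^+ 2.
      exact: (cvgB (cq y) (cvgM (cvg_cst (2:R)) (cvgM (c2 y) (c2 y)))).
    case: b.
      exact: (cvg_prod (cvgM (cvgN c12) cq2) (cvgN (cvgM s2 cq2))).
    exact: (cvg_prod (cvgM s1 cq2) (cvgM c12 cq2)).
move=> y; rewrite dBE (hasp_pd (hD false y)) (hasp_pd (hD true y)) /D.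
have := d0 y; rewrite -/(q y) => dy.
by apply: pair_ext; rewrite /= /q; field.
Qed.

End RegularisedKernel.

Section KernelIntegral.
Variable R : realType.
Local Notation P := (R * R)%type.
Local Notation mu := (@leb2 R).
Local Notation leb := (@lebesgue_measure R).
Implicit Types (z w u x y : P) (U V : set P) (F G : P -> P).

Lemma cvg_plane_unique (T : Type) (Fi : set_system T) {FF : ProperFilter Fi} (u : T -> P) (a b : P) :
  u @ Fi --> a -> u @ Fi --> b -> a = b.
Proof. by move=> ua ub; apply: (cvg_unique (@norm_hausdorff R P) ua ub). Qed.

Lemma regK_le (e : R) y : 0 < e -> `|regK e y| <= `|y|^-1.
Proof.
move=> e0; have d0 := regK_den y e0.
have [->|y0] := eqVneq y 0.
  by rewrite /regK /= !mul0r oppr0 normr0 invr0.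
have n0 : 0 < `|y| by rewrite normr_gt0.
have k (t : R) : `|t| <= `|y| -> `|t * (y.1 * y.1 + y.2 * y.2 + e)^-1| <= `|y|^-1.
  move=> ty; rewrite normrM normfV (gtr0_norm d0) ler_pdivrMr // mulrC ler_pdivlMr //.
  have : `|y| ^+ 2 <= y.1 * y.1 + y.2 * y.2.
    rewrite -!expr2 -eucl_sq; have := norm_le_eucl y; move=> h.
    by rewrite lerXn2r ?nnegrE ?eucl_ge0.
  have : `|t| * `|y| <= `|y| ^+ 2 by rewrite expr2 ler_wpM2r.
  lra.
by apply: normP_le; rewrite /= ?normrN; apply: k; [exact: norm1_le | exact: norm2_le].
Qed.

Lemma dregK_le (e : R) y : 0 < e -> y != 0 ->
  `|(creal (e / (y.1 * y.1 + y.2 * y.2 + e) ^+ 2) : P)| <= `|y| ^- 2.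
Proof.
move=> e0 y0; have d0 := regK_den y e0.
have n0 : 0 < `|y| by rewrite normr_gt0.
have h : `|y| ^+ 2 <= y.1 * y.1 + y.2 * y.2.
  rewrite -!expr2 -eucl_sq; have := norm_le_eucl y; move=> h.
  by rewrite lerXn2r ?nnegrE ?eucl_ge0.
have y2 : 0 < `|y| ^+ 2 by rewrite exprn_gt0.
rewrite /creal; apply: normP_le; rewrite /=; last by rewrite normr0 invr_ge0 exprn_ge0.
rewrite ger0_norm; last by rewrite divr_ge0 ?exprn_ge0 // ltW.
pose q := y.1 * y.1 + y.2 * y.2 + e; rewrite -/q in d0 *.
have qe : e <= q by rewrite /q -!expr2 lerDr addr_ge0 ?sqr_ge0.
have qy : `|y| ^+ 2 <= q by rewrite /q; lra.
apply: (@le_trans _ _ (q^-1)); last by rewrite lef_pV2 ?posrE.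
by rewrite ler_pdivrMr ?exprn_gt0 // expr2 mulrA mulVf ?mul1r // gt_eqF.
Qed.

Lemma cvg_regK y : regK (n.+1%:R^-1) y @[n --> \oo] --> cinv y.
Proof.
have [->|y0] := eqVneq y 0.
  have e (n : nat) : regK (n.+1%:R^-1) (0 : P) = cinv 0.
    by apply: pair_ext; rewrite /= !mul0r.
  by under eq_fun do rewrite e; exact: cvg_cst.
have h0 : (n.+1%:R^-1 : R) @[n --> \oo] --> (0 : R) by exact: cvg_harmonic.
have n0 : y.1 * y.1 + y.2 * y.2 != 0 by have := sqsum_neq0 y0; rewrite !expr2.
have h : (y.1 * y.1 + y.2 * y.2 + n.+1%:R^-1)^-1 @[n --> \oo] --> (y.1 * y.1 + y.2 * y.2)^-1.
  apply: cvgV => //; rewrite -[X in _ --> X]addr0.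
  exact: (cvgD (cvg_cst (y.1 * y.1 + y.2 * y.2)) h0).
rewrite /cinv !expr2.
exact: (cvg_prod (cvgM (cvg_cst y.1) h) (cvgN (cvgM (cvg_cst y.2) h))).
Qed.

Lemma cvg_dregK y : y != 0 ->
  (creal (n.+1%:R^-1 / (y.1 * y.1 + y.2 * y.2 + n.+1%:R^-1) ^+ 2) : P) @[n --> \oo] --> (0 : P).
Proof.
move=> y0.
have h0 : (n.+1%:R^-1 : R) @[n --> \oo] --> (0 : R) by exact: cvg_harmonic.
have n0 : y.1 * y.1 + y.2 * y.2 != 0 by have := sqsum_neq0 y0; rewrite !expr2.
have h : y.1 * y.1 + y.2 * y.2 + n.+1%:R^-1 @[n --> \oo] --> y.1 * y.1 + y.2 * y.2.
  rewrite -[X in _ --> X]addr0.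
  exact: (cvgD (cvg_cst (y.1 * y.1 + y.2 * y.2)) h0).
have h2 : ((y.1 * y.1 + y.2 * y.2 + n.+1%:R^-1) ^+ 2)^-1 @[n --> \oo] -->
    ((y.1 * y.1 + y.2 * y.2) ^+ 2)^-1 by exact: (cvgV (expf_neq0 2 n0) (cvgM h h)).
rewrite (_ : (0 : P) = (0 * ((y.1 * y.1 + y.2 * y.2) ^+ 2)^-1, 0)); last by rewrite mul0r.
exact: (cvg_prod (cvgM h0 h2) (cvg_cst (0:R))).
Qed.

(** Integration by parts against [regK e], then [e] tends to 0. As [F 0 = 0], the bound
    [|F y| <= C |y|] against [|dB (regK e) y| <= |y|^-2] leaves the integrable majorant [C / |y|],
    so that dominated convergence applies and no mass remains at the origin. *)
Lemma cint_dB_cinv0 F (M : R) : 0 < M -> C1 setT F -> (forall x, M < `|x| -> F x = 0) -> F 0 = 0 ->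
  cint (fun y => dB F y *c cinv y) = 0.
Proof.
move=> M0 hF Fout F0.
have Fout0 x : M < `|x - 0| -> F x = 0 by rewrite subr0; exact: Fout.
have [L L0 FL] : exists2 L : R, 0 < L & forall b x, `|pD b F x| <= L.
  have h b := support_bound (fun x => C1_pd_cont (b:=b) hF (I : setT x)) (pd_out b Fout0).
  have [L1 l1 h1] := h false; have [L2 l2 h2] := h true.
  exists (L1 + L2); first exact: addr_gt0.
  move=> b x; case: b; first by rewrite (le_trans (h2 x)) // lerDr ltW.
  by rewrite (le_trans (h1 x)) // lerDl ltW.
have Fl := lipschitz0 hF FL F0.
have [D D0 FD] := support_bound (fun x => C1_dbar_cont hF (I : setT x)) (dbar_out Fout0).
pose e (n : nat) : R := n.+1%:R^-1.
have e0 n : 0 < e n by rewrite invr_gt0.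
have mdF : cmeas (dB F) by apply: cmeas_contT => x; exact: (C1_dbar_cont hF).
have mF : cmeas F by apply: cmeas_contT => x; exact: (C1_cont hF).
have mK n : cmeas (regK (e n)).
  by apply: cmeas_contT => x; have [h _] := regK_C1 (e0 n); exact: (C1_cont h).
pose dK n y : P := creal (e n / (y.1 * y.1 + y.2 * y.2 + e n) ^+ 2).
have dKE n y : dB (regK (e n)) y = dK n y by have [_ ->] := regK_C1 (e0 n).
have mdK n : cmeas (dK n).
  apply: (cmeas_eq (dKE n)); apply: cmeas_contT => x.
  by have [h _] := regK_C1 (e0 n); exact: (C1_dbar_cont h).
pose H (C : R) (y : P) : R := C * (`|y|^-1 * \1_(sq 0 M) y).
have iH (C : R) : mu.-integrable setT (EFin \o H C).
  have := integrableZl measurableT C (integrable_norm_inv M0).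
  by apply: eq_integrable.
have HE C y : `|y| <= M -> H C y = C * `|y|^-1.
  by move=> h; rewrite /H indicE mem_set ?mulr1 // /sq /= subr0.
have H0 C y : 0 <= C -> 0 <= H C y by move=> ?; rewrite !mulr_ge0 ?invr_ge0.
have b1 n y : `|dB F y *c regK (e n) y| <= H (2 * D) y.
  have [h|h] := leP `|y| M; last first.
    by rewrite (dbar_out Fout0) ?subr0 // cmul0l normr0 H0 // mulr_ge0 // ltW.
  rewrite HE // (le_trans (norm_cmul _ _)) // -mulrA ler_wpM2l // ler_pM //.
  exact: regK_le.
have b2 n y : `|F y *c dK n y| <= H (2 * (2 * L)) y.
  have [h|h] := leP `|y| M; last by rewrite Fout // cmul0l normr0 H0 // !mulr_ge0 // ltW.
  rewrite HE //; have [->|y0] := eqVneq y 0.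
    by rewrite F0 cmul0l !normr0 invr0 mulr0.
  rewrite (le_trans (norm_cmul _ _)) // -[leRHS]mulrA ler_wpM2l //.
  apply: (@le_trans _ _ (2 * L * `|y| * `|y| ^- 2)).
    by rewrite ler_pM // dregK_le.
  by rewrite expr2 invfM mulrA mulfK // normr_eq0.
have [i1 c1] : cintegrable (fun y => dB F y *c cinv y) /\
    cint (fun y => dB F y *c regK (e n) y) @[n --> \oo] --> cint (fun y => dB F y *c cinv y).
  apply: (cint_dct (H := H (2 * D))) => [n|y|n y|].
  - exact: (cmeasM mdF (mK n)).
  - by apply: cvg_cmul; [exact: cvg_cst | exact: cvg_regK].
  - exact: b1.
  - exact: iH.
have [i2 c2] : @cintegrable R (fun=> 0) /\
    cint (fun y => F y *c dK n y) @[n --> \oo] --> @cint R (fun=> 0).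
  apply: (@cint_dct R (fun n y => F y *c dK n y) (fun=> 0) (H (2 * (2 * L)))) => [n|y|n y|].
  - exact: (cmeasM mF (mdK n)).
  - have [->|y0] := eqVneq y 0.
      by rewrite F0; under eq_fun do rewrite cmul0l; exact: cvg_cst.
    by rewrite -(cmul0r (F y)); by apply: cvg_cmul; [exact: cvg_cst | exact: cvg_dregK].
  - exact: b2.
  - exact: iH.
have e1 n : cint (fun y => dB F y *c regK (e n) y) = - cint (fun y => F y *c dK n y).
  have [hK _] := regK_C1 (e0 n).
  have z : cint (dB (fun y => F y *c regK (e n) y)) = 0.
    apply: (@cint_dbar0 _ _ M); first exact: (C1M openT hF hK).
    by move=> x h; rewrite Fout // cmul0l.
  apply/eqP; rewrite -subr_eq0 opprK -cintD; last 2 first.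
  - exact: (cintegrable_le (cmeasM mdF (mK n)) (b1 n) (iH _)).
  - exact: (cintegrable_le (cmeasM mF (mdK n)) (b2 n) (iH _)).
  apply/eqP; rewrite -z; apply: cint_eq => y.
  by rewrite (dbarM hF hK) // dKE.
have e2 : cint (fun y => dB F y *c cinv y) = - @cint R (fun=> 0).
  have c3 : cint (fun y => dB F y *c regK (e n) y) @[n --> \oo] --> - @cint R (fun=> 0).
    by under eq_fun do rewrite e1; exact: cvgN.
  exact: (cvg_plane_unique c1 c3).
rewrite e2 (cint_eq (G := fun y => 0 *c 0)); last by move=> y; rewrite cmul0l.
by rewrite cintM // cmul0l oppr0.
Qed.

End KernelIntegral.

(** * Cutoff functions *)

Section Cutoffs.
Variable R : realType.
Local Notation P := (R * R)%type.
Local Notation mu := (@leb2 R).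
Implicit Types (z w u x y : P) (U V : set P) (F G : P -> P).

(** The positive part of [t]. Its square is C1 with derivative twice the positive part, and all
    cutoffs below are built from such squares. *)
Definition pospart (t : R) : R := (t + `|t|) / 2.

Lemma pospart_ge0 t : 0 <= t -> pospart t = t.
Proof. by move=> t0; rewrite /pospart ger0_norm //; field. Qed.
Lemma pospart_le0 t : t <= 0 -> pospart t = 0.
Proof. by move=> t0; rewrite /pospart ler0_norm // subrr mul0r. Qed.
Lemma pospart_nneg t : 0 <= pospart t.
Proof. by have [h|h] := leP 0 t; [rewrite pospart_ge0 | rewrite pospart_le0 // ltW]. Qed.
Lemma pospart_cont (t : R) : {for t, continuous pospart}.
Proof.
have h : s + `|s| @[s --> t] --> t + `|t| by exact: (cvgD cvg_id (cvg_norm cvg_id)).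
exact: (cvgM h (cvg_cst (2^-1 : R))).
Qed.

Lemma is_derive_pospart2 (t : R) :
  is_derive t (1:R) (fun s => pospart s * pospart s) (2 * pospart t).
Proof.
have [t0|t0|->] := ltgtP t 0.
- rewrite pospart_le0 ?(ltW t0) // mulr0.
  have n : \near t, cst (0 : R) t = pospart t * pospart t.
    near=> s; rewrite pospart_le0 ?mul0r //; apply: ltW; near: s; exact: lt_nbhsl.
  exact: (near_eq_is_derive n (is_derive_cst (0 : R) t (1 : R))).
- rewrite pospart_ge0 ?(ltW t0) //.
  have n : \near t, t * t = pospart t * pospart t.
    near=> s; rewrite pospart_ge0 //; apply: ltW; near: s; exact: lt_nbhsr.
  apply: (near_eq_is_derive n).
  have := is_deriveM (is_derive_id t (1:R)) (is_derive_id t (1:R)).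
  by move/is_derive_eq; apply; rewrite /GRing.scale /=; ring.
(* Since [pospart s * pospart s = pospart s * s], the continuous function [pospart] is itself the
   slope at 0. *)
- apply/is_derive1_caratheodory; exists pospart; split; last by rewrite !pospart_le0 ?mulr0.
    move=> s; rewrite !(pospart_le0 (lexx 0)) mul0r !subr0.
    by have [h|h] := leP 0 s; [rewrite pospart_ge0 | rewrite pospart_le0 ?mul0r // ltW].
  exact: pospart_cont.
Unshelve. all: by end_near. Qed.

(* The C1 quadratic spline that is 0 on the left of 0 and 1 on the right of 1. *)
Definition step (s : R) : R := 2 * (pospart s * pospart s)
  - 4 * (pospart (s - 2^-1) * pospart (s - 2^-1)) + 2 * (pospart (s - 1) * pospart (s - 1)).
Definition dstep (s : R) : R := 4 * pospart s - 8 * pospart (s - 2^-1) + 4 * pospart (s - 1).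

Lemma is_derive_step s : is_derive s (1:R) step (dstep s).
Proof.
have h (c : R) : is_derive s (1:R) (fun t => pospart (t - c) * pospart (t - c)) (2 * pospart (s - c)).
  have h1 : is_derive s (1:R) (fun t => t - c) (1 - 0).
    exact: (is_deriveB (is_derive_id s (1:R)) (is_derive_cst c s (1:R))).
  have := @is_derive1_comp R (fun t => pospart t * pospart t) (fun t => t - c) s _ _
    (is_derive_pospart2 (s - c)) h1.
  by rewrite subr0 mulr1.
have e (k : R) (f : R -> R) d : is_derive s (1:R) f d -> is_derive s (1:R) (fun t => k * f t) (k * d).
  by move=> fd; exact: (is_deriveZ k fd).
have h0 := is_derive_pospart2 s.
have := is_deriveD (is_deriveB (e 2 _ _ h0) (e 4 _ _ (h 2^-1))) (e 2 _ _ (h 1)).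
by move/is_derive_eq; apply; rewrite /dstep; ring.
Qed.

Lemma step_cases s : [\/ [/\ s <= 0, step s = 0 & dstep s = 0],
  [/\ 0 <= s, s <= 2^-1, step s = 2 * (s * s) & dstep s = 4 * s],
  [/\ 2^-1 <= s, s <= 1, step s = 1 - 2 * ((1 - s) * (1 - s)) & dstep s = 4 - 4 * s] |
  [/\ 1 <= s, step s = 1 & dstep s = 0]].
Proof.
rewrite /step /dstep.
have [h|h] := leP s 0.
  by apply: Or41; split => //; rewrite !pospart_le0; lra.
have [h1|h1] := leP s 2^-1.
  apply: Or42; split => //; rewrite ?ltW // (@pospart_ge0 s) ?ltW // !pospart_le0; lra.
have [h2|h2] := leP s 1.
  apply: Or43; split => //; rewrite ?ltW // (@pospart_ge0 s) ?ltW // (@pospart_ge0 (s - 2^-1)) ?(@pospart_le0 (s - 1)); lra.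
apply: Or44; split => //; rewrite ?ltW // (@pospart_ge0 s) ?(@pospart_ge0 (s - 2^-1)) ?(@pospart_ge0 (s - 1)); lra.
Qed.

Lemma step_bound s : 0 <= step s <= 1.
Proof. by case: (step_cases s) => -[] => [? -> _|? ? -> _|? ? -> _|? -> _]; nra. Qed.
Lemma dstep_bound s : `|dstep s| <= 2.
Proof. by case: (step_cases s) => -[] => [? _ ->|? ? _ ->|? ? _ ->|? _ ->]; rewrite ler_norml; lra. Qed.
Lemma step1 s : 1 <= s -> step s = 1.
Proof. by move=> h; case: (step_cases s) => -[] => [? -> _|? ? -> _|? ? -> _|? -> _]; nra. Qed.
Lemma step0 s : s <= 0 -> step s = 0.
Proof. by move=> h; case: (step_cases s) => -[] => [? -> _|? ? -> _|? ? -> _|? -> _]; nra. Qed.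
Lemma dstep_cont (s : R) : {for s, continuous dstep}.
Proof.
have h (c : R) : pospart (t - c) @[t --> s] --> pospart (s - c).
  apply: (@cvg_comp _ _ _ (fun t => t - c) pospart _ (nbhs (s - c))); last exact: pospart_cont.
  exact: (cvgB cvg_id (cvg_cst c)).
exact: (cvgD (cvgB (cvgM (cvg_cst (4:R)) (pospart_cont (t:=s))) (cvgM (cvg_cst (8:R)) (h 2^-1)))
  (cvgM (cvg_cst (4:R)) (h 1))).
Qed.
Lemma step_cont (s : R) : {for s, continuous step}.
Proof.
by apply/differentiable_continuous/derivable1_diffP; exact: (@ex_derive _ _ _ _ _ _ _ (is_derive_step s)).
Qed.

(** A bump equal to 1 on [[-1, 1]] and to 0 where [2 <= |s|]. At each point at most one of the two
    factors differs from 1. *)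
Definition plateau (s : R) : R := step (2 - s) * step (2 + s).
Definition dplateau (s : R) : R := step (2 - s) * dstep (2 + s) - step (2 + s) * dstep (2 - s).

Lemma is_derive_plateau s : is_derive s (1:R) plateau (dplateau s).
Proof.
have h1 : is_derive s (1:R) (fun t => 2 - t) (0 - 1).
  exact: (is_deriveB (is_derive_cst (2:R) s (1:R)) (is_derive_id s (1:R))).
have h2 : is_derive s (1:R) (fun t => 2 + t) (0 + 1).
  exact: (is_deriveD (is_derive_cst (2:R) s (1:R)) (is_derive_id s (1:R))).
have := is_deriveM (@is_derive1_comp R step (fun t => 2 - t) s _ _ (is_derive_step (2 - s)) h1)
  (@is_derive1_comp R step (fun t => 2 + t) s _ _ (is_derive_step (2 + s)) h2).
by move/is_derive_eq; apply; rewrite /dplateau /GRing.scale /=; ring.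
Qed.
Lemma plateau_bound s : 0 <= plateau s <= 1.
Proof.
have /andP[h1 h2] := step_bound (2 - s); have /andP[h3 h4] := step_bound (2 + s).
by rewrite /plateau mulr_ge0 // mulr_ile1.
Qed.
Lemma plateau1 s : `|s| <= 1 -> plateau s = 1.
Proof. by rewrite ler_norml => /andP[? ?]; rewrite /plateau !step1 ?mulr1; lra. Qed.
Lemma plateau0 s : 2 <= `|s| -> plateau s = 0.
Proof.
move=> h; rewrite /plateau; have [s0|s0] := leP 0 s.
  by rewrite ger0_norm // in h; rewrite (@step0 (2 - s)) ?mul0r; lra.
by rewrite ltr0_norm // in h; rewrite (@step0 (2 + s)) ?mulr0; lra.
Qed.
Lemma dplateau_bound s : `|dplateau s| <= 4.
Proof.
have /andP[h1 h2] := step_bound (2 - s); have /andP[h3 h4] := step_bound (2 + s).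
have h5 := dstep_bound (2 - s); have h6 := dstep_bound (2 + s).
apply: (le_trans (ler_normB _ _)); rewrite !normrM (ger0_norm h1) (ger0_norm h3).
have : step (2 - s) * `|dstep (2 + s)| <= 1 * 2 by apply: ler_pM.
have : step (2 + s) * `|dstep (2 - s)| <= 1 * 2 by apply: ler_pM.
lra.
Qed.
Lemma dplateau_cont (s : R) : {for s, continuous dplateau}.
Proof.
have h1 (f : R -> R) : (forall t, {for t, continuous f}) -> f (2 - t) @[t --> s] --> f (2 - s).
  move=> fc; apply: (@cvg_comp _ _ _ (fun t => 2 - t) f _ (nbhs (2 - s))); last exact: fc.
  exact: (cvgB (cvg_cst (2:R)) cvg_id).
have h2 (f : R -> R) : (forall t, {for t, continuous f}) -> f (2 + t) @[t --> s] --> f (2 + s).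
  move=> fc; apply: (@cvg_comp _ _ _ (fun t => 2 + t) f _ (nbhs (2 + s))); last exact: fc.
  exact: (cvgD (cvg_cst (2:R)) cvg_id).
exact: (cvgB (cvgM (h1 _ step_cont) (h2 _ dstep_cont)) (cvgM (h2 _ step_cont) (h1 _ dstep_cont))).
Qed.

(** Equal to 1 on [sq a r] and to 0 off [sq a (2 * r)], the source of the pairs [r], [2 * r] in the
    local statements. *)
Definition cut (a : P) (r : R) z : R := plateau ((z.1 - a.1) / r) * plateau ((z.2 - a.2) / r).
Definition ccut (a : P) (r : R) z : P := creal (cut a r z).

Lemma hasp_creal b (h : P -> R) x d : rpd b h x d -> hasp b (fun z => creal (h z)) x (creal d).
Proof. by move=> hd; apply/hasp_rpd; split => //; exact: rpd_cst. Qed.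

Lemma cut_bound a r z : 0 <= cut a r z <= 1.
Proof.
rewrite /cut; have /andP[h1 h2] := plateau_bound ((z.1 - a.1) / r).
by have /andP[h3 h4] := plateau_bound ((z.2 - a.2) / r); rewrite mulr_ge0 // mulr_ile1.
Qed.

Lemma cut1 a r z : 0 < r -> `|z - a| <= r -> cut a r z = 1.
Proof.
move=> r0 h; rewrite /cut !plateau1 ?mulr1 //.
  by rewrite normrM normfV (gtr0_norm r0) ler_pdivrMr // mul1r; apply: le_trans h; exact: (norm2_le (z - a)).
by rewrite normrM normfV (gtr0_norm r0) ler_pdivrMr // mul1r; apply: le_trans h; exact: (norm1_le (z - a)).
Qed.

Lemma cut0 a r z : 0 < r -> 2 * r <= `|z - a| -> cut a r z = 0.
Proof.
move=> r0; rewrite normPE le_max => /orP[|] h; rewrite /cut.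
  rewrite (@plateau0 ((z.1 - a.1) / r)) ?mul0r //.
  by rewrite normrM normfV (gtr0_norm r0) ler_pdivlMr.
rewrite (@plateau0 ((z.2 - a.2) / r)) ?mulr0 //.
by rewrite normrM normfV (gtr0_norm r0) ler_pdivlMr.
Qed.

Lemma ccutE a r z w : ccut a r z *c w = cut a r z *: w.
Proof. by rewrite /ccut crealM. Qed.

Lemma cut_C1 a r : 0 < r -> C1 setT (ccut a r) /\
  forall b x, `|pD b (ccut a r) x| <= 4 / r.
Proof.
move=> r0.
pose D b z : R := if b then plateau ((z.1 - a.1) / r) * (dplateau ((z.2 - a.2) / r) * r^-1)
  else plateau ((z.2 - a.2) / r) * (dplateau ((z.1 - a.1) / r) * r^-1).
have h1 b z : rpd b (fun w => (w.1 - a.1) / r) z (if b then 0 else r^-1).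
  have := rpdM (rpdB (rpd_fst b z) (rpd_cst b a.1 z)) (rpd_cst b r^-1 z).
  by move/is_derive_eq; apply; case: (b) => /=; ring.
have h2 b z : rpd b (fun w => (w.2 - a.2) / r) z (if b then r^-1 else 0).
  have := rpdM (rpdB (rpd_snd b z) (rpd_cst b a.2 z)) (rpd_cst b r^-1 z).
  by move/is_derive_eq; apply; case: (b) => /=; ring.
have hD b z : hasp b (ccut a r) z (creal (D b z)).
  apply: hasp_creal.
  have := rpdM (rpd_comp (h1 b z) (is_derive_plateau _)) (rpd_comp (h2 b z) (is_derive_plateau _)).
  by move/is_derive_eq; apply; rewrite /D; case: (b) => /=; ring.
have c1 (f : R -> R) z : (forall t, {for t, continuous f}) ->
    f ((w.1 - a.1) / r) @[w --> z] --> f ((z.1 - a.1) / r).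
  move=> fc; apply: (@cvg_comp _ _ _ (fun w : P => (w.1 - a.1) / r) f _ (nbhs ((z.1 - a.1) / r))); last exact: fc.
  exact: (cvgM (cvgB (cvg_fstP cvg_id) (cvg_cst a.1)) (cvg_cst r^-1)).
have c2 (f : R -> R) z : (forall t, {for t, continuous f}) ->
    f ((w.2 - a.2) / r) @[w --> z] --> f ((z.2 - a.2) / r).
  move=> fc; apply: (@cvg_comp _ _ _ (fun w : P => (w.2 - a.2) / r) f _ (nbhs ((z.2 - a.2) / r))); last exact: fc.
  exact: (cvgM (cvgB (cvg_sndP cvg_id) (cvg_cst a.2)) (cvg_cst r^-1)).
have pc (t : R) : {for t, continuous plateau}.
  by apply/differentiable_continuous/derivable1_diffP; exact: (@ex_derive _ _ _ _ _ _ _ (is_derive_plateau t)).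
split.
  apply: (C1I (D := fun b z => creal (D b z)) openT) => [z _|b z _|b z _].
  - exact: (cvg_prod (cvgM (c1 _ z pc) (c2 _ z pc)) (cvg_cst (0:R))).
  - exact: hD.
  - case: b.
      exact: (cvg_prod (cvgM (c1 _ z pc) (cvgM (c2 _ z dplateau_cont) (cvg_cst r^-1))) (cvg_cst (0:R))).
    exact: (cvg_prod (cvgM (c2 _ z pc) (cvgM (c1 _ z dplateau_cont) (cvg_cst r^-1))) (cvg_cst (0:R))).
move=> b x; rewrite (hasp_pd (hD b x)); apply: normP_le => /=; last first.
  by rewrite normr0 divr_ge0 // ltW.
have k (s t : R) : `|plateau s * (dplateau t * r^-1)| <= 4 / r.
  have /andP[p0 p1] := plateau_bound s.
  rewrite [X in X <= _]normrM (ger0_norm p0) [X in _ * X]normrM normfV (gtr0_norm r0) -[leRHS]mul1r ler_pM //.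
    by rewrite mulr_ge0 // invr_ge0 ltW.
  by rewrite ler_wpM2r ?dplateau_bound // invr_ge0 ltW.
by case: b; exact: k.
Qed.

(** The decay in [r] is what makes the error of truncating at radius [m] tend to 0 in the density
    argument. *)
Lemma dcut_bound a r x : 0 < r -> `|dB (ccut a r) x| <= 4 / r.
Proof.
move=> r0; have [_ h] := cut_C1 a r0.
have nI (z : P) : `|cI R *c z| <= `|z|.
  by apply: normP_le; rewrite /= !mul0r ?add0r ?addr0 ?sub0r ?normrN mul1r; [exact: norm2_le | exact: norm1_le].
rewrite dBE crealM normrZ gtr0_norm //.
have := ler_normD (pD false (ccut a r) x) (cI R *c pD true (ccut a r) x).
have := nI (pD true (ccut a r) x); have := h true x; have := h false x.
lra.
Qed.

Lemma dcut0 a r x : 0 < r -> `|x - a| < r \/ 2 * r < `|x - a| -> dB (ccut a r) x = 0.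
Proof.
move=> r0 h.
have [c hc] : exists c, \near x, cst c x = ccut a r x.
  case: h => h; [exists (cone R) | exists 0]; apply/square_nbhs.
    exists (r - `|x - a|); first by rewrite subr_gt0.
    move=> y yx; rewrite /ccut cut1 // (_ : y - a = (y - x) + (x - a)); last by rewrite addrA subrK.
    by rewrite (le_trans (ler_normD _ _)) // -lerBrDr ltW.
  exists (`|x - a| - 2 * r); first by rewrite subr_gt0.
  move=> y yx; rewrite /ccut cut0 //; have := ler_normB (y - a) (y - x).
  rewrite (_ : y - a - (y - x) = x - a); last by apply: pair_ext => /=; ring.
  by move: yx; lra.
by rewrite -(dbar_near hc) dbar_cst.
Qed.

End Cutoffs.

(** * Cauchy-Pompeiu formula *)

Section CauchyPompeiu.
Variable R : realType.
Local Notation P := (R * R)%type.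
Local Notation mu := (@leb2 R).
Implicit Types (z w u x y : P) (U V : set P) (F G : P -> P).

Definition radial y : R := 1 - (y.1 * y.1 + y.2 * y.2).
(** The square of the positive part of [1 - |y|^2]. Its dbar derivative is a real multiple of [y],
    so that multiplication by [cinv y] leaves a real function of constant sign, and the constant of
    the Cauchy-Pompeiu formula is seen to be real and positive. *)
Definition bump y : P := creal (pospart (radial y) * pospart (radial y)).

Lemma bump_C1 : C1 setT bump /\ forall y, dB bump y = (- 2 * pospart (radial y)) *: y.
Proof.
pose D b y : P := creal (2 * pospart (radial y) * - (2 * (if b then y.2 else y.1))).
have hr b y : rpd b radial y (- (2 * (if b then y.2 else y.1))).
  have := rpdB (rpd_cst b (1 : R) y) (rpdD (rpdM (rpd_fst b y) (rpd_fst b y)) (rpdM (rpd_snd b y) (rpd_snd b y))).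
  by move/is_derive_eq; apply; case: (b) => /=; ring.
have hD b y : hasp b bump y (D b y).
  apply: hasp_creal; exact: (rpd_comp (hr b y) (is_derive_pospart2 _)).
have c1 y : z.1 @[z --> y] --> y.1 by exact: (cvg_fstP cvg_id).
have c2 y : z.2 @[z --> y] --> y.2 by exact: (cvg_sndP cvg_id).
have cr y : radial z @[z --> y] --> radial y.
  exact: (cvgB (cvg_cst (1 : R)) (cvgD (cvgM (c1 y) (c1 y)) (cvgM (c2 y) (c2 y)))).
have cp y : pospart (radial z) @[z --> y] --> pospart (radial y).
  exact: (cvg_comp _ _ (cr y) (@pospart_cont R (radial y))).
split.
  apply: (C1I (D := D) openT) => [y _|b y _|b y _].
  - exact: (cvg_prod (cvgM (cp y) (cp y)) (cvg_cst (0 : R))).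
  - exact: hD.
  - case: b.
      exact: (cvg_prod (cvgM (cvgM (cvg_cst (2:R)) (cp y)) (cvgN (cvgM (cvg_cst (2:R)) (c2 y)))) (cvg_cst (0 : R))).
    exact: (cvg_prod (cvgM (cvgM (cvg_cst (2:R)) (cp y)) (cvgN (cvgM (cvg_cst (2:R)) (c1 y)))) (cvg_cst (0 : R))).
move=> y; rewrite dBE (hasp_pd (hD false y)) (hasp_pd (hD true y)) /D.
by apply: pair_ext; rewrite ?scale1E ?scale2E /=; field.
Qed.

Lemma bump_out y : 1 < `|y| -> bump y = 0.
Proof.
move=> h; have : 1 < `|y| ^+ 2 by rewrite exprn_egt1.
have : `|y| ^+ 2 <= y.1 * y.1 + y.2 * y.2.
  rewrite -!expr2 -eucl_sq; have := norm_le_eucl y; move=> h'.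
  by rewrite lerXn2r ?nnegrE ?eucl_ge0.
by move=> h1 h2; rewrite /bump pospart_le0 ?mul0r // /radial; lra.
Qed.

(* The constant of the Cauchy-Pompeiu formula, that is pi. *)
Definition kappa : R := - (cint (fun y => dB bump y *c cinv y)).1.

Lemma bump_kernel y : dB bump y *c cinv y =
  creal (- 2 * (pospart (radial y) * \1_[set~ (0 : P)] y)).
Proof.
have [_ ->] := bump_C1; rewrite scale_cmull indicE.
have [->|y0] := eqVneq y 0.
  by rewrite cinv0 cmul0r scaler0 memNset ?mulr0 //=; exact.
by rewrite cmulV // mem_set; [rewrite mulr1; apply: pair_ext; rewrite ?scale1E ?scale2E /=; ring | exact/eqP].
Qed.

Lemma cintegrable_cinv_mul F (M : R) : 0 < M -> (forall x, {for x, continuous F}) ->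
  (forall x, M < `|x| -> F x = 0) -> cintegrable (fun y => F y *c cinv y).
Proof.
move=> M0 Fc F0; have F0' x : M < `|x - 0| -> F x = 0 by rewrite subr0; exact: F0.
have [C C0 FC] := support_bound Fc F0'.
apply: (cintegrable_le (G := fun y => 2 * C * (`|y|^-1 * \1_(sq 0 M) y))).
- by apply: cmeasM; [exact: cmeas_contT | exact: cmeas_cinv].
- move=> y; rewrite indicE; have [h|h] := leP `|y| M; last first.
    by rewrite F0 // cmul0l normr0 !mulr_ge0 ?invr_ge0 // ltW.
  rewrite mem_set ?mulr1; last by rewrite /sq /= subr0.
  by rewrite (le_trans (norm_cmul _ _)) // -mulrA ler_wpM2l // ler_pM // norm_cinv.
- have := integrableZl measurableT (2 * C) (integrable_norm_inv M0).
  by apply: eq_integrable.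
Qed.

Lemma kappa_gt0 : 0 < kappa.
Proof.
have [hb _] := bump_C1.
have i : cintegrable (fun y => dB bump y *c cinv y).
  apply: (@cintegrable_cinv_mul _ 1) => //; first by move=> x; exact: (C1_dbar_cont hb).
  move=> x h; apply: (@dbar_out _ _ 0 1); last by rewrite subr0.
  by move=> y; rewrite subr0; exact: bump_out.
(* On this square [|y|^2 <= 26 / 64], so the integrand [2 * (1 - |y|^2)] is at least 1 and [kappa]
   is at least the area [1 / 16]. *)
pose A : set P := sq (2^-1, 0) 8^-1.
have iA := integrable_square ((2^-1, 0) : P) 8^-1 1.
rewrite /kappa cint1E oppr_gt0.
have i1 := cintegrable1 i.
have : \int[mu]_y (1 * \1_A y) <= \int[mu]_y (- (dB bump y *c cinv y).1).
  apply: le_Rintegral => //.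
    by have := integrableN i1; apply: eq_integrable.
  move=> y _; rewrite bump_kernel !indicE /= mul1r mulNr opprK.
  have [h|h] := boolP (y \in A); last first.
    by apply: mulr_ge0 => //; apply: mulr_ge0; rewrite ?pospart_nneg ?ler0n.
  move: h; rewrite inE /A /sq /= => h.
  have := le_trans (norm1_le _) h; have := le_trans (norm2_le _) h.
  rewrite /= subr0 !ler_norml => /andP[a1 a2] /andP[a3 a4].
  rewrite mem_set /=; last first.
    by move=> y0; move: a3; rewrite y0 /=; lra.
  rewrite mulr1 pospart_ge0 /radial; last by nra.
  by nra.
have -> : \int[mu]_y (- (dB bump y *c cinv y).1) = - \int[mu]_y (dB bump y *c cinv y).1.
  have := RintegralZl (-1) measurableT i1; rewrite mulN1r => <-.
  by apply: eq_Rintegral => y _; rewrite mulN1r.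
rewrite RintegralZl //; last by have := iA; apply: eq_integrable => // y _; rewrite /= mul1r.
rewrite mul1r {1}/Rintegral integral_indic ?setIT //; last exact: measurable_square.
have -> : fine (mu A) = (2 * 8^-1) ^+ 2 by rewrite /A leb2_sq.
have : 0 < ((2 * 8^-1) ^+ 2 : R) by rewrite exprn_gt0 // mulr_gt0.
lra.
Qed.

(** Subtracting [F 0 *c bump] gives a function that vanishes at 0, to which [cint_dB_cinv0] applies;
    the integral belonging to [bump] is [- kappa] by definition. *)
Lemma cauchy_pompeiu F (M : R) : 0 < M -> C1 setT F -> (forall x, M < `|x| -> F x = 0) ->
  cint (fun y => dB F y *c cinv y) = - (kappa *: F 0).
Proof.
move=> M0 hF Fout; have [hb _] := bump_C1.
pose M1 := Num.max M 1.
have M10 : 0 < M1 by rewrite lt_max M0.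
have ob y : M1 < `|y| -> bump y = 0 by rewrite gt_max => /andP[_]; exact: bump_out.
have oF y : M1 < `|y| -> F y = 0 by rewrite gt_max => /andP[h _]; exact: Fout.
have b1 : bump 0 = cone R.
  by rewrite /bump /radial /= mulr0 addr0 subr0 pospart_ge0 // mulr1.
have hc := C1M openT (C1_cst setT (F 0)) hb.
have hG := C1B openT hF hc.
have dE y : dB (fun z => F z - cst (F 0) z *c bump z) y = dB F y - F 0 *c dB bump y.
  rewrite (dbarB openT hF hc I) (dbarM (C1_cst setT (F 0)) hb I).
  by rewrite dbar_cst cmul0l add0r.
have := @cint_dB_cinv0 _ _ M1 M10 hG.
have -> : cint (fun y => dB (fun z => F z - cst (F 0) z *c bump z) y *c cinv y) =
    cint (fun y => dB F y *c cinv y - F 0 *c (dB bump y *c cinv y)).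
  by apply: cint_eq => y; rewrite dE cmulBl cmulA.
have i1 : cintegrable (fun y => dB F y *c cinv y).
  apply: (@cintegrable_cinv_mul _ M1) => //; first by move=> x; exact: (C1_dbar_cont hF).
  move=> x h; apply: (@dbar_out _ _ 0 M1); last by rewrite subr0.
  by move=> y; rewrite subr0; exact: oF.
have i2 : cintegrable (fun y => dB bump y *c cinv y).
  apply: (@cintegrable_cinv_mul _ M1) => //; first by move=> x; exact: (C1_dbar_cont hb).
  move=> x h; apply: (@dbar_out _ _ 0 M1); last by rewrite subr0.
  by move=> y; rewrite subr0; exact: ob.
rewrite (cintB i1 (cintegrableM _ i2)) (cintM _ i2) => h.
have /eqP : cint (fun y => dB F y *c cinv y) - F 0 *c cint (fun y => dB bump y *c cinv y) = 0.
  apply: h; first by move=> y h; rewrite oF // ob // cmul0r subr0.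
  by rewrite /= b1 cmul1r subrr.
rewrite subr_eq0 => /eqP ->.
have -> : cint (fun y => dB bump y *c cinv y) = creal (- kappa).
  rewrite /kappa opprK; apply: pair_ext => //=; rewrite cint2E.
  rewrite (@eq_Rintegral _ _ _ _ _ (fun=> 0)); last by move=> y _; rewrite bump_kernel.
  by rewrite Rintegral_cst ?mul0r.
by rewrite cmulC crealM scaleNr.
Qed.

End CauchyPompeiu.

(** * Convolution with a kernel *)

Section Convolution.
Variable R : realType.
Local Notation P := (R * R)%type.
Local Notation mu := (@leb2 R).
Implicit Types (z w u x y : P) (U V : set P) (F G : P -> P).

Lemma rpd_reflect b (h : P -> R) z y d : rpd b h (z - y) d -> rpd b (fun w => h (z - w)) y (- d).
Proof.
move=> hd.
have e : (fun w => h (z - w)) \o line b y = (h \o line b (z - y)) \o (fun t => co b z - t).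
  by apply/funext => t; rewrite /=; congr h; case: (b); apply: pair_ext.
rewrite /rpd e.
have h1 : is_derive (co b y) (1:R) (fun t => co b z - t) (0 - 1).
  exact: (is_deriveB (is_derive_cst (co b z) (co b y) (1:R)) (is_derive_id (co b y) (1:R))).
have hd' : is_derive (co b z - co b y) (1:R) (h \o line b (z - y)) d.
  by move: hd; rewrite /rpd; case: (b).
have := @is_derive1_comp R (h \o line b (z - y)) (fun t => co b z - t) (co b y) d (0 - 1) hd' h1.
by move/is_derive_eq; apply; rewrite sub0r mulrN1.
Qed.

Lemma hasp_reflect b F z y l : hasp b F (z - y) l -> hasp b (fun w => F (z - w)) y (- l).
Proof.
move=> /hasp_rpd[h1 h2]; apply/hasp_rpd.
by split; [exact: (rpd_reflect h1) | exact: (rpd_reflect h2)].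
Qed.

Lemma hasp_shift b F w x l : hasp b F (x - w) l -> hasp b (fun y => F (y - w)) x l.
Proof.
move=> h; have h1 : hasp b (fun y => F (- w - y)) (- x) (- l).
  by apply: hasp_reflect; rewrite opprK addrC.
have := @hasp_reflect b (fun y => F (- w - y)) 0 x (- l); rewrite sub0r opprK => /(_ h1).
by under eq_fun do rewrite sub0r opprK addrC.
Qed.

Lemma cont_reflect F z y : {for z - y, continuous F} -> {for y, continuous (fun w => F (z - w))}.
Proof.
move=> Fc; apply: (@cvg_comp _ _ _ (fun w => z - w) F _ (nbhs (z - y))); last exact: Fc.
exact: (cvgB (cvg_cst z) cvg_id).
Qed.

Lemma cont_shift F w x : {for x - w, continuous F} -> {for x, continuous (fun y => F (y - w))}.
Proof.
move=> Fc; apply: (@cvg_comp _ _ _ (fun y => y - w) F _ (nbhs (x - w))); last exact: Fc.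
exact: (cvgB cvg_id (cvg_cst w)).
Qed.

Lemma open_reflect U z : open U -> open [set y | U (z - y)].
Proof.
move=> oU; apply: (open_comp (f := fun y => z - y)) oU => y _.
exact: (cvgB (cvg_cst z) cvg_id).
Qed.

Lemma open_shift U w : open U -> open [set x | U (x - w)].
Proof.
move=> oU; apply: (open_comp (f := fun y => y - w)) oU => y _.
exact: (cvgB cvg_id (cvg_cst w)).
Qed.

Lemma C1_reflect U F z : open U -> C1 U F -> C1 [set y | U (z - y)] (fun y => F (z - y)) /\
  forall y, U (z - y) -> dB (fun y => F (z - y)) y = - dB F (z - y).
Proof.
move=> oU hF.
have hD b y (Uy : U (z - y)) := hasp_reflect (C1_hasp b hF Uy).
split.
  apply: (C1I (D := fun b y => - pD b F (z - y)) (open_reflect (z:=z) oU)) => [y Uy|b y Uy|b y Uy].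
  - exact: (cont_reflect (C1_cont hF Uy)).
  - exact: hD.
  - apply: cvgN; exact: (cont_reflect (C1_pd_cont (b:=b) hF Uy)).
move=> y Uy; rewrite !dBE (hasp_pd (hD false y Uy)) (hasp_pd (hD true y Uy)).
by rewrite cmulNr -opprD cmulNr.
Qed.

Lemma C1_shift U F w : open U -> C1 U F -> C1 [set x | U (x - w)] (fun x => F (x - w)) /\
  (forall b x, U (x - w) -> pD b (fun x => F (x - w)) x = pD b F (x - w)) /\
  forall x, U (x - w) -> dB (fun x => F (x - w)) x = dB F (x - w).
Proof.
move=> oU hF.
have hD b x (Ux : U (x - w)) := hasp_shift (C1_hasp b hF Ux).
split.
  apply: (C1I (D := fun b x => pD b F (x - w)) (open_shift (w:=w) oU)) => [x Ux|b x Ux|b x Ux].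
  - exact: (cont_shift (C1_cont hF Ux)).
  - exact: hD.
  - exact: (cont_shift (C1_pd_cont (b:=b) hF Ux)).
split; first by move=> b x Ux; exact: (hasp_pd (hD b x Ux)).
by move=> x Ux; rewrite !dBE (hasp_pd (hD false x Ux)) (hasp_pd (hD true x Ux)).
Qed.

Lemma hol_shift U F w : open U -> hol U F -> hol [set x | U (x - w)] (fun x => F (x - w)).
Proof.
move=> oU [h1 h2]; have [h3 [_ h4]] := C1_shift w oU h1.
by split; [exact: h3 | move=> x Ux; rewrite h4 // h2].
Qed.

(** The Cauchy kernel with a holomorphic factor. The normalisation [g 0 = 1] preserves the
    singularity at 0, while the choice of [g] adapts the size of the kernel far away to the
    weights. *)
Definition ker (g : P -> P) y : P := g y *c cinv y.

(** Cauchy-Pompeiu at 0 for [y |-> F (z - y) *c g y]. As [g] is holomorphic, dbar falls on [F]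
    alone, and the sign of the reflection cancels that of the formula. *)
Lemma cauchy_conv g F (a : P) (M : R) z : hol setT g -> C1 setT F ->
  (forall x, M < `|x - a| -> F x = 0) ->
  cintegrable (fun w => dB F w *c ker g (z - w)) /\
  cint (fun w => dB F w *c ker g (z - w)) = kappa R *: (F z *c g 0).
Proof.
move=> [hg1 hg2] hF Fout.
have [hr dr] := C1_reflect z openT hF.
have {}hr : C1 setT (fun y => F (z - y)) by exact: hr.
pose M1 := Num.max 1 (`|z - a| + M).
have M10 : 0 < M1 by rewrite lt_max ltr01.
have out x : M1 < `|x| -> M < `|z - x - a|.
  rewrite gt_max => /andP[_ h].
  have := ler_normD (z - a - x) x; rewrite subrK.
  have := ler_normB (z - a) (z - a - x); rewrite opprB addrC subrK.
  by rewrite (addrAC z (- a)); lra.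
have hG := C1M openT hr hg1.
have Gout x : M1 < `|x| -> F (z - x) *c g x = 0.
  by move=> /out /Fout ->; rewrite cmul0l.
have dG y : dB (fun y => F (z - y) *c g y) y = - (dB F (z - y) *c g y).
  by rewrite (dbarM hr hg1 I) hg2 // cmul0r addr0 dr // cmulNl.
have i1 : cintegrable (fun y => dB F (z - y) *c ker g y).
  have : cintegrable (fun y => (dB F (z - y) *c g y) *c cinv y).
    apply: (@cintegrable_cinv_mul _ _ M1) => // x.
      apply: cvg_cmul; last exact: (C1_cont hg1).
      exact: (cont_reflect (C1_dbar_cont hF _)).
    by move=> /out h; rewrite (dbar_out Fout) // cmul0l.
  by apply: cintegrable_eq => y; rewrite /ker cmulA.
have e1 : cint (fun y => dB F (z - y) *c ker g y) = kappa R *: (F z *c g 0).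
  have := cauchy_pompeiu M10 hG Gout; rewrite subr0 => e.
  rewrite -[RHS]opprK -e -cintN.
    by apply: cint_eq => y; rewrite dG cmulNl opprK /ker cmulA.
  have := cintegrableN i1; apply: cintegrable_eq => y.
  by rewrite dG cmulNl /ker cmulA.
have e2 w : dB F (z - (z - w)) *c ker g (z - w) = dB F w *c ker g (z - w).
  by rewrite opprB addrC subrK.
split; first by have := cintegrable_reflect z i1; apply: cintegrable_eq.
by rewrite -e1 -(cint_reflect z i1); apply: cint_eq => w; rewrite e2.
Qed.

(** Dominated convergence concerns sequences, so continuity of parameter integrals is tested along
    sequences. *)
Lemma cont_seq F x : (forall s : nat -> P, s @ \oo --> x -> F (s n) @[n --> \oo] --> F x) ->
  {for x, continuous F}.
Proof.
move=> h; apply/cvgrPdist_lt => e e0; apply: contrapT => hn.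
have bad (n : nat) : exists y, `|y - x| < n.+1%:R^-1 /\ e <= `|F x - F y|.
  apply: contrapT => hy; apply: hn; apply/square_nbhs.
  exists n.+1%:R^-1; first by rewrite invr_gt0.
  move=> y yx; rewrite ltNge; apply/negP => ey; apply: hy; exists y; split => //.
have [s hs] := choice bad.
have sx : s @ \oo --> x.
  apply/cvgrPdist_lt => d d0; near=> n; rewrite distrC.
  have [h1 _] := hs n; apply: (lt_trans h1).
  by near: n; exact: (near_infty_natSinv_lt (PosNum d0)).
have /cvgrPdist_lt /(_ _ e0) [N _ /(_ N (leqnn N))] := h s sx.
by have [_ h2] := hs N; rewrite ltNge h2.
Unshelve. all: by end_near. Qed.

Lemma cvg_unshift (u : nat -> P) (l : P) (N : nat) :
  u (n + N)%N @[n --> \oo] --> l -> u @ \oo --> l.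
Proof.
move=> h; apply/cvgrPdist_lt => e e0.
have /cvgrPdist_lt /(_ _ e0) [M _ hM] := h.
exists (M + N)%N => // n /= Mn.
have Nn : (N <= n)%N by rewrite (leq_trans _ Mn) // leq_addl.
by have := hM (n - N)%N; rewrite /= subnK //; apply; rewrite leq_subRL // addnC.
Qed.

Lemma cint_cont U (H : P -> P -> P) (G : P -> R) x : open U -> U x ->
  (forall y, U y -> cmeas (H y)) -> (forall y w, U y -> `|H y w| <= G w) ->
  mu.-integrable setT (EFin \o G) -> (forall w, {for x, continuous (H ^~ w)}) ->
  {for x, continuous (fun y => cint (H y))}.
Proof.
move=> oU Ux mH HG iG Hc; apply: cont_seq => s sx.
have [N _ sU] : \forall n \near \oo, U (s n) by apply: sx; exact: open_nbhs_nbhs.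
suff : cint (H (s (n + N)%N)) @[n --> \oo] --> cint (H x).
  exact: (cvg_unshift (u := fun n => cint (H (s n)))).
have [] := @cint_dct R (fun n => H (s (n + N)%N)) (H x) G => //.
- by move=> n; apply: mH; apply: sU; rewrite /= leq_addl.
- move=> w; have : H (s n) w @[n --> \oo] --> H x w by exact: (cvg_comp _ _ sx (Hc w)).
  by move=> h; apply: (@cvg_comp _ _ _ (fun n => (n + N)%N) (fun n => H (s n) w) _ \oo); [exact: cvg_addnr | exact: h].
- by move=> n w; apply: HG; apply: sU; rewrite /= leq_addl.
Qed.

Lemma rpd_Rintegral b U (h d : P -> P -> R) (G : P -> R) x : open U -> U x ->
  (forall y, U y -> mu.-integrable setT (EFin \o h y)) ->
  (forall y w, U y -> rpd b (h ^~ w) y (d y w)) ->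
  (forall y w, U y -> `|d y w| <= G w) ->
  mu.-integrable setT (EFin \o G) ->
  rpd b (fun y => \int[mu]_w h y w) x (\int[mu]_w d x w).
Proof.
move=> oU Ux ih hd dG iG.
have [r r0 rU] := open_square oU Ux.
have lU t : t \in `](co b x - r), (co b x + r)[ -> U (line b x t).
  rewrite in_itv /= => /andP[t1 t2]; apply: rU.
  have tr : `|t - co b x| < r by rewrite ltr_norml; apply/andP; split; lra.
  by move: tr; case: (b) => /= tr; apply: normP_lt; rewrite /= ?subrr ?normr0.
have cx : (`](co b x - r), (co b x + r)[%classic : set R) (co b x).
  by rewrite /= in_itv /=; apply/andP; split; lra.
have hd' t w : U (line b x t) -> is_derive t (1:R) (fun s => h (line b x s) w) (d (line b x t) w).
  by move=> /(hd _ w); rewrite /rpd; case: (b).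
have G0 w : 0 <= G w by exact: le_trans (normr_ge0 _) (dG x w Ux).
pose f (t : R) (w : P) := h (line b x t) w.
have d1 t w : (`](co b x - r), (co b x + r)[%classic : set R) t -> setT w ->
    derivable (f ^~ w) t 1.
  by move=> /lU /hd' h1 _; exact: (@ex_derive _ _ _ _ _ _ _ (h1 w)).
have d2 t w : U (line b x t) -> partial1of2 f t w = d (line b x t) w.
  by move=> /hd' h1; rewrite partial1of2E; exact: (@derive_val _ _ _ _ _ _ _ (h1 w)).
have d3 t w : (`](co b x - r), (co b x + r)[%classic : set R) t -> setT w ->
    `|partial1of2 f t w| <= G w.
  by move=> /lU Ut _; rewrite d2 // dG.
have i1 t : (`](co b x - r), (co b x + r)[%classic : set R) t -> mu.-integrable setT (EFin \o f t).
  by move=> /lU; exact: ih.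
have k1 := derivable_under_integral measurableT cx i1 d1 G0 iG d3.
have k2 := differentiation_under_integral measurableT cx i1 d1 G0 iG d3.
have := derivableP k1; rewrite -derive1E k2; move/is_derive_eq; apply.
by apply: eq_Rintegral => w _; rewrite d2 line_co.
Qed.

Lemma C1_cint U (H : P -> P -> P) (D : bool -> P -> P -> P) (G : P -> R) : open U ->
  (forall y, U y -> cmeas (H y)) -> (forall b y, U y -> cmeas (D b y)) ->
  (forall b y w, U y -> hasp b (H ^~ w) y (D b y w)) ->
  (forall y w, U y -> {for y, continuous (H ^~ w)}) ->
  (forall b y w, U y -> {for y, continuous (fun y => D b y w)}) ->
  (forall y w, U y -> `|H y w| <= G w) -> (forall b y w, U y -> `|D b y w| <= G w) ->
  mu.-integrable setT (EFin \o G) ->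
  C1 U (fun y => cint (H y)) /\
  forall b y, U y -> hasp b (fun y => cint (H y)) y (cint (D b y)).
Proof.
move=> oU mH mD hD Hc Dc HG DG iG.
have iH y : U y -> cintegrable (H y).
  by move=> Uy; exact: (cintegrable_le (mH y Uy) (fun w => HG y w Uy) iG).
have h b y : U y -> hasp b (fun y => cint (H y)) y (cint (D b y)).
  move=> Uy; apply/hasp_rpd; split.
    rewrite cint1E.
    have -> : fst \o (fun y => cint (H y)) = (fun y => \int[mu]_w (H y w).1).
      by apply/funext => v; rewrite /= cint1E.
    apply: (@rpd_Rintegral b U (fun y w => (H y w).1) (fun y w => (D b y w).1) G) => // [v /iH|v w /(hD b v w)/hasp_rpd[]|v w /(DG b v w)].
    - exact: cintegrable1.
    - by [].
    - exact: (le_trans (norm1_le _)).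
  rewrite cint2E.
  have -> : snd \o (fun y => cint (H y)) = (fun y => \int[mu]_w (H y w).2).
    by apply/funext => v; rewrite /= cint2E.
  apply: (@rpd_Rintegral b U (fun y w => (H y w).2) (fun y w => (D b y w).2) G) => // [v /iH|v w /(hD b v w)/hasp_rpd[]|v w /(DG b v w)].
  - exact: cintegrable2.
  - by [].
  - exact: (le_trans (norm2_le _)).
split=> //; apply: (C1I (D := fun b y => cint (D b y)) oU) => [y Uy|b y Uy|b y Uy].
- exact: (cint_cont oU Uy mH HG iG (fun w => Hc y w Uy)).
- exact: h.
- exact: (cint_cont oU Uy (mD b) (DG b) iG (fun w => Dc b y w Uy)).
Qed.

End Convolution.

(** * Regularity of potentials *)

Section Potentials.
Variable R : realType.
Local Notation P := (R * R)%type.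
Local Notation mu := (@leb2 R).
Implicit Types (z w u x y : P) (U V : set P) (F G : P -> P).

Lemma C1_near_zero U F : open U -> C1 U F -> (forall x, ~ U x -> \near x, F x = 0) -> C1 setT F.
Proof.
move=> oU hF F0; split => x _; have [Ux|/F0 n0] := pselect (U x); first exact: (C1P hF Ux).
have n0' : \near x, cst 0 x = F x by near do apply/esym.
have c0 := C1_near (U := [set x]) (f := cst 0) (g := F).
apply: (C1P (c0 _ (C1_cst _ _))) => // y -> //.
Unshelve. all: by end_near. Qed.

Lemma near_out (a : P) (r : R) x : r < `|x - a| -> \near x, r < `|x - a|.
Proof.
move=> rx; apply/square_nbhs; exists (`|x - a| - r); first by rewrite subr_gt0.
move=> y yx; have := ler_normB (y - a) (y - x).
rewrite (_ : y - a - (y - x) = x - a); last by apply: pair_ext => /=; ring.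
by move: yx; lra.
Qed.

Lemma open_sqo (a : P) (r : R) : open [set x : P | `|x - a| < r].
Proof.
apply: openP_square => x /= xr; exists (r - `|x - a|); first by rewrite subr_gt0.
move=> y yx; rewrite (_ : y - a = (y - x) + (x - a)); last by rewrite addrA subrK.
by apply: (le_lt_trans (ler_normD _ _)); move: yx; lra.
Qed.

Lemma cont_ext F G x : F =1 G -> {for x, continuous F} -> {for x, continuous G}.
Proof. by move=> /funext ->. Qed.

(** The density [a] is merely integrable, so the derivatives fall on the kernel. [V] contains all
    differences [x - w] that the support of [a] produces, and the bounds are only asked there. *)
Lemma C1_convolution U V a K (B : R) : open U -> open V -> C1 V K -> cintegrable a ->
  (forall x w, U x -> a w != 0 -> V (x - w)) ->
  (forall x w, U x -> a w != 0 -> `|K (x - w)| <= B) ->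
  (forall b x w, U x -> a w != 0 -> `|pD b K (x - w)| <= B) ->
  [/\ C1 U (fun x => cint (fun w => a w *c K (x - w))),
   forall b x, U x -> pD b (fun x => cint (fun w => a w *c K (x - w))) x =
      cint (fun w => a w *c pD b K (x - w)) &
   forall x, U x -> dB (fun x => cint (fun w => a w *c K (x - w))) x =
      cint (fun w => a w *c dB K (x - w))].
Proof.
move=> oU oV hK [ma ia] aV KB DB.
(* Off [V] the kernel may fail to be measurable; it is replaced by its extension by zero, which [a]
   cannot distinguish from it. *)
have e (L : P -> P) x w : U x -> a w *c L (x - w) = a w *c cext V L (x - w).
  move=> Ux; have [->|w0] := eqVneq (a w) 0; first by rewrite !cmul0l.
  by rewrite cext_in //; exact: aV.
have m (L : P -> P) x : (forall y, V y -> {for y, continuous L}) -> U x ->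
    cmeas (fun w => a w *c L (x - w)).
  move=> Lc Ux; apply: (@cmeas_eq _ (fun w => a w *c cext V L (x - w))) => [w|].
    by rewrite -e.
  apply: cmeasM => //; apply: (cmeas_comp (cmeas_cont oV Lc)); exact: cmeas_reflect.
have bd (L : P -> P) x w : (U x -> a w != 0 -> `|L (x - w)| <= B) -> U x ->
    `|a w *c L (x - w)| <= 2 * `|B| * `|a w|.
  move=> h Ux; have [->|w0] := eqVneq (a w) 0; first by rewrite cmul0l normr0 mulr_ge0.
  rewrite (le_trans (norm_cmul _ _)) // -mulrA ler_wpM2l // mulrC ler_wpM2r //.
  by rewrite (le_trans (h Ux w0)) // ler_norm.
have iG : mu.-integrable setT (EFin \o (fun w => 2 * `|B| * `|a w|)).
  by have := integrableZl measurableT (2 * `|B|) ia; apply: eq_integrable.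
have := @C1_cint R U (fun x w => a w *c K (x - w)) (fun b x w => a w *c pD b K (x - w))
  (fun w => 2 * `|B| * `|a w|) oU.
case.
- by move=> y Uy; apply: m => // v Vv; exact: (C1_cont hK).
- by move=> b y Uy; apply: m => // v Vv; exact: (C1_pd_cont hK).
- move=> b y w Uy; have [->|w0] := eqVneq (a w) 0.
    under eq_fun do rewrite cmul0l; rewrite cmul0l; exact: (hasp_cst b 0 y).
  have h := haspM (hasp_cst b (a w) y) (hasp_shift (C1_hasp b hK (aV y w Uy w0))).
  by apply: (hasp_eq h); rewrite cmul0l add0r.
- move=> y w Uy; have [->|w0] := eqVneq (a w) 0.
    by apply: (@cont_ext (cst 0)) => [v|]; [rewrite cmul0l | exact: cvg_cst].
  apply: cvg_cmul; first exact: cvg_cst.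
  exact: (cont_shift (C1_cont hK (aV y w Uy w0))).
- move=> b y w Uy; have [->|w0] := eqVneq (a w) 0.
    by apply: (@cont_ext (cst 0)) => [v|]; [rewrite cmul0l | exact: cvg_cst].
  apply: cvg_cmul; first exact: cvg_cst.
  exact: (cont_shift (C1_pd_cont (b:=b) hK (aV y w Uy w0))).
- by move=> y w Uy; apply: bd => // *; exact: KB.
- by move=> b y w Uy; apply: bd => // *; exact: DB.
- exact: iG.
move=> h1 h2; split=> [|b x Ux|x Ux]; first exact: h1.
  exact: (hasp_pd (h2 b x Ux)).
have i b : cintegrable (fun w => a w *c pD b K (x - w)).
  apply: (cintegrable_le _ _ iG).
    by apply: m => // v Vv; exact: (C1_pd_cont hK).
  by move=> w; apply: bd => // *; exact: DB.
rewrite dBE (hasp_pd (h2 false x Ux)) (hasp_pd (h2 true x Ux)).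
rewrite -(cintM _ (i true)) -(cintD (i false) (cintegrableM _ (i true))) -cintM; last first.
  by apply: cintegrableD (i false) (cintegrableM _ (i true)).
apply: cint_eq => w; rewrite dBE.
move: (pD _ K _) (pD _ K _) (a w) => k1 k2 aw.
by apply: pair_ext; rewrite /=; ring.
Qed.

Lemma cinv_hol : hol [set~ (0 : P)] (@cinv R).
Proof.
have o := @open_neq0 R.
apply: (@hol_cinv R _ id) => //; first by move=> x /eqP.
exact: hol_id.
Qed.

Lemma pD_cinv b y : y != 0 -> pD b (@cinv R) y =
  - (cinv y *c cinv y *c (if b then cI R else cone R)).
Proof. by move=> y0; exact: (hasp_pd (@hasp_cinv R b id y _ y0 (hasp_id b y))). Qed.

Lemma pD_cinv_hol b : hol [set~ (0 : P)] (pD b (@cinv R)).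
Proof.
have o := @open_neq0 R.
apply: (hol_eq (f := fun y => - (cinv y *c cinv y *c (if b then cI R else cone R))) o) => [x /eqP x0|].
  by rewrite pD_cinv.
exact: (holN o (holM o (holM o cinv_hol cinv_hol) (hol_cst _ _))).
Qed.

Lemma pD_cinv_le b y : y != 0 -> `|pD b (@cinv R) y| <= 4 * `|y| ^- 2.
Proof.
move=> y0; rewrite pD_cinv // normrN (le_trans (norm_cmul _ _)) //.
have n1 : `|(if b then cI R else cone R)| <= 1.
  by case: b; apply: normP_le; rewrite /= ?normr0 ?normr1.
have n2 : `|cinv y *c cinv y| <= 2 * `|y| ^- 2.
  rewrite (le_trans (norm_cmul _ _)) // ler_wpM2l // expr2 invfM ler_pM // norm_cinv //.
have -> : 4 * `|y| ^- 2 = 2 * (2 * `|y| ^- 2 * 1) by ring.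
by rewrite ler_wpM2l // ler_pM.
Qed.

Definition locint (k : P -> P) := forall N : R, cintegrable (cext (sq 0 N) k).

Lemma locint_ker g : (forall x, {for x, continuous g}) -> locint (ker g).
Proof.
move=> gc N; pose M := Num.max N 1.
have M0 : 0 < M by rewrite lt_max ltr01 orbT.
have [C C0 gC] := compact_bound (sq_compact (a:=(0:P)) (r:=M)) (fun x _ => gc x).
apply: (cintegrable_le (G := fun y => 2 * C * (`|y|^-1 * \1_(sq 0 M) y))).
- apply: cmeas_cext; first exact: measurable_square.
  by apply: cmeasM; [exact: cmeas_contT | exact: cmeas_cinv].
- move=> y; rewrite /cext; case: asboolP => h; last by rewrite normr0 !mulr_ge0 ?invr_ge0 // ltW.
  have h' : sq 0 M y by apply: (le_trans h); rewrite le_max lexx.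
  rewrite indicE mem_set // mulr1 /ker (le_trans (norm_cmul _ _)) // -mulrA ler_wpM2l // ler_pM //.
    exact: gC.
  exact: norm_cinv.
- have := integrableZl measurableT (2 * C) (integrable_norm_inv M0).
  by apply: eq_integrable.
Qed.

Lemma locint_cinv : locint (@cinv R).
Proof.
have -> : @cinv R = ker (cst (cone R)) by apply/funext => y; rewrite /ker cmul1l.
by apply: locint_ker => x; exact: cvg_cst.
Qed.

(** The roles are exchanged with respect to [C1_potential]: the kernel is only locally integrable
    and the derivatives fall on [F]. *)
Lemma conv_C1 k F (a : P) (M : R) : locint k -> C1 setT F -> (forall x, M < `|x - a| -> F x = 0) ->
  [/\ C1 setT (fun z => cint (fun w => k w *c F (z - w))),
   forall b z, pD b (fun z => cint (fun w => k w *c F (z - w))) z =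
     cint (fun w => k w *c pD b F (z - w)) &
   forall z, dB (fun z => cint (fun w => k w *c F (z - w))) z =
     cint (fun w => k w *c dB F (z - w))].
Proof.
move=> hk hF Fout.
have [B B0 FB] := support_bound (fun x => C1_cont hF (I : setT x)) Fout.
have [B1 B10 FB1] := support_bound (fun x => C1_pd_cont (b:=false) hF (I : setT x)) (pd_out false Fout).
have [B2 B20 FB2] := support_bound (fun x => C1_pd_cont (b:=true) hF (I : setT x)) (pd_out true Fout).
have BB : B <= B + B1 + B2 by lra.
have HB b x : `|pD b F x| <= B + B1 + B2.
  by case: b; [apply: (le_trans (FB2 x)); lra | apply: (le_trans (FB1 x)); lra].
(* For [z] within distance 1 of [x0], only the values of the kernel on this square meet the support
   of [F], so the kernel may be truncated to an integrable one. *)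
pose k' x0 := cext (sq 0 (`|x0 - a| + 1 + M)) k.
have loc (L : P -> P) x0 z : (forall x, M < `|x - a| -> L x = 0) -> `|z - x0| < 1 ->
    cint (fun w => k w *c L (z - w)) = cint (fun w => k' x0 w *c L (z - w)).
  move=> L0 zx; apply: cint_eq => w; rewrite /k' /cext; case: asboolP => // /negP.
  rewrite /sq /= subr0 -ltNge => h; rewrite L0 ?cmul0r ?cmul0l //.
  have := ler_normB (z - a) (z - w - a).
  have -> : z - a - (z - w - a) = w by apply: pair_ext => /=; ring.
  have := ler_normD (z - x0) (x0 - a); rewrite addrA subrK; lra.
have H x0 := @C1_convolution [set x | `|x - x0| < 1] setT (k' x0) F (B + B1 + B2)
  (open_sqo (a:=x0) (r:=1)) openT hF (hk _) (fun _ _ _ _ => I)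
  (fun x w _ _ => le_trans (FB (x - w)) BB) (fun b x w _ _ => HB b (x - w)).
have x0in x0 : [set x | `|x - x0| < 1] x0 by rewrite /= subrr normr0.
have E x0 x : [set x | `|x - x0| < 1] x ->
    cint (fun w => k' x0 w *c F (x - w)) = cint (fun w => k w *c F (x - w)).
  by move=> h; rewrite -loc.
have nE x0 := open_near (open_sqo (a:=x0) (r:=1)) (E x0) (x0in x0).
split.
- split => x0 _; have [h _ _] := H x0.
  exact: (C1P (C1_eq (open_sqo (a:=x0) (r:=1)) (E x0) h) (x0in x0)).
- move=> b x0; have [_ h _] := H x0.
  by rewrite -(pd_near b (nE x0)) (h b x0 (x0in x0)) -loc // ?subrr ?normr0 //; exact: pd_out.
- move=> x0; have [_ _ h] := H x0.
  by rewrite -(dbar_near (nE x0)) (h x0 (x0in x0)) -loc // ?subrr ?normr0 //; exact: dbar_out.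
Qed.

(* [a] is supported in an annulus around [x0], off which the kernel is smooth. *)
Lemma C1_potential K a x0 (d M : R) : 0 < d -> C1 [set~ (0 : P)] K -> cintegrable a ->
  (forall w, a w != 0 -> d <= `|w - x0| <= M) ->
  let U := [set x | `|x - x0| < d / 2] in
  [/\ C1 U (fun x => cint (fun w => a w *c K (x - w))),
   forall b x, U x -> pD b (fun x => cint (fun w => a w *c K (x - w))) x =
      cint (fun w => a w *c pD b K (x - w)) &
   forall x, U x -> dB (fun x => cint (fun w => a w *c K (x - w))) x =
      cint (fun w => a w *c dB K (x - w))].
Proof.
move=> d0 hK ia aM U.
pose A : set P := [set z : P | d / 2 <= `|z|] `&` sq 0 (M + d).
have cA : compact A.
  apply: (subclosed_compact _ (@sq_compact R 0 (M + d))); last by move=> z [].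
  apply: closedI; last by apply: compact_closed; [exact: norm_hausdorff | exact: sq_compact].
  rewrite (_ : [set z : P | d / 2 <= `|z|] = (fun z : P => `|z|) @^-1` [set t | d / 2 <= t]) //.
  apply: preimage_closed; last exact: closed_ge.
  by move=> z _; apply: cvg_norm; exact: cvg_id.
have A0 z : A z -> [set~ (0 : P)] z.
  by move=> [h _] z0; move: h; rewrite /= z0 normr0; lra.
have [B B0 KB] := compact_bound cA (fun z Az => C1_cont hK (A0 z Az)).
have [B1 B10 KB1] := compact_bound cA (fun z Az => C1_pd_cont (b:=false) hK (A0 z Az)).
have [B2 B20 KB2] := compact_bound cA (fun z Az => C1_pd_cont (b:=true) hK (A0 z Az)).
have aA x w : U x -> a w != 0 -> A (x - w).
  move=> Ux /aM /andP[h1 h2]; rewrite /U /= in Ux; rewrite /A /sq /= subr0.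
  have := ler_normB (x - x0) (x - w); rewrite (_ : x - x0 - (x - w) = w - x0); last by apply: pair_ext => /=; ring.
  have := ler_normB (x - x0) (w - x0); rewrite (_ : x - x0 - (w - x0) = x - w); last by apply: pair_ext => /=; ring.
  by move=> h3 h4; split => /=; lra.
apply: (@C1_convolution U [set~ (0 : P)] a K (B + B1 + B2) (open_sqo (a:=x0) (r:=d/2)) (@open_neq0 R) hK ia).
- by move=> x w Ux /(aA x w Ux) /A0.
- by move=> x w Ux /(aA x w Ux) /KB h; apply: (le_trans h); lra.
- move=> b x w Ux /(aA x w Ux) h; case: b; first by apply: (le_trans (KB2 _ h)); lra.
  by apply: (le_trans (KB1 _ h)); lra.
Qed.

Lemma hol_potential K a x0 (d M : R) : 0 < d -> hol [set~ (0 : P)] K -> cintegrable a ->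
  (forall w, a w != 0 -> d <= `|w - x0| <= M) ->
  hol [set x | `|x - x0| < d / 2] (fun x => cint (fun w => a w *c K (x - w))).
Proof.
move=> d0 [hK K0] ia aM; have [h1 _ h3] := C1_potential d0 hK ia aM.
split=> // x Ux; rewrite h3 // (cint_eq (G := fun w => 0 *c a w)).
  by rewrite cintM // cmul0l.
move=> w; have [->|w0] := eqVneq (a w) 0; first by rewrite cmul0l cmul0r.
rewrite K0 ?cmul0r ?cmul0l //= => xw.
have /andP[h4 _] := aM w w0; move: Ux; rewrite /= -normrN opprB.
by move/eqP: xw; rewrite subr_eq0 => /eqP ->; rewrite distrC; lra.
Qed.

End Potentials.

(** * Local representation and regularity *)

Section Regularity.
Variable R : realType.
Local Notation P := (R * R)%type.
Local Notation mu := (@leb2 R).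
Implicit Types (z w u x y : P) (U V : set P) (F G h v : P -> P).

Lemma sqo_in (x0 : P) (r : R) U : open U -> U x0 ->
  exists2 r : R, 0 < r & sq x0 (2 * r) `<=` U.
Proof.
move=> oU /(open_square oU)[d d0 dU]; exists (d / 4); first by rewrite divr_gt0.
by move=> y; rewrite /sq /= => h; apply: dU; lra.
Qed.

Lemma sq_out x0 (r : R) U w : sq x0 (2 * r) `<=` U -> ~ U w -> 2 * r < `|w - x0|.
Proof. by move=> rU nU; rewrite ltNge; apply/negP => h; apply: nU; exact: rU. Qed.

Lemma cont_mul_support F v U x0 (r : R) : open U -> sq x0 (2 * r) `<=` U ->
  (forall x, {for x, continuous F}) -> (forall x, 2 * r < `|x - x0| -> F x = 0) ->
  (forall x, U x -> {for x, continuous v}) -> forall x, {for x, continuous (fun w => F w *c v w)}.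
Proof.
move=> oU rU Fc F0 vc x; have [Ux|nU] := pselect (U x).
  by apply: cvg_cmul; [exact: Fc | exact: vc].
apply: (cont_near (f := cst 0)); last exact: cvg_cst.
have := near_out (sq_out rU nU); apply: filterS => y h.
by rewrite F0 // cmul0l.
Qed.

Lemma pD_cut0 b x0 (r : R) x : 0 < r -> `|x - x0| < r \/ 2 * r < `|x - x0| ->
  pD b (ccut x0 r) x = 0.
Proof.
move=> r0 h.
have [c hc] : exists c, \near x, cst c x = ccut x0 r x.
  case: h => h; [exists (cone R) | exists 0]; last first.
    have := near_out h; apply: filterS => y yx.
    by rewrite /ccut cut0 // ltW.
  have : \near x, `|x - x0| < r by exact: (open_near (open_sqo (a:=x0) (r:=r)) (fun y Uy => Uy) h).
  by apply: filterS => y yx; rewrite /ccut cut1 // ltW.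
by rewrite -(pd_near b hc); exact: (hasp_pd (hasp_cst b c x)).
Qed.

Lemma ccut_out x0 (r : R) x : 0 < r -> 2 * r < `|x - x0| -> ccut x0 r x = 0.
Proof. by move=> r0 h; rewrite /ccut cut0 // ltW. Qed.

Lemma cut_mul v U x0 (r : R) : 0 < r -> open U -> sq x0 (2 * r) `<=` U -> C1 U v ->
  [/\ C1 setT (fun w => ccut x0 r w *c v w),
    forall w, 2 * r < `|w - x0| -> ccut x0 r w *c v w = 0,
    forall b w, pD b (fun w => ccut x0 r w *c v w) w =
      pD b (ccut x0 r) w *c v w + ccut x0 r w *c pD b v w &
    forall w, dB (fun w => ccut x0 r w *c v w) w = dB (ccut x0 r) w *c v w + ccut x0 r w *c dB v w].
Proof.
move=> r0 oU rU hv; have [hc _] := cut_C1 x0 r0.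
have out w : 2 * r < `|w - x0| -> ccut x0 r w *c v w = 0.
  by move=> h; rewrite ccut_out // cmul0l.
have hU := C1M oU (C1_sub (@subsetT _ U) hc) hv.
split=> //.
- apply: (C1_near_zero oU hU) => x nU.
  by have := near_out (sq_out rU nU); apply: filterS => y; exact: out.
- move=> b w; have [Uw|nU] := pselect (U w).
    by rewrite (hasp_pd (haspM (C1_hasp b hc (I : setT w)) (C1_hasp b hv Uw))).
  have ow := sq_out rU nU.
  by rewrite (pd_out b out ow) pD_cut0 ?ccut_out ?cmul0l ?addr0 //; right.
- move=> w; have [Uw|nU] := pselect (U w).
    exact: (dbarM (C1_sub (@subsetT _ U) hc) hv Uw).
  have ow := sq_out rU nU.
  by rewrite (dbar_out out ow) dcut0 ?ccut_out ?cmul0l ?addr0 //; right.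
Qed.

Lemma conv_swap F (a : P) (M : R) z : (forall x, {for x, continuous F}) ->
  (forall x, M < `|x - a| -> F x = 0) ->
  cintegrable (fun w => F w *c cinv (z - w)) /\
  cint (fun w => F w *c cinv (z - w)) = cint (fun w => cinv w *c F (z - w)).
Proof.
move=> Fc Fout; pose M1 := Num.max 1 (`|z - a| + M).
have M10 : 0 < M1 by rewrite lt_max ltr01.
have out x : M1 < `|x| -> M < `|z - x - a|.
  rewrite gt_max => /andP[_ h].
  have := ler_normB (z - a) (z - x - a).
  rewrite (_ : z - a - (z - x - a) = x); last by apply: pair_ext => /=; ring.
  lra.
have i1 : cintegrable (fun y => F (z - y) *c cinv y).
  apply: (cintegrable_cinv_mul M10) => x; first exact: (cont_reflect (Fc _)).
  by move=> /out; exact: Fout.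
have e w : F (z - (z - w)) *c cinv (z - w) = F w *c cinv (z - w) by rewrite subKr.
split; first by have := cintegrable_reflect z i1; apply: cintegrable_eq.
have := cint_reflect z i1; rewrite (cint_eq e) => ->.
by apply: cint_eq => w; rewrite cmulC.
Qed.

Lemma cauchy_conv1 F (a : P) (M : R) z : C1 setT F -> (forall x, M < `|x - a| -> F x = 0) ->
  cint (fun w => dB F w *c cinv (z - w)) = kappa R *: F z.
Proof.
move=> hF Fout; have [_] := @cauchy_conv R (cst (cone R)) F a M z (hol_cst _ _) hF Fout.
rewrite cmul1r => <-; apply: cint_eq => w; by rewrite /ker cmul1l.
Qed.

Lemma kappaK (c : P) : (kappa R)^-1 *: (kappa R *: c) = c.
Proof. by rewrite scalerA mulVf ?scale1r // gt_eqF // kappa_gt0. Qed.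

Section Representation.
Variables (U : set P) (x0 : P) (r : R) (v : P -> P).
Hypotheses (r0 : 0 < r) (oU : open U) (rU : sq x0 (2 * r) `<=` U) (hv : C1 U v).

(* By the Leibniz rule [dB (ccut v) = src + edge]; [edge] vanishes near [x0]. *)
Definition src w := ccut x0 r w *c dB v w.
Definition edge w := dB (ccut x0 r) w *c v w.

Lemma edge_cont x : {for x, continuous edge}.
Proof.
have [hc _] := cut_C1 x0 r0.
apply: (cont_mul_support oU rU) => [y|y h|y Uy].
- exact: (C1_dbar_cont hc).
- by rewrite dcut0 //; right.
- exact: (C1_cont hv).
Qed.

Lemma edge_supp w : edge w != 0 -> r <= `|w - x0| <= 2 * r.
Proof.
move=> h; rewrite !leNgt; apply/andP; split; apply/negP => k; move: h.
  by rewrite /edge dcut0 ?cmul0l ?eqxx //; left.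
by rewrite /edge dcut0 ?cmul0l ?eqxx //; right.
Qed.

Lemma edge_int : cintegrable edge.
Proof.
apply: (@cintegrable_cont _ _ x0 (2 * r)) => [x|x h]; first exact: edge_cont.
by rewrite /edge dcut0 ?cmul0l //; right.
Qed.

Lemma src_cont x : {for x, continuous src}.
Proof.
have [hc _] := cut_C1 x0 r0.
apply: (cont_mul_support oU rU) => [y|y h|y Uy].
- exact: (C1_cont hc).
- exact: ccut_out.
- exact: (C1_dbar_cont hv).
Qed.

Lemma src_out w : 2 * r < `|w - x0| -> src w = 0.
Proof. by move=> h; rewrite /src ccut_out // cmul0l. Qed.

Lemma edge_out w : 2 * r < `|w - x0| -> edge w = 0.
Proof. by move=> h; rewrite /edge dcut0 ?cmul0l //; right. Qed.

(** Cauchy-Pompeiu for [ccut v]. The first potential is as regular as [dB v], the second one is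
    smooth near [x0]: this splitting drives the regularity theory. *)
Lemma representation z : `|z - x0| <= r ->
  v z = (kappa R)^-1 *: (cint (fun w => cinv w *c src (z - w)) + cint (fun w => edge w *c cinv (z - w))).
Proof.
move=> zr; have [hF Fout _ dF] := cut_mul r0 oU rU hv.
have [i1 e1] := conv_swap z src_cont src_out.
have [i2 _] := conv_swap z edge_cont edge_out.
have := cauchy_conv1 z hF Fout; rewrite ccutE cut1 // scale1r => e.
rewrite -[LHS]kappaK -e -e1 -cintD //; congr (_ *: _); apply: cint_eq => w.
by rewrite dF cmulDl addrC.
Qed.

End Representation.

(** Cauchy's integral formula, with the contour replaced by the ring on which the cutoff varies. *)
Lemma hol_representation U x0 (r : R) h z : 0 < r -> open U -> sq x0 (2 * r) `<=` U -> hol U h ->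
  `|z - x0| <= r -> h z = (kappa R)^-1 *: cint (fun w => edge x0 r h w *c cinv (z - w)).
Proof.
move=> r0 oU rU [hh h0] zr; rewrite (representation r0 oU rU hh zr).
rewrite (cint_eq (G := fun w => 0 *c src x0 r h w)); last first.
  move=> w; rewrite cmul0l /src; have [Uw|nU] := pselect (U (z - w)); first by rewrite h0 // !cmul0r.
  by rewrite ccut_out ?cmul0l ?cmul0r //; exact: (sq_out rU nU).
have i : cintegrable (src x0 r h).
  by apply: (@cintegrable_cont _ _ x0 (2 * r)) => [x|x k]; [exact: (src_cont r0 oU rU hh) | exact: src_out].
by rewrite cintM // cmul0l add0r.
Qed.

Section DerivativeFormula.
Variables (U : set P) (x0 : P) (r : R) (v : P -> P).
Hypotheses (r0 : 0 < r) (oU : open U) (rU : sq x0 (2 * r) `<=` U) (hv : C1 U v) (hf : C1 U (dB v)).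
Let U0 := [set x | `|x - x0| < r / 2].

(** The derivative falls on the density in the [src] term, whose kernel is singular, and on the
    kernel in the [edge] term, whose density is only continuous. *)
Lemma derivative_formula b z : U0 z -> pD b v z = (kappa R)^-1 *:
  (cint (fun w => cinv w *c pD b (src x0 r v) (z - w)) +
   cint (fun w => edge x0 r v w *c pD b (@cinv R) (z - w))).
Proof.
move=> Uz; have oU0 : open U0 := open_sqo (a:=x0) (r:=r/2).
have [hs sout _ _] := cut_mul r0 oU rU hf.
have [q1 dq1 _] := conv_C1 (@locint_cinv R) hs sout.
have [h2 _] := @cinv_hol R.
have [q2 dq2 _] := C1_potential r0 h2 (edge_int r0 oU rU hv) (@edge_supp x0 r v r0).
have n : \near z, creal (kappa R)^-1 *c (cint (fun w => cinv w *c src x0 r v (z - w)) +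
    cint (fun w => edge x0 r v w *c cinv (z - w))) = v z.
  apply: (open_near oU0 _ Uz) => y; rewrite /U0 /= => h.
  rewrite crealM -(representation r0 oU rU hv) //; apply: ltW; apply: (lt_trans h).
  by rewrite ltr_pdivrMr // ltr_pMr // ltr1n.
rewrite -(pd_near b n).
have hp := haspM (hasp_cst b (creal (kappa R)^-1) z)
  (haspD (C1_hasp b q1 (I : setT z)) (C1_hasp b q2 Uz)).
by rewrite (hasp_pd hp) cmul0l add0r crealM dq1 dq2.
Qed.

End DerivativeFormula.

(** In [derivative_formula] the density [pD b src] has two parts. The one with [pD b (dB v)] is C1;
    the one with the derivative of the cutoff vanishes near [x0], and its potential is holomorphic
    there, like the [edge] term. Hence [pD b v] is C1, and only the first part contributes to its
    dbar derivative, which gives the commutation of [dB] and [pD b]. *)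
Lemma regularity1 U v : open U -> C1 U v -> C1 U (dB v) -> (forall b, C1 U (pD b (dB v))) ->
  forall b, C1 U (pD b v) /\ forall x, U x -> dB (pD b v) x = pD b (dB v) x.
Proof.
move=> oU hv hf hpf b.
suff loc x0 : U x0 -> exists2 r : R, 0 < r & C1 [set x | `|x - x0| < r] (pD b v) /\
    dB (pD b v) x0 = pD b (dB v) x0.
  split; last by move=> x /loc[r _ []].
  split => x Ux; have [r r0 [h _]] := loc x Ux.
  by apply: (C1P h); rewrite /= subrr normr0.
move=> Ux0; have [r r0 rU] := sqo_in 0 oU Ux0.
have [hc _] := cut_C1 x0 r0.
have [hs sout ps _] := cut_mul r0 oU rU hf.
have [hp pout _ dp] := cut_mul r0 oU rU (hpf b).
have [t1 _ dt1] := conv_C1 (@locint_cinv R) hp pout.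
pose e1 w := pD b (ccut x0 r) w *c dB v w.
have e1c x : {for x, continuous e1}.
  apply: (cont_mul_support oU rU) => [y|y h|y Uy].
  - exact: (C1_pd_cont hc).
  - by rewrite pD_cut0 //; right.
  - exact: (C1_cont hf).
have e1out w : 2 * r < `|w - x0| -> e1 w = 0.
  by move=> h; rewrite /e1 pD_cut0 ?cmul0l //; right.
have e1supp w : e1 w != 0 -> r <= `|w - x0| <= 2 * r.
  move=> h; rewrite !leNgt; apply/andP; split; apply/negP => k; move: h.
    by rewrite /e1 pD_cut0 ?cmul0l ?eqxx //; left.
  by rewrite /e1 pD_cut0 ?cmul0l ?eqxx //; right.
have ie1 := cintegrable_cont e1c e1out.
have t2 := hol_potential r0 (@cinv_hol R) ie1 e1supp.
have t3 := hol_potential r0 (@pD_cinv_hol R b) (edge_int r0 oU rU hv) (@edge_supp x0 r v r0).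
pose U0 := [set x | `|x - x0| < r / 2].
have oU0 : open U0 := open_sqo (a:=x0) (r:=r/2).
have Ux00 : U0 x0 by rewrite /U0 /= subrr normr0 divr_gt0.
have t1' := C1_sub (@subsetT _ U0) t1.
have hsum := C1D oU0 (C1D oU0 t1' t2.1) t3.1.
have hsumk := C1M oU0 (C1_cst U0 (creal (kappa R)^-1)) hsum.
have E z : U0 z -> creal (kappa R)^-1 *c (cint (fun w => cinv w *c (ccut x0 r (z - w) *c pD b (dB v) (z - w)))
    + cint (fun w => e1 w *c cinv (z - w)) + cint (fun w => edge x0 r v w *c pD b (@cinv R) (z - w))) = pD b v z.
  move=> Uz; rewrite (derivative_formula r0 oU rU hv hf b Uz) crealM; congr (_ *: (_ + _)).
  have [i2 ->] := conv_swap z e1c e1out.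
  have i2' : cintegrable (fun w => cinv w *c e1 (z - w)).
    have := cintegrable_reflect z i2; apply: cintegrable_eq => w.
    by rewrite subKr cmulC.
  have [i3 _] := conv_swap z (fun x => C1_cont hp (I : setT x)) pout.
  have i3' : cintegrable (fun w => cinv w *c (ccut x0 r (z - w) *c pD b (dB v) (z - w))).
    have := cintegrable_reflect z i3; apply: cintegrable_eq => w.
    by rewrite subKr cmulC.
  rewrite -cintD //; apply: cint_eq => w; rewrite ps /e1.
  by rewrite -cmulDr addrC.
exists (r / 2); first by rewrite divr_gt0.
split; first exact: (C1_eq oU0 E hsumk).
rewrite -(dbar_near (open_near oU0 E Ux00)).
rewrite (dbarM (C1_cst U0 (creal (kappa R)^-1)) hsum Ux00) dbar_cst cmul0l add0r.
rewrite (dbarD (C1D oU0 t1' t2.1) t3.1 Ux00) (dbarD t1' t2.1 Ux00) t2.2 // t3.2 // !addr0.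
rewrite dt1 crealM.
have [i4 e4] := conv_swap x0 (fun x => C1_dbar_cont hp (I : setT x)) (dbar_out pout).
rewrite -e4 (cauchy_conv1 x0 hp pout) kappaK ccutE cut1 ?scale1r //.
by rewrite subrr normr0 ltW.
Qed.

Lemma regularity U v f : open U -> C1 U v -> (forall x, U x -> dB v x = f x) -> smooth_on U f ->
  smooth_on U v /\ forall s x, U x -> dB (pds s v) x = pds s f x.
Proof.
move=> oU hv vf /smooth_onP hf.
(* The differentiated equation is part of the induction, since it supplies the regularity of
   [dB (pds s v)] that the next step requires. *)
have H s : C1 U (pds s v) /\ forall x, U x -> dB (pds s v) x = pds s f x.
  elim: s => [|b s [IH1 IH2]]; first by split.
  have E x : U x -> pds s f x = dB (pds s v) x by move=> /IH2.
  have Eb c x : U x -> pds (c :: s) f x = pD c (dB (pds s v)) x.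
    by move=> Ux; rewrite pds_cons; exact: (pd_near c (open_near oU E Ux)).
  have [h1 h2] := regularity1 oU IH1 (C1_eq oU E (hf s)) (fun c => C1_eq oU (Eb c) (hf (c :: s))) b.
  by rewrite !pds_cons; split => // x Ux; rewrite h2 // -Eb // pds_cons.
by split; [apply/smooth_onP => s; case: (H s) | move=> s; case: (H s)].
Qed.

Lemma smooth_cst U (c : P) : smooth_on U (cst c).
Proof.
apply/smooth_onP => s; have [d ->] : exists d, pds s (cst c) = cst d.
  elim: s => [|b s [d IH]]; first by exists c.
  by exists 0; rewrite pds_cons IH; apply/funext => x; exact: (hasp_pd (hasp_cst b d x)).
exact: C1_cst.
Qed.

Lemma hol_smooth U h : open U -> hol U h -> smooth_on U h.
Proof.
by move=> oU [h1 h2]; have [] := regularity oU h1 h2 (@smooth_cst U 0).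
Qed.

End Regularity.

(** * Interior estimates and limits of holomorphic functions *)

Section Estimates.
Variable R : realType.
Local Notation P := (R * R)%type.
Local Notation mu := (@leb2 R).
Implicit Types (z w u x y : P) (U V : set P) (F G h v : P -> P).

Lemma ccut_le1 x0 (r : R) w : `|ccut x0 r w| <= 1.
Proof.
have /andP[h1 h2] := cut_bound x0 r w.
by apply: normP_le; rewrite /= ?normr0 // ger0_norm.
Qed.

Lemma edge_le x0 (r : R) v w : 0 < r -> `|edge x0 r v w| <= 8 / r * `|v w|.
Proof.
move=> r0; apply: (le_trans (norm_cmul _ _)); rewrite mulrA ler_wpM2r //.
have := dcut_bound x0 w r0.
have -> : 8 / r = 2 * (4 / r) by rewrite mulrA -natrM.
by move=> h; rewrite ler_pM2l.
Qed.

(** The constant depends on [r] alone, and [M] is only a bound on the square about [x0]: this is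
    what allows [M] to be a multiple of the inverse weight at [x0] later. *)
Lemma gradient_estimate (r : R) : 0 < r -> exists2 C : R, 0 < C &
  forall U v x0 (M : R) b, open U -> sq x0 (2 * r) `<=` U -> C1 U v -> C1 U (dB v) ->
  (forall w, sq x0 (2 * r) w -> [/\ `|v w| <= M, `|dB v w| <= M & `|pD b (dB v) w| <= M]) ->
  `|pD b v x0| <= C * M.
Proof.
move=> r0; have r20 : 0 < 2 * r by rewrite mulr_gt0.
have k0 := kappa_gt0 R.
pose I1 := \int[mu]_w (`|w|^-1 * \1_(sq 0 (2 * r)) w).
have I10 : 0 <= I1 by apply: Rintegral_ge0 => w _; rewrite mulr_ge0 ?invr_ge0.
pose I2 : R := (2 * (2 * r)) ^+ 2.
have I20 : 0 <= I2 by rewrite exprn_ge0 // !mulr_ge0 // ltW.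
(* First summand: [|pD b src| <= (8 / r + 2) * M] against the kernel [1 / |w|], whose integral is
   [I1]. Second: [2 * (8 / r) * (4 / r ^+ 2)] from [edge] and the differentiated kernel, times the
   area [I2]. *)
pose C1' := 2 * (8 / r + 2) * I1 + 64 / r ^+ 3 * I2.
have C10 : 0 <= C1'.
  have h8 : 0 <= 8 / r by rewrite divr_ge0 // ltW.
  apply: addr_ge0; first by rewrite !mulr_ge0 // addr_ge0.
  by rewrite mulr_ge0 // divr_ge0 // exprn_ge0 // ltW.
exists ((kappa R)^-1 * C1' + 1); first by rewrite ltr_wpDl // mulr_ge0 // invr_ge0 ltW.
move=> U v x0 M b oU rU hv hf vM.
have x0in : sq x0 (2 * r) x0 by rewrite /sq /= subrr normr0 ltW.
have M0 : 0 <= M by have [h _ _] := vM x0 x0in; exact: le_trans (normr_ge0 _) h.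
have Uz : [set x | `|x - x0| < r / 2] x0 by rewrite /= subrr normr0 divr_gt0.
rewrite (derivative_formula r0 oU rU hv hf b Uz) normrZ gtr0_norm ?invr_gt0 //.
suff : `|cint (fun w => cinv w *c pD b (src x0 r v) (x0 - w)) +
   cint (fun w => edge x0 r v w *c pD b (@cinv R) (x0 - w))| <= C1' * M.
  move=> h; rewrite mulrDl mul1r -mulrA; apply: ler_wpDr => //.
  by rewrite ler_wpM2l // invr_ge0 ltW.
rewrite (le_trans (ler_normD _ _)) // mulrDl lerD //.
  have [hs sout ps _] := cut_mul r0 oU rU hf.
  have mm : cmeas (fun w => cinv w *c pD b (src x0 r v) (x0 - w)).
    apply: cmeasM; first exact: cmeas_cinv.
    apply: cmeas_comp; last exact: cmeas_reflect.
    by apply: cmeas_contT => x; exact: (C1_pd_cont hs).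
  have iG := integrableZl measurableT (2 * ((8 / r + 2) * M)) (integrable_norm_inv r20).
  have bnd w : `|cinv w *c pD b (src x0 r v) (x0 - w)| <=
      2 * ((8 / r + 2) * M) * (`|w|^-1 * \1_(sq 0 (2 * r)) w).
    rewrite indicE; have [h|h] := leP `|w| (2 * r); last first.
      rewrite (pd_out b sout) ?cmul0r ?normr0; last by rewrite addrAC subrr sub0r normrN.
      by rewrite !mulr_ge0 ?invr_ge0 // addr_ge0 // divr_ge0 // ltW.
    rewrite mem_set ?mulr1 ?(le_trans (norm_cmul _ _)) //; last by rewrite /sq /= subr0.
    rewrite -mulrA ler_wpM2l // mulrC ler_pM // ?norm_cinv //.
    have hin : sq x0 (2 * r) (x0 - w) by rewrite /sq /= addrAC subrr sub0r normrN.
    have [_ d1 d2] := vM _ hin.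
    rewrite /src ps (le_trans (ler_normD _ _)) // mulrDl lerD //.
      rewrite (le_trans (norm_cmul _ _)) // (_ : 8 / r * M = 2 * (4 / r * M)); last by field; rewrite gt_eqF.
      by have [_ hd] := cut_C1 x0 r0; rewrite ler_wpM2l // ler_pM.
    rewrite (le_trans (norm_cmul _ _)) // ler_wpM2l // -[leRHS]mul1r ler_pM //.
    exact: ccut_le1.
  have iG' : mu.-integrable setT (EFin \o (fun w => 2 * ((8 / r + 2) * M) * (`|w|^-1 * \1_(sq 0 (2 * r)) w))).
    by apply: eq_integrable iG.
  apply: (le_trans (norm_cint_le mm bnd iG')).
  rewrite RintegralZl //; last exact: integrable_norm_inv.
  by rewrite -/I1 le_eqVlt; apply/orP; left; apply/eqP; ring.
pose L := cext [set~ (0 : P)] (pD b (@cinv R)).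
have [hpc _] := @pD_cinv_hol R b.
have mm : cmeas (fun w => edge x0 r v w *c pD b (@cinv R) (x0 - w)).
  apply: (@cmeas_eq _ (fun w => edge x0 r v w *c L (x0 - w))) => [w|].
    have [->|e0] := eqVneq (edge x0 r v w) 0; first by rewrite !cmul0l.
    rewrite /L cext_in // => /eqP; rewrite subr_eq0 => /eqP xw.
    by have := edge_supp r0 e0; rewrite -xw subrr normr0 leNgt r0.
  apply: cmeasM; first by apply: cmeas_contT => x; exact: (edge_cont r0 oU rU hv).
  apply: cmeas_comp; last exact: cmeas_reflect.
  apply: cmeas_cont => [|x hx]; first exact: open_neq0.
  exact: (C1_cont hpc).
have bnd w : `|edge x0 r v w *c pD b (@cinv R) (x0 - w)| <= 64 / r ^+ 3 * M.
  have [->|e0] := eqVneq (edge x0 r v w) 0.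
    by rewrite cmul0l normr0 mulr_ge0 // divr_ge0 // exprn_ge0 // ltW.
  have /andP[w1 w2] := edge_supp r0 e0.
  have nz : x0 - w != 0 by rewrite -normr_gt0 distrC (lt_le_trans r0).
  have [d1 _ _] := vM w w2.
  rewrite (le_trans (norm_cmul _ _)) //.
  have -> : 64 / r ^+ 3 * M = 2 * ((8 / r * M) * (4 * r ^- 2)) by field; rewrite gt_eqF.
  rewrite ler_wpM2l // ler_pM //.
    apply: (le_trans (edge_le x0 v w r0)).
    by apply: ler_wpM2l => //; apply: divr_ge0 => //; exact: ltW.
  apply: (le_trans (pD_cinv_le b nz)); rewrite ler_wpM2l // lef_pV2 ?posrE ?exprn_gt0 ?normr_gt0 //.
  by rewrite lerXn2r ?nnegrE ?(ltW r0) // distrC.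
have out w : 2 * r < `|w - x0| -> edge x0 r v w *c pD b (@cinv R) (x0 - w) = 0.
  by move=> h; rewrite (edge_out _ r0 h) cmul0l.
apply: (le_trans (norm_cint_bounded mm bnd out)).
have -> : fine (mu (sq x0 (2 * r))) = I2 by rewrite leb2_sq // ltW.
by rewrite mulrAC.
Qed.

(** Local bounds let [hol_representation] pass to the limit by dominated convergence, so pointwise
    convergence suffices; the limit is then a holomorphic potential near each point. *)
Lemma hol_limit U (hn : nat -> P -> P) h : open U -> (forall n, hol U (hn n)) ->
  (forall x, U x -> exists2 r : R, 0 < r & exists M : R, forall n y, `|y - x| < r -> `|hn n y| <= M) ->
  (forall x, U x -> hn n x @[n --> \oo] --> h x) -> hol U h.
Proof.
move=> oU hU bd lim.
suff loc x0 : U x0 -> exists2 r : R, 0 < r & hol [set x | `|x - x0| < r] h.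
  split; first split => x /loc[r r0 [h1 _]].
    by apply: (C1P h1); rewrite /= subrr normr0.
  by move=> x /loc[r r0 [_ h2]]; apply: h2; rewrite /= subrr normr0.
move=> Ux0; have [r1 r10 rU1] := open_square oU Ux0.
have [r2 r20 [M hM]] := bd x0 Ux0.
pose r := Num.min r1 r2 / 4.
have r0 : 0 < r by rewrite divr_gt0 // lt_min r10.
have r2r : 2 * r < Num.min r1 r2.
  have := r0; rewrite /r; move: (Num.min r1 r2) => m; lra.
clearbody r.
have rU : sq x0 (2 * r) `<=` U.
  by move=> y /le_lt_trans /(_ r2r); rewrite lt_min => /andP[/rU1].
have bM n y : sq x0 (2 * r) y -> `|hn n y| <= M.
  by move=> /le_lt_trans /(_ r2r); rewrite lt_min => /andP[_ /hM]; exact.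
have x0in : sq x0 (2 * r) x0 by rewrite /sq /= subrr normr0 mulr_ge0 // ltW.
have M0 : 0 <= M := le_trans (normr_ge0 _) (bM 0%N x0 x0in).
have C0 : 0 <= 8 / r * M by rewrite mulr_ge0 // divr_ge0 // ltW.
have eb n w : `|edge x0 r (hn n) w| <= 8 / r * M * \1_(sq x0 (2 * r)) w.
  apply: (bounded_le_indic (F := edge x0 r (hn n))) => y; last exact: (edge_out _ r0).
  have [e0|e0] := eqVneq (edge x0 r (hn n) y) 0; first by rewrite e0 normr0.
  apply: (le_trans (edge_le _ _ _ r0)); apply: ler_wpM2l; first by rewrite divr_ge0 // ltW.
  by apply: bM; have /andP[_ h2] := edge_supp r0 e0.
have ec w : edge x0 r (hn n) w @[n --> \oo] --> edge x0 r h w.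
  have [Uw|nU] := pselect (U w).
    by apply: cvg_cmul; [exact: cvg_cst | exact: lim].
  have ow := sq_out rU nU.
  rewrite (edge_out h r0 ow).
  by under eq_fun do rewrite (edge_out _ r0 ow); exact: cvg_cst.
have me n : cmeas (edge x0 r (hn n)).
  by apply: cmeas_contT => x; exact: (edge_cont r0 oU rU (hU n).1).
have [ie _] := cint_dct me ec eb (integrable_square x0 (2 * r) (8 / r * M)).
have U0in z : [set x | `|x - x0| < r / 2] z ->
    creal (kappa R)^-1 *c cint (fun w => edge x0 r h w *c cinv (z - w)) = h z.
  rewrite /= => zr; have zr' : `|z - x0| <= r.
    by apply: ltW; apply: (lt_trans zr); rewrite ltr_pdivrMr // ltr_pMr // ltr1n.
  have Uz : U z by apply: rU; rewrite /sq /= (le_trans zr') // ler_peMl ?ler1n // ltW.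
  rewrite crealM.
  have bn n w : `|edge x0 r (hn n) w *c cinv (z - w)| <=
      2 * (8 / r * M * (2 / r)) * \1_(sq x0 (2 * r)) w.
    apply: (bounded_le_indic (F := fun w => edge x0 r (hn n) w *c cinv (z - w))) => y;
      last by move=> hy; rewrite (edge_out _ r0 hy) cmul0l.
    have [->|e0] := eqVneq (edge x0 r (hn n) y) 0.
      rewrite cmul0l normr0; apply: mulr_ge0 => //; apply: mulr_ge0 => //.
      by apply: divr_ge0 => //; exact: ltW.
    rewrite (le_trans (norm_cmul _ _)) // ler_wpM2l // ler_pM //.
      apply: (le_trans (eb n y)); rewrite indicE ler_piMr //; by case: (_ \in _).
    apply: (le_trans (norm_cinv _)).
    have /andP[y1 _] := edge_supp r0 e0.
    have zy : r / 2 <= `|z - y|.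
      have := ler_normB (z - x0) (z - y); rewrite (_ : z - x0 - (z - y) = y - x0); last by apply: pair_ext => /=; ring.
      by move=> h3; lra.
    rewrite -invf_div lef_pV2 ?posrE ?divr_gt0 //.
    by apply: lt_le_trans zy; rewrite divr_gt0.
  have mn n : cmeas (fun w => edge x0 r (hn n) w *c cinv (z - w)).
    apply: cmeasM => //; apply: (cmeas_comp (cmeas_cinv R)); exact: cmeas_reflect.
  have cn w : edge x0 r (hn n) w *c cinv (z - w) @[n --> \oo] --> edge x0 r h w *c cinv (z - w).
    by apply: cvg_cmul; [exact: ec | exact: cvg_cst].
  have [_ c1] := cint_dct mn cn bn (integrable_square x0 (2 * r) _).
  have c2 : (kappa R)^-1 *: cint (fun w => edge x0 r (hn n) w *c cinv (z - w)) @[n --> \oo] -->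
      (kappa R)^-1 *: cint (fun w => edge x0 r h w *c cinv (z - w)) by rewrite -crealM; under eq_fun do rewrite -crealM; apply: (cvg_cmul _ c1); exact: cvg_cst.
  apply: (cvg_plane_unique c2).
  under eq_fun do rewrite -(hol_representation r0 oU rU (hU _) zr').
  exact: lim.
exists (r / 2); first by rewrite divr_gt0.
apply: (hol_eq (open_sqo (a:=x0) (r:=r/2)) U0in).
apply: (holM (open_sqo (a:=x0) (r:=r/2))); first exact: hol_cst.
exact: (hol_potential r0 (@cinv_hol R) ie (@edge_supp R x0 r h r0)).
Qed.

End Estimates.

(** * Taylor expansion *)

Section Taylor.
Variable R : realType.
Local Notation P := (R * R)%type.
Local Notation mu := (@leb2 R).
Implicit Types (z w u x y t : P) (U V : set P) (F G h v : P -> P).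

(** The Taylor remainder of order [N] of [h] at [x0] divided by [t^N]: its value at [t = 0] is the
    [N]-th coefficient, and for [N = 0] it is [h (x0 + t)]. *)
Definition taylor x0 (r : R) h N t : P := (kappa R)^-1 *:
  cint (fun w => edge x0 r h w *c (cexp (cinv (w - x0)) N *c cinv (x0 + t - w))).

Lemma cmeas_cexp F n : cmeas F -> cmeas (fun w => cexp (F w) n).
Proof. by move=> mF; elim: n => [|n IH] /=; [exact: cmeas_cst | exact: cmeasM]. Qed.

Section Fixed.
Variables (U : set P) (h : P -> P) (x0 : P) (r : R).
Hypotheses (r0 : 0 < r) (oU : open U) (rU : sq x0 (2 * r) `<=` U) (hh : hol U h).

Let r20 : 0 < r / 2. Proof. by rewrite divr_gt0. Qed.

Let far w t : edge x0 r h w != 0 -> `|t| <= r / 2 ->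
  [/\ w - x0 != 0, r <= `|w - x0|, r / 2 <= `|x0 + t - w| & x0 + t - w != 0].
Proof.
move=> e0 tr; have /andP[w1 _] := edge_supp r0 e0.
have w2 : r / 2 <= `|x0 + t - w|.
  have := ler_normB t (x0 + t - w); rewrite (_ : t - (x0 + t - w) = w - x0); last by apply: pair_ext => /=; ring.
  by move=> h3; lra.
by split => //; rewrite -normr_gt0; apply: lt_le_trans _ _; [exact: r0| |exact: r20|].
Qed.

Lemma taylor_meas N t : cmeas (fun w => edge x0 r h w *c (cexp (cinv (w - x0)) N *c cinv (x0 + t - w))).
Proof.
apply: cmeasM; first by apply: cmeas_contT => x; exact: (edge_cont r0 oU rU hh.1).
apply: cmeasM; last by apply: (cmeas_comp (cmeas_cinv R)); exact: cmeas_reflect.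
apply: cmeas_cexp; apply: (@cmeas_eq _ (fun w => - (cinv (x0 - w)))).
  by move=> w; rewrite -cinvN opprB.
by apply: cmeasN; apply: (cmeas_comp (cmeas_cinv R)); exact: cmeas_reflect.
Qed.

Lemma taylor_kernel_le N t w : `|t| <= r / 2 ->
  `|edge x0 r h w *c (cexp (cinv (w - x0)) N *c cinv (x0 + t - w))| <=
  64 / r ^+ 2 * r ^- N * (`|h w| * \1_(sq x0 (2 * r)) w).
Proof.
move=> tr; have [->|e0] := eqVneq (edge x0 r h w) 0.
  by rewrite cmul0l normr0 !mulr_ge0 // ?invr_ge0 ?exprn_ge0 // ltW.
have [w0 w1 w2 w3] := far e0 tr.
have /andP[_ win] := edge_supp r0 e0.
rewrite indicE mem_set // mulr1 (le_trans (norm_cmul _ _)) //.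
have -> : 64 / r ^+ 2 * r ^- N * `|h w| = 2 * (8 / r * `|h w| * (2 * (r ^- N * (2 / r)))).
  by field; rewrite ?expf_neq0 gt_eqF.
rewrite ler_wpM2l // ler_pM //; first exact: edge_le.
rewrite (le_trans (norm_cmul _ _)) // ler_wpM2l // ler_pM //.
  apply: (le_trans (norm_le_eucl _)); rewrite eucl_cexp eucl_cinv -exprVn lerXn2r ?nnegrE ?invr_ge0 ?eucl_ge0 ?(ltW r0) //.
  by rewrite lef_pV2 ?posrE ?eucl_gt0 // (le_trans w1) // norm_le_eucl.
apply: (le_trans (norm_cinv _)).
by rewrite -invf_div lef_pV2 ?posrE ?normr_gt0.
Qed.

Lemma integrable_hol_sq : mu.-integrable setT (EFin \o (fun w => `|h w| * \1_(sq x0 (2 * r)) w)).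
Proof.
have [C C0 hC] := compact_bound (@sq_compact R x0 (2 * r)) (fun x hx => C1_cont hh.1 (rU hx)).
have mh : cmeas (cext (sq x0 (2 * r)) h).
  apply: (@cmeas_eq _ (cext (sq x0 (2 * r)) (cext U h))) => [w|].
    by rewrite /cext; case: asboolP => // /rU hU; case: asboolP.
  apply: cmeas_cext; first exact: measurable_square.
  by apply: cmeas_cont => // x; exact: (C1_cont hh.1).
have := cintegrable_bounded (a := x0) (r := 2 * r) (c := C) mh _ _; case.
- move=> y; rewrite /cext; case: asboolP => [/hC //|_]; rewrite normr0; exact: ltW.
- by move=> y hy; rewrite cext_out // /sq /= => /le_lt_trans /(_ hy); rewrite ltxx.
move=> _; apply: eq_integrable => // w _; rewrite /= indicE /cext.
by case: asboolP => hw; [rewrite mem_set ?mulr1 | rewrite memNset ?mulr0 ?normr0].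
Qed.

Lemma taylor_int N t : `|t| <= r / 2 ->
  cintegrable (fun w => edge x0 r h w *c (cexp (cinv (w - x0)) N *c cinv (x0 + t - w))).
Proof.
move=> tr; apply: (cintegrable_le (taylor_meas N t) (fun w => taylor_kernel_le N w tr)).
have := integrableZl measurableT (64 / r ^+ 2 * r ^- N) integrable_hol_sq.
by apply: eq_integrable.
Qed.

Lemma taylor0 t : `|t| <= r -> taylor x0 r h 0 t = h (x0 + t).
Proof.
move=> tr; rewrite (@hol_representation _ U x0 r h (x0 + t)) //; last by rewrite addrC addKr.
by congr (_ *: _); apply: cint_eq => w; rewrite /= cmul1l.
Qed.

Lemma taylorS N t : `|t| <= r / 2 ->
  taylor x0 r h N t = taylor x0 r h N 0 + t *c taylor x0 r h N.+1 t.
Proof.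
move=> tr; have t0 : `|(0 : P)| <= r / 2 by rewrite normr0 ltW.
rewrite /taylor scale_cmulr -scalerDr; congr (_ *: _).
have i1 := taylor_int N.+1 tr.
rewrite -(cintM _ i1).
rewrite -(cintD (taylor_int N t0)); last exact: cintegrableM.
apply: cint_eq => w; have [->|e0] := eqVneq (edge x0 r h w) 0; first by rewrite !cmul0l cmul0r addr0.
have [w0 w1 w2 w3] := far e0 tr; have [_ _ _ w4] := far e0 t0.
(* One step of the geometric expansion of the Cauchy kernel in powers of [t / (w - x0)]. *)
have key : cinv (x0 + t - w) = cinv (x0 + 0 - w) + t *c (cinv (w - x0) *c cinv (x0 + t - w)).
  apply/eqP; rewrite [X in _ == X]addrC -subr_eq; apply/eqP; rewrite cinv_sub // addr0.
  have -> : x0 - w - (x0 + t - w) = - t by apply: pair_ext => /=; ring.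
  by rewrite -[x0 - w]opprB cinvN cmulNr cmulNl cmulNr opprK [cinv (w - x0) *c _]cmulC.
rewrite {1}key /=; move: (cexp _ N) (edge _ _ _ _) => b e; move: (cinv (x0 + t - w)) (cinv (w - x0)) (cinv (x0 + 0 - w)) => a c d.
by apply: pair_ext; rewrite /cmul /=; ring.
Qed.

(** The bound is by the L1 norm of [h] on the square, the quantity that condition (a)(iii) controls
    when [h] is a kernel seen as a function of its pole. *)
Lemma taylor_le (A : R) N t : `|t| <= r / 2 ->
  (\int[mu]_(w in sq x0 (2 * r)) (`|h w|)%:E <= A%:E)%E ->
  eucl (taylor x0 r h N t) <= (kappa R)^-1 * (128 / r ^+ 2) * A * r ^- N.
Proof.
move=> tr hA; have k0 := kappa_gt0 R.
have i1 := taylor_int N tr.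
rewrite eucl_scale gtr0_norm ?invr_gt0 // -!mulrA ler_wpM2l ?invr_ge0 ?(ltW k0) //.
apply: (le_trans (eucl_le_norm _)).
have iG := integrableZl measurableT (64 / r ^+ 2 * r ^- N) integrable_hol_sq.
apply: (@le_trans _ _ (2 * (64 / r ^+ 2 * r ^- N * A))); last by rewrite le_eqVlt; apply/orP; left; apply/eqP; ring.
rewrite ler_wpM2l //.
have iG' : mu.-integrable setT (EFin \o (fun w => 64 / r ^+ 2 * r ^- N * (`|h w| * \1_(sq x0 (2 * r)) w))).
  by apply: eq_integrable iG.
apply: (le_trans (norm_cint_le (taylor_meas N t) (fun w => taylor_kernel_le N w tr) iG')).
rewrite RintegralZl //; last exact: integrable_hol_sq.
apply: ler_wpM2l; first by rewrite !mulr_ge0 // ?invr_ge0 ?exprn_ge0 // ltW.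
rewrite -lee_fin /Rintegral fineK; last exact: integrable_fin_num integrable_hol_sq.
apply: le_trans hA; rewrite le_eqVlt; apply/orP; left; apply/eqP.
rewrite [RHS]integral_mkcond; apply: eq_integral => w _.
by rewrite patchE indicE; case: (_ \in _); rewrite ?mulr1 ?mulr0.
Qed.

End Fixed.
End Taylor.

(** * Goursat's theorem *)

Section Goursat.
Variable R : realType.
Local Notation P := (R * R)%type.
Local Notation leb := (@lebesgue_measure R).
Implicit Types (z w u x y p : P) (U V : set P) (F G h v g : P -> P).

Lemma antiderivative (h : R -> R) (M : R) : (forall t, {for t, continuous h}) ->
  exists H : R -> R, forall t, `|t| < M -> is_derive t (1:R) H (h t).
Proof.
move=> hc; exists (fun x : R => \int[leb]_(t in [set` `[- M, x]]) h t) => t tM.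
have /andP[t1 t2] : - M < t < M by rewrite -ltr_norml.
have ih : leb.-integrable `[- M, M] (EFin \o h).
  apply: continuous_compact_integrable; first exact: segment_compact.
  by apply: continuous_subspaceT => x; exact: hc.
have [d1 d2] := continuous_FTC1_closed t2 ih t1 (hc t).
by split; [exact: d1 | rewrite -derive1E].
Qed.

Lemma partial_antiderivative b g (M : R) : (forall x, {for x, continuous g}) ->
  exists A : P -> P, forall w, `|co b w| < M -> hasp b A w (g w).
Proof.
move=> gc.
have H x : exists H : R -> P, forall t, `|t| < M -> is_derive t (1:R) H (g (line b x t)).
  have [H1 h1] := @antiderivative (fun t => (g (line b x t)).1) M (fun t =>
    @cvg_line R b x t (fun w => (g w).1) (cvg_fstP (gc (line b x t)))).
  have [H2 h2] := @antiderivative (fun t => (g (line b x t)).2) M (fun t =>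
    @cvg_line R b x t (fun w => (g w).2) (cvg_sndP (gc (line b x t)))).
  by exists (fun t => (H1 t, H2 t)) => t /[dup] /h1 ? /h2 ?; apply/is_derive_pairP; split.
(* All points of one line share this representative, so that the choice made next picks a single
   antiderivative per line. *)
pose key x : P := if b then (x.1, 0) else (0, x.2).
have [Hf hH] := choice H.
have ek x t : line b (key x) t = line b x t by rewrite /key /line; case: (b).
have el x t : key (line b x t) = key x by rewrite /key /line; case: (b).
have ec x t : co b (line b x t) = t by case: (b).
exists (fun w => Hf (key w) (co b w)) => w hw; move: (hH (key w) _ hw).
rewrite ek line_co /hasp; congr (is_derive _ _ _ _).
by apply/funext => t /=; rewrite el ec.
Qed.

Lemma nested (a b : nat -> R) : {homo a : m n / (m <= n)%N >-> m <= n} ->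
  {homo b : m n / (m <= n)%N >-> n <= m} -> (forall n, a n <= b n) ->
  exists z : R, forall n, a n <= z <= b n.
Proof.
move=> ha hb ab.
have amb m n : a m <= b n.
  by apply: (le_trans (ha _ _ (leq_maxl m n))); apply: (le_trans (ab _)); exact: hb (leq_maxr m n).
exists (sup (range a)) => n; apply/andP; split.
  by apply: ub_le_sup; [exists (b 0%N) => _ [m _ <-] | exists n].
by apply: ge_sup; [exists (a 0%N), 0%N | move=> _ [m _ <-]].
Qed.

Section Rectangles.
Variables (g A B : P -> P) (M : R).
Hypothesis hA : forall w, `|w.1| < M -> hasp false A w (g w).
Hypothesis hB : forall w, `|w.2| < M -> hasp true B w (g w).

(* The integral of [g] along the boundary of the rectangle, in terms of the
   antiderivatives [A] and [B] of [g] in each variable. *)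
Definition rect (a b c d : R) : P := (A (b, c) - A (a, c)) - (A (b, d) - A (a, d))
  + cI R *c ((B (b, d) - B (b, c)) - (B (a, d) - B (a, c))).

Lemma rect_split a b c d m n :
  rect a b c d = (rect a m c n + rect m b c n) + (rect a m n d + rect m b n d).
Proof. by apply: pair_ext; rewrite /rect /cmul /=; ring. Qed.

Lemma rect_swap1 a b c d : rect b a c d = - rect a b c d.
Proof. by apply: pair_ext; rewrite /rect /cmul /=; ring. Qed.

Lemma rect_swap2 a b c d : rect a b d c = - rect a b c d.
Proof. by apply: pair_ext; rewrite /rect /cmul /=; ring. Qed.

(** Opposite sides are paired. By the mean value theorem each pair agrees, up to [2 * e * s], with
    its value for the affine map of slope [l], and these two values cancel. *)
Lemma rect_local a b c d z (l : P) (e s : R) : - M < a -> b < M -> - M < c -> d < M ->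
  a <= z.1 <= b -> c <= z.2 <= d -> b - a <= s -> d - c <= s ->
  (forall w, `|w - z| <= s -> `|g w - g z - l *c (w - z)| <= e) ->
  `|rect a b c d| <= 4 * e * s.
Proof.
move=> aM bM cM dM /andP[z1 z2] /andP[z3 z4] bas dcs H.
have s0 : 0 <= s by apply: le_trans bas; lra.
have e0 : 0 <= e by apply: le_trans (H z _); rewrite // subrr normr0.
have inz (p q : R) : a <= p <= b -> c <= q <= d -> `|(p, q) - z| <= s.
  by move=> /andP[p1 p2] /andP[q1 q2]; apply: normP_le => /=; rewrite ler_norml; apply/andP; split; lra.
have bd1 (p : R) : a <= p <= b -> `|p| < M by move=> /andP[p1 p2]; rewrite ltr_norml; apply/andP; split; lra.
have bd2 (p : R) : c <= p <= d -> `|p| < M by move=> /andP[p1 p2]; rewrite ltr_norml; apply/andP; split; lra.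
have cd : c <= d by lra. have ab : a <= b by lra.
have diff p q : `|p - z| <= s -> `|q - z| <= s -> `|g p - g q - l *c (p - q)| <= 2 * e.
  move=> /H h1 /H h2.
  have -> : g p - g q - l *c (p - q) = (g p - g z - l *c (p - z)) - (g q - g z - l *c (q - z)).
    by rewrite !cmulBr; apply: pair_ext => /=; ring.
  by rewrite (le_trans (ler_normB _ _)) // mulr_natl mulr2n lerD.
have seg (u p q : R) : p <= q -> (p <= u <= q) || (q <= u <= p) -> p <= u <= q.
  by move=> pq /orP[//|/andP[h1 h2]]; apply/andP; split; lra.
have m1 : `|A (b, c) - A (b, d) - (A (a, c) - A (a, d)) - (b - a) *: (l *c (0, c - d))| <= 2 * e * `|b - a|.
  apply: (@mvt_line R false (fun w => A (w.1, c) - A (w.1, d)) 0 a b) => u /(seg u a b ab) uab.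
  have h : hasp false (fun w => A (w.1, c) - A (w.1, d)) (u, 0) (g (u, c) - g (u, d)).
    apply: haspB; [have := @hA (u, c) (bd1 _ uab) | have := @hA (u, d) (bd1 _ uab)]; exact.
  have -> : (0, c - d) = (u, c) - (u, d) :> P by apply: pair_ext => /=; ring.
  split; rewrite ?(hasp_pd h) //; apply: diff; apply: inz; rewrite ?lexx ?cd //.
have m2 : `|B (b, d) - B (a, d) - (B (b, c) - B (a, c)) - (d - c) *: (l *c (b - a, 0))| <= 2 * e * `|d - c|.
  apply: (@mvt_line R true (fun w => B (b, w.2) - B (a, w.2)) 0 c d) => u /(seg u c d cd) uab.
  have h : hasp true (fun w => B (b, w.2) - B (a, w.2)) (0, u) (g (b, u) - g (a, u)).
    apply: haspB; [have := @hB (b, u) (bd2 _ uab) | have := @hB (a, u) (bd2 _ uab)]; exact.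
  have -> : (b - a, 0) = (b, u) - (a, u) :> P by apply: pair_ext => /=; ring.
  split; rewrite ?(hasp_pd h) //; apply: diff; apply: inz; rewrite ?lexx ?ab //.
have nI (q : P) : `|cI R *c q| <= `|q|.
  by apply: normP_le; rewrite /= mul0r mul1r ?sub0r ?add0r ?normrN ?mul0r ?add0r ?norm1_le ?norm2_le.
set p := (_ - _) in m1; set q := (_ - _) in m2.
have -> : rect a b c d = p + cI R *c q.
  by rewrite /rect /p /q -!crealM; apply: pair_ext; rewrite /cmul /=; ring.
rewrite (le_trans (ler_normD _ _)) //.
have -> : 4 * e * s = 2 * e * s + 2 * e * s by ring.
have e20 : 0 <= 2 * e by rewrite mulr_ge0.
apply: lerD; last apply: (le_trans (nI _)).
  by apply: (le_trans m1); apply: ler_wpM2l => //; rewrite ger0_norm // subr_ge0.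
by apply: (le_trans m2); apply: ler_wpM2l => //; rewrite ger0_norm // subr_ge0.
Qed.

Hypothesis hg : forall z, exists l : P, forall e : R, 0 < e -> exists2 d : R, 0 < d &
  forall w, `|w - z| < d -> `|g w - g z - l *c (w - z)| <= e * `|w - z|.

Lemma rect_halve a b c d : exists m : bool * bool, let h := (b - a) / 2 in let k := (d - c) / 2 in
  let a' := a + m.1%:R * h in let c' := c + m.2%:R * k in
  `|rect a b c d| <= 4 * `|rect a' (a' + h) c' (c' + k)|.
Proof.
set h := (b - a) / 2; set k := (d - c) / 2.
have e := rect_split a b c d (a + h) (c + k).
pose F (m : bool * bool) := let a' := a + m.1%:R * h in let c' := c + m.2%:R * k in
  rect a' (a' + h) c' (c' + k).
apply: contrapT => /forallNP H.
have {}H m : `|F m| < `|rect a b c d| / 4.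
  by rewrite ltr_pdivlMr // mulrC ltNge; apply/negP; exact: (H m).
have {}e : rect a b c d = (F (false, false) + F (true, false)) + (F (false, true) + F (true, true)).
  rewrite e /F /= !mul0r !addr0 !mul1r.
  have -> : a + h + h = b by rewrite /h; field.
  by have -> : c + k + k = d by rewrite /k; field.
have := H (false, false); have := H (true, false); have := H (false, true); have := H (true, true).
have := ler_normD (F (false, false) + F (true, false)) (F (false, true) + F (true, true)).
have := ler_normD (F (false, false)) (F (true, false)).
have := ler_normD (F (false, true)) (F (true, true)).
rewrite -e; lra.
Qed.

(** Goursat's subdivision: at the [n]-th stage [rect_local] bounds [rect] by a multiple of
    [e * (s / 2 ^+ n) ^+ 2], which absorbs the factor [4 ^+ n] lost by halving. *)
Lemma rect0_le a b c d : - M < a -> a <= b -> b < M -> - M < c -> c <= d -> d < M ->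
  rect a b c d = 0.
Proof.
move=> aM ab bM cM cd dM.
pose S1 n : R := (b - a) / 2 ^+ n; pose S2 n : R := (d - c) / 2 ^+ n.
have S1S n : S1 n.+1 = S1 n / 2 by rewrite /S1 exprS invfM mulrA mulrAC.
have S2S n : S2 n.+1 = S2 n / 2 by rewrite /S2 exprS invfM mulrA mulrAC.
have S10 n : 0 <= S1 n by rewrite divr_ge0 ?exprn_ge0 // subr_ge0.
have S20 n : 0 <= S2 n by rewrite divr_ge0 ?exprn_ge0 // subr_ge0.
have step (np : nat * P) : exists m : bool * bool,
    let a' := np.2.1 + m.1%:R * S1 np.1.+1 in let c' := np.2.2 + m.2%:R * S2 np.1.+1 in
    `|rect np.2.1 (np.2.1 + S1 np.1) np.2.2 (np.2.2 + S2 np.1)| <=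
      4 * `|rect a' (a' + S1 np.1.+1) c' (c' + S2 np.1.+1)|.
  have [m] := rect_halve np.2.1 (np.2.1 + S1 np.1) np.2.2 (np.2.2 + S2 np.1).
  rewrite /= ![_ + _ - np.2.1]addrAC ![_ + _ - np.2.2]addrAC !subrr !add0r -S1S -S2S.
  by exists m.
have [m hm] := choice step.
(* [p n] is the lower left corner of the [n]-th rectangle, whose sides are [S1 n] and [S2 n]. *)
pose p := nat_rect (fun _ => P) (a, c) (fun n q =>
  (q.1 + (m (n, q)).1%:R * S1 n.+1, q.2 + (m (n, q)).2%:R * S2 n.+1)).
have pS n : p n.+1 = ((p n).1 + (m (n, p n)).1%:R * S1 n.+1, (p n).2 + (m (n, p n)).2%:R * S2 n.+1) by [].
have p1 n : (p n).1 <= (p n.+1).1 /\ (p n.+1).1 + S1 n.+1 <= (p n).1 + S1 n.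
  rewrite pS /= S1S; have := S10 n; case: (m _).1 => h0; rewrite ?mul1r ?mul0r; split; lra.
have p2 n : (p n).2 <= (p n.+1).2 /\ (p n.+1).2 + S2 n.+1 <= (p n).2 + S2 n.
  rewrite pS /= S2S; have := S20 n; case: (m _).2 => h0; rewrite ?mul1r ?mul0r; split; lra.
have i1 : {homo (fun n => (p n).1) : i j / (i <= j)%N >-> i <= j} by apply/nondecreasing_seqP => n; have [] := p1 n.
have i2 : {homo (fun n => (p n).2) : i j / (i <= j)%N >-> i <= j} by apply/nondecreasing_seqP => n; have [] := p2 n.
have j1 : {homo (fun n => (p n).1 + S1 n) : i j / (i <= j)%N >-> j <= i} by apply/nonincreasing_seqP => n; have [] := p1 n.
have j2 : {homo (fun n => (p n).2 + S2 n) : i j / (i <= j)%N >-> j <= i} by apply/nonincreasing_seqP => n; have [] := p2 n.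
have [z1 hz1] := nested i1 j1 (fun n => ler_wpDr (S10 n) (lexx _)).
have [z2 hz2] := nested i2 j2 (fun n => ler_wpDr (S20 n) (lexx _)).
have [l hl] := hg (z1, z2).
pose s := Num.max (b - a) (d - c).
have s0 : 0 <= s by rewrite le_max subr_ge0 ab.
have iter n : `|rect a b c d| <= 4 ^+ n * `|rect (p n).1 ((p n).1 + S1 n) (p n).2 ((p n).2 + S2 n)|.
  elim: n => [|n IH]; first by rewrite mul1r /S1 /S2 /= !divr1 !subrKC.
  by rewrite (le_trans IH) // exprSr -mulrA ler_wpM2l ?exprn_ge0 //; exact: (hm (n, p n)).
have small e : 0 < e -> `|rect a b c d| <= e * (4 * s * s).
  move=> e0; have [dl dl0 hdl] := hl e e0.
  have [n hn] : exists n, s / 2 ^+ n < dl.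
    exists (Num.truncn (s / dl)).+1; rewrite ltr_pdivrMr ?exprn_gt0 // mulrC -ltr_pdivrMr //.
    apply: (lt_trans (truncnS_gt _)).
    by rewrite -natrX ltr_nat ltn_expl.
  apply: (le_trans (iter n)).
  have -> : e * (4 * s * s) = 4 ^+ n * (4 * (e * (s / 2 ^+ n)) * (s / 2 ^+ n)).
    have -> : (4 : R) = 2 ^+ 2 by rewrite -natrX.
    by rewrite -exprM mulnC exprM; field; rewrite expf_neq0.
  rewrite ler_wpM2l ?exprn_ge0 //.
  have sn0 : 0 <= s / 2 ^+ n by rewrite divr_ge0 // exprn_ge0.
  have a1 : a <= (p n).1 := i1 0%N n (leq0n n).
  have a2 : c <= (p n).2 := i2 0%N n (leq0n n).
  have b1 : (p n).1 + S1 n <= b by have := j1 0%N n (leq0n n); rewrite /S1 /= divr1 subrKC.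
  have b2 : (p n).2 + S2 n <= d by have := j2 0%N n (leq0n n); rewrite /S2 /= divr1 subrKC.
  apply: (@rect_local _ _ _ _ (z1, z2) l); rewrite ?hz1 ?hz2 //.
  - exact: lt_le_trans aM a1.
  - exact: le_lt_trans b1 bM.
  - exact: lt_le_trans cM a2.
  - exact: le_lt_trans b2 dM.
  - by rewrite addrAC subrr add0r ler_wpM2r ?invr_ge0 ?exprn_ge0 // le_max lexx.
  - by rewrite addrAC subrr add0r ler_wpM2r ?invr_ge0 ?exprn_ge0 // le_max lexx orbT.
  move=> w hw; apply: le_trans (hdl w _) _; first exact: le_lt_trans hw hn.
  by apply: ler_wpM2l hw; exact: ltW.
apply/eqP; rewrite -normr_eq0; apply/eqP/le_anti; rewrite normr_ge0 andbT.
have K0 : 0 <= 4 * s * s by rewrite !mulr_ge0.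
apply/ler_addgt0Pl => e e0; rewrite addr0.
apply: (le_trans (small (e / (4 * s * s + 1)) _)); first by rewrite divr_gt0 // ltr_wpDl.
by rewrite mulrAC ler_pdivrMr ?ltr_wpDl // ler_wpM2l ?ltW // ltrDl.
Qed.

Lemma rect0 a b c d : `|a| < M -> `|b| < M -> `|c| < M -> `|d| < M -> rect a b c d = 0.
Proof.
rewrite !ltr_norml => /andP[a1 a2] /andP[b1 b2] /andP[c1 c2] /andP[d1 d2].
have [ab|/ltW ab] := leP a b; have [cd|/ltW cd] := leP c d.
- exact: rect0_le.
- by rewrite rect_swap2 rect0_le ?oppr0.
- by rewrite rect_swap1 rect0_le ?oppr0.
- by rewrite rect_swap1 rect_swap2 rect0_le ?oppr0.
Qed.

End Rectangles.

(** Existence of partial derivatives does not imply the continuity that [C1] includes; bounded ones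
    give a Lipschitz estimate along two coordinate segments. *)
Lemma cont_bounded_pd F x0 (d L : R) : 0 < d ->
  (forall b w, `|w - x0| < d -> exists2 l, hasp b F w l & `|l| <= L) -> {for x0, continuous F}.
Proof.
move=> d0 H.
have L0 : 0 <= L by have [|l _ h] := H false x0; [rewrite subrr normr0 | exact: le_trans h].
have dist w : `|w - x0| < d -> `|F w - F x0| <= 2 * L * `|w - x0|.
  move=> wd.
  have inx (p q : P) : `|p.1 - x0.1| <= `|w - x0| -> `|p.2 - x0.2| <= `|w - x0| -> `|p - x0| < d.
    by move=> h1 h2; apply: le_lt_trans wd; exact: normP_le.
  have seg (u p q : R) : (p <= u <= q) || (q <= u <= p) -> `|u - p| <= `|q - p|.
    move=> /orP[|] /andP[h1 h2]; first by rewrite !ger0_norm ?subr_ge0 // ?(le_trans h1) // lerD2r.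
    by rewrite ler0_norm ?subr_le0 // ler0_norm ?subr_le0 ?(le_trans h1) // lerN2 lerD2r.
  have n1 : `|w.1 - x0.1| <= `|w - x0| := norm1_le (w - x0).
  have n2 : `|w.2 - x0.2| <= `|w - x0| := norm2_le (w - x0).
  have m1 : `|F (w.1, w.2) - F (x0.1, w.2) - (w.1 - x0.1) *: 0| <= L * `|w.1 - x0.1|.
    apply: (@mvt_line R false F w x0.1 w.1) => u /seg hu.
    have [|l hl ll] := H false (line false w u); last by rewrite (hasp_pd hl) subr0.
    by apply: inx => //=; apply: le_trans hu n1.
  have m2 : `|F (x0.1, w.2) - F (x0.1, x0.2) - (w.2 - x0.2) *: 0| <= L * `|w.2 - x0.2|.
    apply: (@mvt_line R true F x0 x0.2 w.2) => u /seg hu.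
    have [|l hl ll] := H true (line true x0 u); last by rewrite (hasp_pd hl) subr0.
    by apply: inx => //=; rewrite ?subrr ?normr0 //; apply: le_trans hu n2.
  rewrite !scaler0 !subr0 in m1 m2.
  have -> : F w - F x0 = (F (w.1, w.2) - F (x0.1, w.2)) + (F (x0.1, w.2) - F (x0.1, x0.2)).
    by rewrite addrA subrK -!surjective_pairing.
  rewrite (le_trans (ler_normD _ _)) // -mulrA mulr_natl mulr2n lerD //.
    by apply: (le_trans m1); rewrite ler_wpM2l.
  by apply: (le_trans m2); rewrite ler_wpM2l.
apply/cvgrPdist_lt => e e0; apply/square_nbhs.
exists (Num.min d (e / (2 * L + 1))); first by rewrite lt_min d0 divr_gt0 // ltr_wpDl // mulr_ge0.
move=> w; rewrite lt_min => /andP[/dist h1].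
rewrite ltr_pdivlMr ?ltr_wpDl ?mulr_ge0 // mulrDr mulr1 => h2.
by rewrite distrC (le_lt_trans h1) // (le_lt_trans _ h2) // mulrC lerDl.
Qed.

Lemma entire_diff g : entire g -> forall z, exists l : P, forall e : R, 0 < e -> exists2 d : R, 0 < d &
  forall w, `|w - z| < d -> `|g w - g z - l *c (w - z)| <= e * `|w - z|.
Proof.
move=> eg z; have [l hl] := eg z; exists l => e e0.
have e20 : 0 < e / 2 by rewrite divr_gt0.
have /square_nbhs[d d0 hd] : nbhs (0 : P) [set h : P | h != 0 ->
    `|l - (g (z + h) - g z) *c cinv h| < e / 2].
  by have /cvgrPdist_lt /(_ _ e20) := hl.
exists d => // w wd; have [->|nz] := eqVneq w z; first by rewrite !subrr cmul0r subrr normr0 mulr0.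
rewrite -subr_eq0 in nz; have := hd (w - z); rewrite subr0 => /(_ wd nz).
rewrite [z + _]addrC subrK distrC => h.
have -> : g w - g z - l *c (w - z) = ((g w - g z) *c cinv (w - z) - l) *c (w - z).
  by rewrite cmulBl -cmulA [cinv _ *c _]cmulC cmulV // cmul1r.
rewrite (le_trans (norm_cmul _ _)) // mulrA ler_wpM2r //.
by rewrite mulrC -ler_pdivlMr // ltW.
Qed.

Lemma diff_cont g z (l : P) : (forall e : R, 0 < e -> exists2 d : R, 0 < d &
  forall w, `|w - z| < d -> `|g w - g z - l *c (w - z)| <= e * `|w - z|) -> {for z, continuous g}.
Proof.
move=> H; have [d d0 hd] := H 1 ltr01.
have K0 : 0 < 2 * `|l| + 1 by rewrite ltr_wpDl // mulr_ge0.
apply/cvgrPdist_lt => e e0; apply/square_nbhs.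
exists (Num.min d (e / (2 * `|l| + 1))); first by rewrite lt_min d0 divr_gt0.
move=> w; rewrite lt_min ltr_pdivlMr // => /andP[/hd h1 h2]; rewrite distrC.
have -> : g w - g z = (g w - g z - l *c (w - z)) + l *c (w - z) by rewrite subrK.
rewrite (le_lt_trans (ler_normD _ _)) //; apply: le_lt_trans h2.
rewrite mulrDr mulr1 addrC lerD //; last by rewrite (le_trans h1) // mul1r.
by rewrite (le_trans (norm_cmul _ _)) // [leRHS]mulrC mulrA.
Qed.

(** Complex differentiability says nothing on the continuity of the derivative. On each square [g]
    has a primitive [G], which is C1 because its partial derivatives [g] and [cI *c g] are
    continuous; regularity makes [G] smooth, and [g = pD false G] inherits this. *)
Lemma entire_hol g : entire g -> hol setT g.
Proof.
move=> /entire_diff hg.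
have gc x : {for x, continuous g} by have [l] := hg x; exact: diff_cont.
suff loc (M : R) : 0 < M -> hol [set x | `|x - 0| < M] g.
  have Mx x : 0 < `|x| + 1 by rewrite ltr_wpDl.
  have inx x : [set y : P | `|y - 0| < `|x| + 1] x by rewrite /= subr0 ltrDl.
  by split; [split | ] => x _; have [h1 h2] := loc _ (Mx x); [apply: (C1P h1) | apply: h2]; exact: inx.
move=> M0; set V := [set x | _]; have oV : open V := @open_sqo R 0 M.
have [A hA] := partial_antiderivative false M gc.
have [B hB] := partial_antiderivative true M gc.
(* The integral of [g] from 0 to [w], vertically and then horizontally. The vanishing of [rect]
   equates it with the other path, so each partial derivative can be read off along one of the
   two. *)
pose G w := A w - A (0, w.2) + cI R *c (B (0, w.2) - B (0, 0)).
have Vin w : V w -> `|w.1| < M /\ `|w.2| < M.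
  by rewrite /V /= subr0 => h; split; [exact: le_lt_trans (norm1_le w) h | exact: le_lt_trans (norm2_le w) h].
have n0 : `|0 : R| < M by rewrite normr0.
have G1 w : V w -> hasp false G w (g w).
  move=> /Vin[w1 _]; apply: (hasp_eq (l := g w - 0 + 0)); last by rewrite subr0 addr0.
  apply: haspD; first apply: haspB; first exact: hA.
    exact: (is_derive_cst (A (0, w.2)) _ _).
  exact: (is_derive_cst (cI R *c (B (0, w.2) - B (0, 0))) _ _).
have GE w : V w -> G w = A (w.1, 0) - A (0, 0) + cI R *c (B w - B (w.1, 0)).
  move=> /Vin[w1 w2]; have := rect0 hA hB hg n0 w1 n0 w2.
  rewrite /rect -surjective_pairing cmulBr => h.
  apply/eqP; rewrite -subr_eq0; apply/eqP; rewrite /G -[RHS]oppr0 -h.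
  by apply: pair_ext; rewrite /cmul /=; ring.
have G2 w : V w -> hasp true G w (cI R *c g w).
  move=> Vw; apply: (@hasp_near R true (fun w => A (w.1, 0) - A (0, 0) + cI R *c (B w - B (w.1, 0)))).
    by apply: (open_near oV _ Vw) => y /GE.
  have [w1 w2] := Vin w Vw.
  apply: (hasp_eq (l := 0 + (0 *c (B w - B (w.1, 0)) + cI R *c (g w - 0)))).
    apply: haspD; first exact: (is_derive_cst (A (w.1, 0) - A (0, 0)) _ _).
    apply: haspM; first exact: hasp_cst.
    apply: haspB; first exact: hB.
    exact: (is_derive_cst (B (w.1, 0)) _ _).
  by rewrite cmul0l !add0r subr0.
have nI (q : P) : `|cI R *c q| <= `|q|.
  by apply: normP_le; rewrite /= mul0r mul1r ?sub0r ?add0r ?normrN ?mul0r ?add0r ?norm1_le ?norm2_le.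
have GC x : V x -> {for x, continuous G}.
  move=> Vx; have [r r0 hr] := open_square oV Vx.
  have [d d0 hd] : exists2 d : R, 0 < d & forall y, `|y - x| < d -> `|g y| <= `|g x| + 1.
    have /cvgrPdist_lt /(_ 1 ltr01) /square_nbhs[d d0 hd] := gc x.
    exists d => // y /hd /= h; have := ler_normB (g x) (g x - g y).
    by rewrite subKr => h2; apply: (le_trans h2); rewrite lerD2l ltW.
  apply: (@cont_bounded_pd G x (Num.min r d) (`|g x| + 1)); first by rewrite lt_min r0.
  move=> b w; rewrite lt_min => /andP[/hr Vw /hd gw]; case: b.
    by exists (cI R *c g w); [exact: G2 | exact: le_trans (nI _) gw].
  by exists (g w); [exact: G1 | ].
have cD b x : V x -> {for x, continuous (if b then (fun w => cI R *c g w) else g)}.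
  by move=> _; case: b; [apply: (cvg_cmul _ (gc x)); exact: cvg_cst | exact: gc].
have hG : hol V G.
  split.
    apply: (@C1I R V G (fun b => if b then (fun w => cI R *c g w) else g)) => //.
    by case=> x Vx; [exact: G2 | exact: G1].
  by move=> x Vx; rewrite (dbarE (G1 x Vx) (G2 x Vx)) cI2 subrr cmul0r.
have sG := hol_smooth oV hG.
have [_ dG] := regularity oV hG.1 hG.2 (@smooth_cst R V 0).
have e x : V x -> pD false G x = g x by move=> Vx; exact: hasp_pd (G1 x Vx).
apply: (hol_eq oV e); split; first by apply: smooth_C1; exact: smooth_pd.
move=> x Vx; have := dG [:: false] x Vx; rewrite !pds_cons /= => ->.
by rewrite (hasp_pd (hasp_cst _ _ _)).
Qed.

End Goursat.

(** * Local solutions *)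

Section Solve.
Variable R : realType.
Local Notation P := (R * R)%type.
Local Notation mu := (@leb2 R).
Implicit Types (z w u x y p : P) (U V D : set P) (F G h v g f : P -> P).

Lemma eucl_cont z : {for z, continuous (@eucl R)}.
Proof.
apply/cvgrPdist_lt => e e0; apply/square_nbhs; exists (e / 2); first by rewrite divr_gt0.
move=> w; rewrite ltr_pdivlMr // mulrC => h; apply: le_lt_trans h.
apply: (@le_trans _ _ (eucl (w - z))); last exact: eucl_le_norm.
rewrite ler_norml lerBrDr lerBlDr; apply/andP; split.
  have := eucl_tri z (w - z); rewrite addrC subrK; move: (eucl w) (eucl z) (eucl _) => a b c; lra.
have := eucl_tri w (z - w); rewrite addrC subrK -(euclN (z - w)) opprB; lra.
Qed.

Lemma measurable_eucl F : cmeas F -> measurable_fun [set: P] (fun y => eucl (F y)).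
Proof.
move=> /cmeas_pair mF; apply: (@measurableT_comp _ _ _ _ _ _ (@eucl R) _ F) => //.
by apply: cont_measurable_on; [exact: openT | move=> x _; exact: eucl_cont].
Qed.

Lemma cmeas_ker g : (forall x, {for x, continuous g}) -> cmeas (ker g).
Proof. by move=> gc; apply: cmeasM; [apply: cmeas_contT | exact: cmeas_cinv]. Qed.

(** The passage from the integral conditions to potentials. The number [b] stands for the weight at
    [x]; dividing by it yields a bound of the form constant over weight. *)
Lemma kernel_integral_le D g (nu : P -> R) F x (a b C : R) : (forall x, {for x, continuous g}) ->
  measurable (D : set (measurableTypeR R * measurableTypeR R)) ->
  measurable_fun D (fun y => (nu y)^-1) -> (forall y, D y -> 0 < nu y) ->
  cmeas F -> (forall y, ~ D y -> F y = 0) -> (forall y, D y -> eucl (F y) <= C / nu y) ->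
  0 < b -> 0 <= C ->
  (\int[mu]_(y in D) ((eucl (g (x - y)) * b / (eucl (x - y) * nu y))%:E) <= a%:E)%E ->
  (\int[mu]_y ((eucl (F y *c ker g (x - y)))%:E) <= (C * a / b)%:E)%E.
Proof.
move=> gc mD mnu nu0 mF F0 Fle b0 C0 hI.
have mk : cmeas (fun y => ker g (x - y)) by apply: (cmeas_comp (cmeas_ker gc)); exact: cmeas_reflect.
have mH : measurable_fun setT (fun y => eucl (ker g (x - y))) by exact: measurable_eucl.
have -> : (\int[mu]_y ((eucl (F y *c ker g (x - y)))%:E) =
    \int[mu]_(y in D) ((eucl (F y *c ker g (x - y)))%:E))%E.
  rewrite [RHS]integral_mkcond; apply: eq_integral => y _; rewrite patchE.
  by case: ifPn => // /negP yD; rewrite F0 ?cmul0l ?eucl0 // => h; apply: yD; rewrite inE.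
apply: (@le_trans _ _ (\int[mu]_(y in D) ((C / b)%:E * (eucl (g (x - y)) * b / (eucl (x - y) * nu y))%:E))%E).
  apply: ge0_le_integral => //.
  - by move=> y _; rewrite lee_fin eucl_ge0.
  - apply/measurable_EFinP; apply: measurable_funTS; apply: measurable_eucl; exact: cmeasM.
  - apply/measurable_EFinP; apply: measurable_funM => //.
    apply: (@eq_measurable_fun _ _ _ _ D (fun y => b * (eucl (ker g (x - y)) * (nu y)^-1))).
      by move=> y _; rewrite /ker eucl_cmul eucl_cinv invfM; ring.
    by apply: measurable_funM => //; apply: measurable_funM => //; exact: measurable_funTS.
  - move=> y Dy; rewrite -EFinM lee_fin eucl_cmul /ker eucl_cmul eucl_cinv.
    have -> : C / b * (eucl (g (x - y)) * b / (eucl (x - y) * nu y)) =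
        C / nu y * (eucl (g (x - y)) / eucl (x - y)) by rewrite invfM -[RHS]mulr1 -(divff (lt0r_neq0 b0)); ring.
    by apply: ler_wpM2r; [rewrite divr_ge0 ?eucl_ge0 | exact: Fle].
rewrite ge0_integralZl_EFin //.
- have Cb : (0 <= (C / b)%:E)%E by rewrite lee_fin divr_ge0 // ltW.
  by apply: (le_trans (lee_wpmul2l Cb hI)); rewrite -EFinM lee_fin mulrAC.
- by move=> y Dy; rewrite lee_fin !mulr_ge0 ?invr_ge0 ?mulr_ge0 ?eucl_ge0 // ltW //; exact: nu0.
- apply/measurable_EFinP.
  apply: (@eq_measurable_fun _ _ _ _ D (fun y => b * (eucl (ker g (x - y)) * (nu y)^-1))).
    by move=> y _; rewrite /ker eucl_cmul eucl_cinv invfM; ring.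
  by apply: measurable_funM => //; apply: measurable_funM => //; exact: measurable_funTS.
- by rewrite divr_ge0 // ltW.
Qed.

Lemma eucl_cintegrable F (a : R) : cmeas F -> (\int[mu]_y ((eucl (F y))%:E) <= a%:E)%E ->
  cintegrable F /\ `|cint F| <= a.
Proof.
move=> mF h.
have h1 : (\int[mu]_y (`|F y|)%:E <= a%:E)%E.
  apply: le_trans h; apply: ge0_le_integral => //.
  - by apply/measurable_EFinP; exact: cmeas_norm.
  - by apply/measurable_EFinP; exact: measurable_eucl.
  - by move=> y _; rewrite lee_fin norm_le_eucl.
split; last exact: norm_cint_ub.
by apply: cintegrableP => //; apply: le_lt_trans h1 _; rewrite ltry.
Qed.

Lemma conv_swap_ker g F (a : P) (M : R) z : (forall x, {for x, continuous g}) ->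
  (forall x, {for x, continuous F}) -> (forall x, M < `|x - a| -> F x = 0) ->
  cintegrable (fun w => F w *c ker g (z - w)) /\
  cint (fun w => F w *c ker g (z - w)) = cint (fun w => ker g w *c F (z - w)).
Proof.
move=> gc Fc Fout.
have [||i e] := @conv_swap R (fun w => F w *c g (z - w)) a M z.
- by move=> x; apply: (cvg_cmul (Fc x)); exact: (cont_reflect (gc _)).
- by move=> x /Fout ->; rewrite cmul0l.
have E : (fun w => F w *c g (z - w) *c cinv (z - w)) = (fun w => F w *c ker g (z - w)).
  by apply/funext => w; rewrite /ker cmulA.
rewrite E in i e; split; first exact: i.
by rewrite e; apply: cint_eq => w; rewrite subKr [F _ *c _]cmulC cmulA [cinv w *c _]cmulC.
Qed.

Section Local.
Variables (D : set P) (g f : P -> P) (B : P -> R) (U : set P).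
Hypotheses (oD : open D) (oU : open U) (UD : U `<=` D) (hg : hol setT g) (g0 : g 0 = cone R).
Hypothesis fs : C1 D f.
Let F := cext D f.
Hypothesis hB : forall x, U x -> (\int[mu]_y ((eucl (F y *c ker g (x - y)))%:E) <= (B x)%:E)%E.
Hypothesis Bloc : forall x, U x -> exists M : R, \forall y \near x, B y <= M.

Let gc x : {for x, continuous g}. Proof. exact: (C1_cont hg.1). Qed.
Let mF : cmeas F. Proof. by apply: cmeas_cont => // x Dx; exact: (C1_cont fs). Qed.
Let mk x : cmeas (fun y => ker g (x - y)).
Proof. by apply: (cmeas_comp (cmeas_ker gc)); exact: cmeas_reflect. Qed.

Lemma ker_hol : hol [set~ (0 : P)] (ker g).
Proof. by apply: holM; [exact: open_neq0 | exact: hol_sub hg | exact: cinv_hol]. Qed.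

(** [F] itself need not be integrable, only its products with the kernel are. Truncation in position
    and in size gives integrable densities with holomorphic potentials, bounded by [B] uniformly in
    the truncation, and [hol_limit] applies. *)
Lemma solve_far x0 (r : R) : 0 < r -> sq x0 (2 * r) `<=` U ->
  hol [set x | `|x - x0| < r / 2] (fun x => cint (fun w => (F w - ccut x0 r w *c F w) *c ker g (x - w))).
Proof.
move=> r0 rU; set V := [set x | _]; have oV : open V := @open_sqo R x0 (r / 2).
have VU x : V x -> U x.
  by move=> h; apply: rU; rewrite /sq /= ltW // (lt_trans h) //; lra.
pose b w := F w - ccut x0 r w *c F w.
have mb : cmeas b.
  apply: cmeasB => //; apply: cmeasM => //; apply: cmeas_contT => x.
  by have [h _] := cut_C1 x0 r0; exact: (C1_cont h).
have ble w : eucl (b w) <= eucl (F w).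
  have -> : b w = (1 - cut x0 r w) *: F w by rewrite /b ccutE scalerBl scale1r.
  rewrite eucl_scale ler_piMl ?eucl_ge0 //.
  by have /andP[h1 h2] := cut_bound x0 r w; rewrite ger0_norm ?subr_ge0 // lerBlDr lerDl.
have bsupp w : b w != 0 -> r <= `|w - x0|.
  apply: contra_neqT; rewrite -ltNge => /ltW h; rewrite /b ccutE cut1 // scale1r subrr //.
pose T (m : nat) : set P := sq 0 m%:R `&` [set y | `|b y| <= m%:R].
have mT m : measurable (T m : set (measurableTypeR R * measurableTypeR R)).
  apply: measurableI; first exact: measurable_square.
  have := cmeas_norm mb measurableT (measurable_itv `]-oo, (m%:R : R)]).
  by rewrite setTI; congr (measurable _); apply/seteqP; split => y /=; rewrite in_itv.
pose bm m := cext (T m) b.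
have mbm m : cmeas (bm m) by apply: cmeas_cext.
have bme m w : bm m w = b w \/ bm m w = 0 by rewrite /bm /cext; case: asboolP => _; [left | right].
have bmle m w : eucl (bm m w) <= eucl (F w) by case: (bme m w) => ->; rewrite // eucl0 eucl_ge0.
have ibm m : cintegrable (bm m).
  apply: (@cintegrable_bounded _ _ 0 m%:R m%:R) => // y; rewrite /bm /cext; case: asboolP.
  - by move=> [].
  - by rewrite normr0.
  - by move=> [h _] h2; have := lt_le_trans h2 h; rewrite ltxx.
  - by [].
have bound G x : V x -> cmeas G -> (forall w, eucl (G w) <= eucl (F w)) ->
    (\int[mu]_y ((eucl (G y *c ker g (x - y)))%:E) <= (B x)%:E)%E.
  move=> Vx mG hG; apply: le_trans (hB (VU _ Vx)); apply: ge0_le_integral => //.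
  - by move=> y _; rewrite lee_fin eucl_ge0.
  - by apply/measurable_EFinP; apply: measurable_eucl; exact: cmeasM.
  - by apply/measurable_EFinP; apply: measurable_eucl; exact: cmeasM.
  - move=> y _; rewrite lee_fin [eucl (G y *c _)]eucl_cmul [eucl (F y *c _)]eucl_cmul.
    by apply: ler_wpM2r; [exact: eucl_ge0 | exact: hG].
apply: (@hol_limit R V (fun m x => cint (fun w => bm m w *c ker g (x - w)))) => //.
- move=> m; apply: (hol_potential (M := m%:R + `|x0|) r0 ker_hol (ibm m)) => w.
  rewrite /bm /cext; case: asboolP => [[h1 h2] nz|]; last by rewrite eqxx.
  rewrite bsupp //= (le_trans (ler_normB _ _)) // lerD2r.
  by move: h1; rewrite /sq /= subr0.
- move=> x Vx; have [M /square_nbhs[d d0 hd]] := Bloc (VU _ Vx).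
  have [d' d'0 hd'] := open_square oV Vx.
  exists (Num.min d d'); first by rewrite lt_min d0.
  exists M => m y; rewrite lt_min => /andP[/hd yM /hd' Vy].
  have [_ h] := eucl_cintegrable (cmeasM (mbm m) (mk y)) (bound _ _ Vy (mbm m) (bmle m)).
  exact: le_trans h yM.
- move=> x Vx.
  have [iF _] := eucl_cintegrable (cmeasM mb (mk x)) (bound _ _ Vx mb ble).
  have cv w : bm m w *c ker g (x - w) @[m --> \oo] --> b w *c ker g (x - w).
    apply: cvg_cmul; last exact: cvg_cst.
    apply: cvg_near_cst.
    exists (Num.truncn (Num.max `|w| `|b w|)).+1 => // m /= hm.
    have hm' : Num.max `|w| `|b w| <= m%:R.
      by apply: ltW; apply: (lt_le_trans (truncnS_gt _)); rewrite ler_nat.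
    by rewrite /bm cext_in //; move: hm'; rewrite ge_max => /andP[h1 h2]; split => //=; rewrite /sq /= subr0.
  have le m w : `|bm m w *c ker g (x - w)| <= `|b w *c ker g (x - w)|.
    by case: (bme m w) => ->; rewrite // cmul0l normr0.
  have [_ h] := cint_dct (fun m => cmeasM (mbm m) (mk x)) cv le iF.2.
  exact: h.
Qed.

Lemma solve_near x0 (r : R) : 0 < r -> sq x0 (2 * r) `<=` U ->
  C1 setT (fun x => cint (fun w => (ccut x0 r w *c F w) *c ker g (x - w))) /\
  forall x, cintegrable (fun w => (ccut x0 r w *c F w) *c ker g (x - w)) /\
   dB (fun x => cint (fun w => (ccut x0 r w *c F w) *c ker g (x - w))) x =
    kappa R *: (ccut x0 r x *c F x).
Proof.
move=> r0 rU; have rD : sq x0 (2 * r) `<=` D by move=> y /rU /UD.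
have [hc out _ _] := cut_mul r0 oD rD fs.
pose G w := ccut x0 r w *c F w.
have e : (fun w => ccut x0 r w *c f w) = G.
  apply/funext => w; rewrite /G; have [h|h] := leP `|w - x0| (2 * r).
    by rewrite /F cext_in //; exact: rD.
  by rewrite (ccut_out r0 h) !cmul0l.
have hG : C1 setT G by rewrite -e.
have Gout w : 2 * r < `|w - x0| -> G w = 0 by rewrite -e; exact: out.
have [h1 h2 h3] := conv_C1 (locint_ker gc) hG Gout.
have swap z := conv_swap_ker z gc (fun x => C1_cont hG (I : setT x)) Gout.
have E : (fun x => cint (fun w => G w *c ker g (x - w))) =
    (fun x => cint (fun w => ker g w *c G (x - w))).
  by apply/funext => x; have [_] := swap x.
rewrite -/G E; split; first exact: h1.
move=> x; split; first by have [] := swap x.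
rewrite h3.
have [_ e2] := cauchy_conv x hg hG Gout.
have [_ <-] := conv_swap_ker x gc (fun x => C1_dbar_cont hG (I : setT x)) (dbar_out Gout).
by rewrite e2 g0 cmul1r.
Qed.

(** Near each [x0] the source is split by a cutoff: the near part has a C1 compactly supported
    density and solves the equation by Cauchy-Pompeiu, the far part contributes a holomorphic
    function. *)
Lemma local_solution : C1 U (fun x => (kappa R)^-1 *: cint (fun w => F w *c ker g (x - w))) /\
  forall x, U x -> dB (fun x => (kappa R)^-1 *: cint (fun w => F w *c ker g (x - w))) x = f x.
Proof.
set u := fun x => _.
suff loc x0 : U x0 -> exists2 r : R, 0 < r & C1 [set x | `|x - x0| < r] u /\ dB u x0 = f x0.
  split; last by move=> x /loc[r _ []].
  by split => x /loc[r r0 [h1 _]]; apply: (C1P h1); rewrite /= subrr normr0.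
move=> Ux0; have [r r0 rU] := sqo_in 0 oU Ux0.
exists (r / 2); first by rewrite divr_gt0.
set V := [set x | _]; have oV : open V := @open_sqo R x0 (r / 2).
have Vx0 : V x0 by rewrite /V /= subrr normr0 divr_gt0.
have hfar := solve_far r0 rU; have [hn hn'] := solve_near r0 rU.
rewrite -/V in hfar.
set un := fun x => cint _ in hn; set uf := fun x => cint _ in hfar.
have ue x : V x -> creal (kappa R)^-1 *c (un x + uf x) = u x.
  move=> Vx; rewrite crealM /u; congr (_ *: _).
  have Ux : U x by apply: rU; move: Vx; rewrite /V /sq /=; lra.
  have [iF _] := eucl_cintegrable (cmeasM mF (mk x)) (hB Ux).
  have [iN _] := hn' x.
  rewrite /un /uf -cintD //.
    by apply: cint_eq => w; rewrite -cmulDl addrC subrK.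
  apply: cintegrable_eq (cintegrableB iF iN) => w.
  by rewrite cmulBl.
have hnV : C1 V un by apply: C1_sub hn.
have hs : C1 V (fun x => creal (kappa R)^-1 *c (un x + uf x)).
  by apply: (C1M oV); [exact: C1_cst | exact: (C1D oV hnV hfar.1)].
split; first exact: (C1_eq oV ue hs).
rewrite -(dbar_near (open_near oV ue Vx0)).
rewrite (dbarM (C1_cst V (creal (kappa R)^-1)) (C1D oV hnV hfar.1) Vx0).
rewrite dbar_cst cmul0l add0r (dbarD hnV hfar.1 Vx0) hfar.2 // addr0.
have [_ ->] := hn' x0; rewrite crealM kappaK.
by rewrite ccutE cut1 // ?subrr ?normr0 ?ltW // scale1r /F cext_in //; exact: UD.
Qed.

End Local.
End Solve.

(** * Weighted approximation *)

Lemma finite_cover (R : realType) (K : set (R * R)) (U : R * R -> set (R * R)) : compact K ->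
  (forall c, K c -> open (U c) /\ U c c) ->
  exists s : seq (R * R), (forall c, c \in s -> K c) /\
    forall x, K x -> exists2 c, c \in s & U c x.
Proof.
move=> cK hU.
(* Compactness in its near-covering form, applied to the filter of finite sequences ordered by
   inclusion, yields a finite subcover. *)
pose F : set_system (seq (R * R)) :=
  [set S | exists s0 : seq (R * R), forall s : seq (R * R), {subset s0 <= s} -> S s].
have FF : Filter F.
  constructor.
  - by exists [::].
  - move=> S T [s0 h0] [s1 h1]; exists (s0 ++ s1) => s hs.
    by split; [apply: h0 | apply: h1] => x xs; apply: hs; rewrite mem_cat xs ?orbT.
  - by move=> S T ST [s0 h0]; exists s0 => s /h0 /ST.
have /compact_near_coveringP cov := cK.
have [x Kx|s0 hs0] := cov _ F (fun s x => exists c, [/\ c \in s, K c & U c x]) FF.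
  have [oU Ux] := hU x Kx.
  exists (U x, [set s : seq (R * R) | x \in s]) => /=.
    split; first exact: open_nbhs_nbhs.
    by exists [:: x] => s; apply; rewrite inE.
  by move=> [y s] /= [Uy xs]; exists x.
exists [seq c <- s0 | `[< K c >]]; split=> [c|x Kx].
  by rewrite mem_filter => /andP[/asboolP].
have [c [cs Kc Uc]] := hs0 s0 (fun _ h => h) x Kx.
by exists c => //; rewrite mem_filter cs andbT; apply/asboolP.
Qed.

Section Approximation.
Variable R : realType.
Local Notation P := (R * R)%type.
Local Notation mu := (@leb2 R).
Implicit Types (z w u x y p t : P) (F G h v g f phi : P -> P).
Variables (H : (P -> P) -> Prop) (O : set P) (nu : P -> R).
Hypotheses (nu0 : forall x, O x -> 0 < nu x) (H0 : H (cst 0)).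
Hypothesis HD : forall F G, H F -> H G -> H (fun x => F x + G x).
Hypothesis HM : forall (c : P) F, H F -> H (fun x => c *c F x).

(** Membership in the closure of the linear space [H] for the weighted sup norm on [O]. *)
Definition apx phi := forall e : R, 0 < e -> exists2 F, H F &
  forall x, O x -> eucl (phi x - F x) * nu x <= e.

Lemma apx_id F : H F -> apx F.
Proof. by move=> hF e e0; exists F => // x _; rewrite subrr eucl0 mul0r ltW. Qed.

Lemma apx_lim phi : (forall e : R, 0 < e -> exists2 F, apx F &
  forall x, O x -> eucl (phi x - F x) * nu x <= e) -> apx phi.
Proof.
move=> h e e0; have e20 : 0 < e / 2 by rewrite divr_gt0.
have [F /(_ _ e20)[G hG FG] pF] := h _ e20; exists G => // x Ox.
have -> : phi x - G x = (phi x - F x) + (F x - G x) by rewrite addrA subrK.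
apply: (@le_trans _ _ ((eucl (phi x - F x) + eucl (F x - G x)) * nu x)).
  by apply: ler_wpM2r; [exact: ltW (nu0 Ox) | exact: eucl_tri].
by rewrite mulrDl [e]splitr lerD ?pF ?FG.
Qed.

Lemma apx_eq F G : (forall x, O x -> F x = G x) -> apx F -> apx G.
Proof. by move=> FG h e /h[K hK FK]; exists K => // x Ox; rewrite -FG // FK. Qed.

Lemma apxD F G : apx F -> apx G -> apx (fun x => F x + G x).
Proof.
move=> hF hG e e0; have e20 : 0 < e / 2 by rewrite divr_gt0.
have [F' h1 h2] := hF _ e20; have [G' h3 h4] := hG _ e20.
exists (fun x => F' x + G' x); first exact: HD.
move=> x Ox; rewrite opprD addrACA.
apply: (@le_trans _ _ ((eucl (F x - F' x) + eucl (G x - G' x)) * nu x)).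
  by apply: ler_wpM2r; [exact: ltW (nu0 Ox) | exact: eucl_tri].
by rewrite mulrDl [e]splitr lerD ?h2 ?h4.
Qed.

Lemma apxM (c : P) F : apx F -> apx (fun x => c *c F x).
Proof.
move=> hF e e0; have c0 : 0 < eucl c + 1 by rewrite ltr_wpDl ?eucl_ge0.
have [F' h1 h2] := hF _ (divr_gt0 e0 c0).
exists (fun x => c *c F' x); first exact: HM.
move=> x Ox; rewrite -cmulBr eucl_cmul -mulrA.
have h := h2 x Ox; rewrite ler_pdivlMr // in h.
have h0 : 0 <= eucl (F x - F' x) * nu x by rewrite mulr_ge0 ?eucl_ge0 // ltW // nu0.
by apply: le_trans h; rewrite mulrC ler_wpM2l // lerDl.
Qed.

Variables (Y : set P) (k : P -> P -> P).
Hypotheses (oY : open Y) (hk : forall x, O x -> hol Y (k ^~ x)).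
Hypothesis kI : forall y0 (r : R), 0 < r -> sq y0 (2 * r) `<=` Y -> exists2 A : R, 0 <= A &
  forall x, O x -> (\int[mu]_(w in sq y0 (2 * r)) (`|k w x|)%:E <= (A / nu x)%:E)%E.

(** The expansion is in the pole, and [x] is a parameter: an L1 bound [A / nu x] on the kernel
    becomes a bound on all remainders that is uniform in the weighted norm. *)
Lemma taylor_weighted y0 (r : R) : 0 < r -> sq y0 (2 * r) `<=` Y -> exists2 B : R, 0 <= B &
  forall N t x, O x -> `|t| <= r / 2 -> eucl (taylor y0 r (k ^~ x) N t) * nu x <= B * r ^- N.
Proof.
move=> r0 rY; have [A A0 hA] := kI r0 rY.
have k0 := kappa_gt0 R.
exists ((kappa R)^-1 * (128 / r ^+ 2) * A).
  by rewrite !mulr_ge0 ?invr_ge0 ?exprn_ge0 // ltW.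
move=> N t x Ox tr; have n0 := nu0 Ox.
rewrite -ler_pdivlMr //.
apply: (le_trans (taylor_le r0 oY rY (hk Ox) N tr (hA x Ox))).
by rewrite le_eqVlt; apply/orP; left; apply/eqP; ring.
Qed.

Lemma kernel_lipschitz y0 (r : R) : 0 < r -> sq y0 (2 * r) `<=` Y -> exists2 B : R, 0 <= B &
  forall w x, O x -> `|w - y0| <= r / 2 -> eucl (k w x - k y0 x) * nu x <= B * `|w - y0|.
Proof.
move=> r0 rY; have [B B0 hB] := taylor_weighted r0 rY.
exists (2 * (B * r ^- 1)); first by rewrite !mulr_ge0 // invr_ge0 exprn_ge0 // ltW.
move=> w x Ox wr; have n0 := nu0 Ox.
have wr' : `|w - y0| <= r by apply: (le_trans wr); rewrite ler_pdivrMr // ler_peMr ?ltW // ltr1n.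
have t0 := @taylor0 R Y (k ^~ x) y0 r r0 oY rY (hk Ox) _ wr'.
have z0 : `|(0 : P)| <= r by rewrite normr0 ltW.
have t1 := @taylor0 R Y (k ^~ x) y0 r r0 oY rY (hk Ox) _ z0.
rewrite addr0 in t1; rewrite [y0 + _]addrC subrK in t0.
rewrite -t0 -t1 (taylorS r0 oY rY (hk Ox) 0 wr) addrC addKr eucl_cmul -mulrA.
apply: (@le_trans _ _ (2 * `|w - y0| * (B * r ^- 1))); last by rewrite mulrAC.
apply: ler_pM; rewrite ?eucl_ge0 ?eucl_le_norm ?mulr_ge0 ?eucl_ge0 ?(ltW n0) //.
exact: hB.
Qed.

(* The Taylor coefficients at [y0] are approximable, being iterated limits of
   difference quotients of functions [k y] with [y] near [y0]. *)
Lemma apx_spread y0 (r : R) : 0 < r -> sq y0 (2 * r) `<=` Y -> (\near y0, apx (k y0)) ->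
  forall y, `|y - y0| <= r / 4 -> apx (k y).
Proof.
move=> r0 rY /square_nbhs[s1 s10 hs1].
have [B B0 hB] := taylor_weighted r0 rY.
pose s := Num.min s1 (r / 2).
have s0 : 0 < s by rewrite lt_min s10 divr_gt0.
pose rho N t x := taylor y0 r (k ^~ x) N t.
have rho0 t x : O x -> `|t| <= r -> rho 0 t x = k (y0 + t) x.
  by move=> Ox tr; exact: (taylor0 r0 oY rY (hk Ox) tr).
have rhoS N t x : O x -> `|t| <= r / 2 -> rho N t x = rho N 0 x + t *c rho N.+1 t x.
  by move=> Ox tr; exact: (taylorS r0 oY rY (hk Ox) N tr).
have r2r : r / 2 <= r by rewrite ler_pdivrMr // ler_peMr ?ltW // ltr1n.
have small N : forall t, `|t| < s -> apx (rho N t).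
  elim: N => [|N IH] t; rewrite lt_min => /andP[t1 t2].
    have tr : `|t| <= r by apply: le_trans (ltW t2) r2r.
    apply: (@apx_eq (k (y0 + t))) => [x Ox|]; first by rewrite rho0.
    by apply: hs1; rewrite addrC addKr.
  have nz u : `|u| < s -> u != 0 -> apx (rho N.+1 u).
    move=> us u0; have ur : `|u| <= r / 2 by move: us; rewrite lt_min => /andP[_ /ltW].
    apply: (@apx_eq (fun x => cinv u *c (rho N u x + (- cone R) *c rho N 0 x))).
      move=> x Ox; rewrite (rhoS _ _ _ Ox ur) cmulNl cmul1l addrAC subrr add0r.
      by rewrite cmulA [cinv u *c u]cmulC cmulV // cmul1l.
    by apply/apxM/apxD; [exact: IH | apply/apxM/IH; rewrite normr0].
  have [t0|t0] := eqVneq t 0; last by apply: nz => //; rewrite lt_min t1.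
  rewrite {}t0 {t t1 t2}; apply: apx_lim => e e0.
  pose K := B * r ^- N.+2.
  have K0 : 0 <= K by rewrite mulr_ge0 // invr_ge0 exprn_ge0 // ltW.
  have K1 : 0 < 2 * K + 1 by rewrite ltr_wpDl // mulr_ge0.
  (* The first entry keeps the increment where approximability is already known, the second makes
     [2 * tau * K], which bounds the next remainder, at most [e]. *)
  pose tau := Num.min (s / 2) (e / (2 * K + 1)).
  have tau0 : 0 < tau by rewrite lt_min !divr_gt0.
  have tn : `|(tau, 0) : P| = tau by rewrite normPE /= normr0 gtr0_norm //; apply/max_idPl; exact: ltW.
  have ts : `|(tau, 0) : P| < s.
    by rewrite tn; apply: (@le_lt_trans _ _ (s / 2)); [rewrite ge_min lexx | rewrite ltr_pdivrMr // ltr_pMr // ltr1n].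
  exists (rho N.+1 (tau, 0)).
    by apply: nz => //; rewrite -normr_gt0 tn.
  move=> x Ox; have tr : `|(tau, 0) : P| <= r / 2 by move: ts; rewrite lt_min => /andP[_ /ltW].
  rewrite (rhoS _ _ _ Ox tr) opprD addrA subrr sub0r euclN eucl_cmul -mulrA.
  apply: (@le_trans _ _ (2 * tau * K)).
    apply: ler_pM; rewrite ?eucl_ge0 ?mulr_ge0 ?eucl_ge0 ?(ltW (nu0 Ox)) //.
      by rewrite -{2}tn eucl_le_norm.
    exact: hB.
  have : tau <= e / (2 * K + 1) by rewrite ge_min lexx orbT.
  rewrite ler_pdivlMr // => h; apply: le_trans h; rewrite mulrDr mulr1 mulrAC [tau * _]mulrC lerDl; exact: ltW.
move=> y yr; pose t := y - y0.
have tr4 : `|t| <= r / 4 by [].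
have tr : `|t| <= r / 2 by apply: (le_trans tr4); rewrite ler_pM2l // lef_pV2 ?posrE // ler_nat.
pose S := nat_rect (fun _ => P -> P) (fun _ => 0) (fun N f x => f x + cexp t N *c rho N 0 x).
have SE N x : O x -> k y x = S N x + cexp t N *c rho N t x.
  move=> Ox; elim: N => [|N IH] /=.
    by rewrite add0r cmul1l rho0 ?(le_trans tr) // /t addrC subrK.
  by rewrite IH (rhoS N _ _ Ox tr) cmulDr addrA cmulA [t *c _]cmulC.
have aS N : apx (S N).
  elim: N => [|N IH]; first exact: apx_id.
  by apply: apxD => //; apply/apxM/small; rewrite normr0.
apply: apx_lim => e e0.
(* The radius [r / 4] in the max norm gives [eucl t <= r / 2], so the remainder after [N] terms is
   at most [(r / 2) ^+ N * (B * r ^- N) = B / 2 ^+ N]. *)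
have [N hN] : exists N, B / 2 ^+ N <= e.
  exists (Num.truncn (B / e)).+1; rewrite ler_pdivrMr ?exprn_gt0 // mulrC -ler_pdivrMr // ltW //.
  by apply: (lt_trans (truncnS_gt _)); rewrite -natrX ltr_nat ltn_expl.
exists (S N) => // x Ox; rewrite (SE N x Ox) addrC addKr eucl_cmul eucl_cexp -mulrA.
apply: le_trans hN.
have -> : B / 2 ^+ N = (r / 2) ^+ N * (B * r ^- N).
  by rewrite expr_div_n; field; rewrite !expf_neq0 ?gt_eqF.
apply: ler_pM; rewrite ?exprn_ge0 ?eucl_ge0 ?mulr_ge0 ?eucl_ge0 ?(ltW (nu0 Ox)) //; last exact: hB.
rewrite lerXn2r ?nnegrE ?eucl_ge0 ?divr_ge0 ?(ltW r0) //.
apply: (le_trans (eucl_le_norm _)); rewrite -ler_pdivlMl //; apply: (le_trans tr4).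
by rewrite le_eqVlt; apply/orP; left; apply/eqP; field.
Qed.

(** The points near which [k] is approximable form an open set. It is also relatively closed,
    because the radius in [apx_spread] depends on the room inside [Y] and not on the size of the
    neighbourhood where approximability is given. *)
Lemma apx_connected (N : set P) y0 : connected N -> N `<=` Y -> N y0 -> (\near y0, apx (k y0)) ->
  forall y, N y -> apx (k y).
Proof.
move=> cN NY Ny0 h0.
pose Z : set P := [set y | \near y, apx (k y)].
have oZ : open Z by exact: (@open_interior _ [set y | apx (k y)]).
suff E : N `&` Z = N.
  by move=> y Ny; have : (N `&` Z) y by [rewrite E]; case=> _ /nbhs_singleton.
apply: cN.
- by exists y0.
- by exists Z.
exists (~` (Y `\` Z)).
  apply: open_closedC; apply: openP_square => y [Yy nZ].
  have [r r0 rY] := sqo_in 0 oY Yy.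
  (* [apx_spread] about [y1] with radius [r / 2] reaches distance [r / 8], which covers the points
     within [r / 16] of [y] when [y1] is that close to [y]. *)
  exists (r / 16); first by rewrite divr_gt0.
  move=> y1 hy1; split; first by apply: rY; rewrite /sq /= ltW // (lt_trans hy1) //; lra.
  move=> Zy1; apply: nZ.
  have rY1 : sq y1 (2 * (r / 2)) `<=` Y.
    move=> w hw; apply: rY; rewrite /sq /= in hw *.
    by have := ler_distD y1 w y; lra.
  have := apx_spread (divr_gt0 r0 (ltr0n _ 2)) rY1 Zy1.
  move=> sp; apply/square_nbhs; exists (r / 16); first by rewrite divr_gt0.
  move=> w hw; apply: sp; have := ler_distD y w y1; rewrite (distrC y) => h; lra.
apply/seteqP; split => y [Ny h]; split => //; first by case.
by apply: contrapT => nZ; apply: h; split => //; exact: NY.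
Qed.

Section Integral.
Variables (L : set P) (a : P -> P).
Hypotheses (cL : compact L) (LY : L `<=` Y) (kL : forall y, L y -> apx (k y)).
Hypotheses (mk : forall x, cmeas (k ^~ x)) (ia : cintegrable a) (aL : forall w, ~ L w -> a w = 0).

Local Notation mset A := (measurable (A : set (measurableTypeR R * measurableTypeR R))).

Let ma A : mset A -> cmeas (cext A a). Proof. by move=> mA; exact: cmeas_cext mA ia.1. Qed.

Let a_le A w : `|cext A a w| <= `|a w|.
Proof. by rewrite /cext; case: asboolP => // _; rewrite normr0. Qed.

Let ia_ext A : mset A -> cintegrable (cext A a).
Proof. by move=> mA; exact: (cintegrable_le (ma mA) (a_le A) ia.2). Qed.

Let ik A x : mset A -> O x -> cintegrable (fun w => cext A a w *c k w x).
Proof.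
move=> mA Ox; have [C C0 hC] := compact_bound cL (fun y Ly => C1_cont (hk Ox).1 (LY Ly)).
have iC := integrableZl measurableT (2 * C) ia.2.
apply: (cintegrable_le (G := fun w => 2 * C * `|a w|)).
- by apply: cmeasM; [exact: ma | exact: mk].
- move=> w; have [Lw|nL] := pselect (L w).
    rewrite (le_trans (norm_cmul _ _)) // -mulrA ler_wpM2l // mulrC ler_pM //; exact: hC.
  have -> : cext A a w = 0 by rewrite /cext aL //; case: ifP.
  by rewrite cmul0l normr0; apply: mulr_ge0 => //; apply: mulr_ge0 => //; exact: ltW.
- by apply: eq_integrable iC.
Qed.

Let mass A : R := \int[mu]_w `|cext A a w|.

Let split_ext A E w : cext A a w = cext (A `&` E) a w + cext (A `\` E) a w.
Proof.
have [Aw|nA] := pselect (A w); last by rewrite !cext_out ?addr0 // => -[].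
have [Ew|nE] := pselect (E w).
  by rewrite (cext_in _ Aw) cext_in // cext_out ?addr0 // => -[].
by rewrite (cext_in _ Aw) cext_out ?cext_in ?add0r // => -[].
Qed.

Let mass_split A E : mset A -> mset E -> mass A = mass (A `&` E) + mass (A `\` E).
Proof.
move=> mA mE; rewrite /mass -RintegralD //.
- apply: eq_Rintegral => w _; rewrite (split_ext A E).
  have [Ew|nE] := pselect (E w).
    by rewrite [cext (A `\` E) a w]cext_out ?normr0 ?addr0 // => -[].
  by rewrite [cext (A `&` E) a w]cext_out ?normr0 ?add0r // => -[].
- by have [_] := ia_ext (measurableI _ _ mA mE).
- by have [_] := ia_ext (measurableD mA mE).
Qed.

(** Freezing the pole at [c] turns the integral into a constant multiple of [k c]. The factor 4
    combines those of [norm_cmul] and [eucl_le_norm]. *)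
Lemma apx_piece A c (e : R) : mset A -> apx (k c) -> 0 <= e ->
  (forall w x, A w -> O x -> eucl (k w x - k c x) * nu x <= e) ->
  exists2 psi, apx psi & forall x, O x ->
    eucl (cint (fun w => cext A a w *c k w x) - psi x) * nu x <= 4 * e * mass A.
Proof.
move=> mA hc e0 hA; exists (fun x => cint (cext A a) *c k c x); first exact: apxM.
move=> x Ox; have n0 := nu0 Ox.
have i1 := ik mA Ox; have i2 := cintegrableM (k c x) (ia_ext mA).
have -> : cint (cext A a) *c k c x = cint (fun w => k c x *c cext A a w).
  by rewrite (cintM _ (ia_ext mA)) cmulC.
rewrite -(cintB i1 i2) -ler_pdivlMr //.
apply: (le_trans (eucl_le_norm _)).
have -> : 4 * e * mass A / nu x = 2 * (2 * (e / nu x) * mass A) by ring.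
rewrite ler_wpM2l // /mass.
have im := integrableZl measurableT (2 * (e / nu x)) (ia_ext mA).2.
rewrite -RintegralZl; [|exact: measurableT|exact: (ia_ext mA).2].
apply: norm_cint_le.
- by have [] := cintegrableB i1 i2.
- move=> w; rewrite [k c x *c _]cmulC -cmulBr.
  have [Aw|nA] := pselect (A w); last by rewrite cext_out // cmul0l !normr0 mulr0.
  rewrite (le_trans (norm_cmul _ _)) // -mulrA ler_wpM2l // mulrC ler_wpM2r //.
  by rewrite (le_trans (norm_le_eucl _)) // ler_pdivlMr // hA.
- by apply: eq_integrable im.
Qed.

(** A Riemann sum argument. The cover is peeled off one square at a time, so the pieces are disjoint
    and their masses add up: the error does not depend on the number of pieces. *)
Lemma apx_pieces (e : R) (s : seq (P * R)) : 0 <= e ->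
  (forall p : P * R, p \in s -> apx (k p.1) /\
    forall w x, `|w - p.1| < p.2 -> O x -> eucl (k w x - k p.1 x) * nu x <= e) ->
  forall A, mset A -> (forall w, A w -> exists2 p : P * R, p \in s & `|w - p.1| < p.2) ->
  exists2 psi, apx psi & forall x, O x ->
    eucl (cint (fun w => cext A a w *c k w x) - psi x) * nu x <= 4 * e * mass A.
Proof.
move=> e0; elim: s => [|p s IH] hs A mA hA.
  exists (cst 0); first exact: apx_id.
  move=> x Ox; have i0 : cintegrable (cst (0 : P)).
    by apply: cintegrable_eq (cintegrableM 0 ia) => w; exact: cmul0l.
  have -> : (fun w => cext A a w *c k w x) = (fun w => 0 *c cst (0 : P) w).
    by apply/funext => w; rewrite cext_out ?cmul0l // => /hA[].
  by rewrite (cintM _ i0) cmul0l subrr eucl0 mul0r !mulr_ge0 // Rintegral_ge0.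
pose E : set P := [set w | `|w - p.1| < p.2].
have mE : mset E by apply: open_measurable2; exact: open_sqo.
have mAE := measurableI _ _ mA mE; have mAD := measurableD mA mE.
have [h1 h2] := hs p (mem_head _ _).
have [psi1 a1 b1] := apx_piece mAE h1 e0 (fun w x Aw => h2 w x Aw.2).
have hs' (q : P * R) : q \in s -> apx (k q.1) /\
    forall w x, `|w - q.1| < q.2 -> O x -> eucl (k w x - k q.1 x) * nu x <= e.
  by move=> qs; apply: hs; rewrite inE qs orbT.
have cov w : (A `\` E) w -> exists2 q : P * R, q \in s & `|w - q.1| < q.2.
  move=> [/hA[q]]; rewrite inE => /orP[/eqP -> h nE|qs h _]; last by exists q.
  by case: nE.
have [psi2 a2 b2] := IH hs' _ mAD cov.
exists (fun x => psi1 x + psi2 x); first exact: apxD.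
move=> x Ox; rewrite (mass_split mA mE) mulrDr.
have -> : cint (fun w => cext A a w *c k w x) =
    cint (fun w => cext (A `&` E) a w *c k w x) + cint (fun w => cext (A `\` E) a w *c k w x).
  rewrite -cintD; [|exact: ik|exact: ik].
  by apply: cint_eq => w; rewrite (split_ext A E) cmulDl.
rewrite opprD addrACA (le_trans _ (lerD (b1 x Ox) (b2 x Ox))) // -mulrDl.
by apply: ler_wpM2r; [exact: ltW (nu0 Ox) | exact: eucl_tri].
Qed.

Lemma apx_integral : apx (fun x => cint (fun w => a w *c k w x)).
Proof.
apply: apx_lim => e e0.
pose m := mass L; have m0 : 0 <= m by apply: Rintegral_ge0.
have m1 : 0 < 4 * m + 1 by rewrite ltr_wpDl // mulr_ge0.
pose d := e / (4 * m + 1); have d0 : 0 < d by rewrite divr_gt0.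
have loc c : exists r : R, 0 < r /\ (L c ->
    forall w x, `|w - c| < r -> O x -> eucl (k w x - k c x) * nu x <= d).
  have [Lc|nL] := pselect (L c); last by exists 1.
  have [r r0 rY] := sqo_in 0 oY (LY Lc).
  have [B B0 hB] := kernel_lipschitz r0 rY.
  have B1 : 0 < B + 1 by rewrite ltr_wpDl.
  exists (Num.min (r / 2) (d / (B + 1))); split; first by rewrite lt_min !divr_gt0.
  move=> _ w x; rewrite lt_min => /andP[/ltW w1 w2] Ox; rewrite ltr_pdivlMr // in w2.
  apply: (le_trans (hB w x Ox w1)); apply: le_trans (ltW w2).
  by rewrite mulrC ler_wpM2l // lerDl.
have [r hr] := choice loc.
have cen c : L c -> open [set w | `|w - c| < r c] /\ [set w | `|w - c| < r c] c.
  by move=> _; split; [exact: open_sqo | rewrite /= subrr normr0; have [] := hr c].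
have [D [DL cov]] := finite_cover cL cen.
have mL : mset L by apply: closed_measurable2; exact: (compact_closed _ cL).
have [psi a1 b1] : exists2 psi, apx psi & forall x, O x ->
    eucl (cint (fun w => cext L a w *c k w x) - psi x) * nu x <= 4 * d * mass L.
  apply: (apx_pieces (s := [seq (c, r c) | c <- D])) => //.
  - exact: ltW.
  - move=> p /mapP[c cD ->] /=; have Lc := DL _ cD.
    by split; [exact: kL | have [_] := hr c; exact].
  - move=> w /cov[c /= cD wc]; exists (c, r c) => //.
    by apply/mapP; exists c.
exists psi => // x Ox.
have -> : (fun w => a w *c k w x) = (fun w => cext L a w *c k w x).
  apply/funext => w; congr (_ *c _).
  by have [Lw|nL] := pselect (L w); [rewrite cext_in | rewrite cext_out // aL].
apply: (le_trans (b1 x Ox)); rewrite -/m /d.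
rewrite mulrAC mulrA ler_pdivrMr // mulrC ler_wpM2l ?ltW //.
by rewrite ltrDl.
Qed.

End Integral.
End Approximation.

(** * Density *)

Section Density.
Variable R : realType.
Local Notation P := (R * R)%type.
Local Notation mu := (@leb2 R).
Local Notation mset A := (measurable (A : set (measurableTypeR R * measurableTypeR R))).
Implicit Types (z w u x y p t : P) (F G h v g f phi : P -> P).

Lemma cutoff_squares (D : set P) (r : P -> R) (s : seq P) : open D ->
  (forall c, c \in s -> 0 < r c /\ sq c (2 * r c) `<=` D) ->
  exists chi : P -> R, [/\ C1 setT (fun z => creal (chi z)), forall z, 0 <= chi z <= 1,
    forall c z, c \in s -> `|z - c| < r c -> chi z = 1 & forall z, ~ D z -> \near z, chi z = 0].
Proof.
move=> oD; elim: s => [|c s IH] hs.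
  exists (cst 0); split; [exact: (C1_cst setT (creal 0)) | by move=> z; rewrite lexx ler01 | by [] |].
  by move=> z _; apply/square_nbhs; exists 1.
have [r0 rD] := hs c (mem_head _ _).
have [c' c's|chi [h1 h2 h3 h4]] := IH; first by apply: hs; rewrite inE c's orbT.
have [hc _] := cut_C1 c r0.
(* This is [1 - (1 - chi)(1 - cut)]: it equals 1 as soon as one of the two does, and stays between 0
   and 1. *)
exists (fun z => chi z + cut c (r c) z - chi z * cut c (r c) z); split.
- apply: (@C1_eq R setT (fun z => creal (chi z) + ccut c (r c) z - creal (chi z) *c ccut c (r c) z) _ openT).
    by move=> z _; apply: pair_ext; rewrite /= /cmul /creal /ccut /=; ring.
  by apply: (C1B openT); [exact: (C1D openT h1 hc) | exact: (C1M openT h1 hc)].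
- move=> z; have /andP[a1 a2] := h2 z; have /andP[b1 b2] := cut_bound c (r c) z.
  by apply/andP; split; nra.
- move=> c' z; rewrite inE => /orP[/eqP -> zc|c's zc].
    by rewrite (cut1 r0 (ltW zc)); ring.
  by rewrite (h3 _ _ c's zc); ring.
- move=> z nD; have zo : 2 * r c < `|z - c|.
    by rewrite ltNge; apply/negP => /rD.
  move: (h4 z nD) (near_out zo); apply: filterS2 => w -> wo.
  by rewrite (cut0 r0 (ltW wo)) mul0r addr0 subrr.
Qed.

Lemma compact_cutoff (K D : set P) : compact K -> open D -> K `<=` D ->
  exists (chi : P -> R) (G : set P), [/\ C1 setT (fun z => creal (chi z)), forall z, 0 <= chi z <= 1,
    forall z, ~ D z -> \near z, chi z = 0, open G /\ K `<=` G & forall z, G z -> D z /\ chi z = 1].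
Proof.
move=> cK oD KD.
have loc c : exists r : R, K c -> 0 < r /\ sq c (2 * r) `<=` D.
  have [Kc|nK] := pselect (K c); last by exists 1.
  by have [r r0 rD] := sqo_in 0 oD (KD _ Kc); exists r.
have [r hr] := choice loc.
have cen c : K c -> open [set w | `|w - c| < r c] /\ [set w | `|w - c| < r c] c.
  by move=> Kc; split; [exact: open_sqo | rewrite /= subrr normr0; have [] := hr c Kc].
have [s [sK cov]] := finite_cover cK cen.
have hs c : c \in s -> 0 < r c /\ sq c (2 * r c) `<=` D by move=> /sK /hr.
have [chi [h1 h2 h3 h4]] := cutoff_squares oD hs.
exists chi, [set w | exists2 c, c \in s & `|w - c| < r c]; split => //.
  split; last by move=> x /cov[c cs xc]; exists c.
  apply: openP_square => x [c cs xc].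
  have [d d0 hd] := open_square (@open_sqo R c (r c)) xc.
  by exists d => // y /hd; exists c.
move=> z [c cs zc]; split; last exact: h3 zc.
have [r0 rD] := hs c cs; apply: rD; rewrite /sq /= ltW // (lt_le_trans zc) //.
by rewrite ler_peMl ?ler1n // ltW.
Qed.

(** [O], [D], [E] stand for [Om n], [Om (I4 n)], [Om (I14 n)], with their weights [nu], [nu4],
    [nu14]; [H] is the space of holomorphic functions from which [h] is approximated. *)
Variables (O D E : set P) (nu nu4 nu14 : P -> R) (g : P -> P) (A C : R) (h : P -> P).
Variable H : (P -> P) -> Prop.
Hypotheses (oD : open D) (OD : closure O `<=` D) (DE : D `<=` E).
Hypothesis nu0 : forall x, O x -> 0 < nu x.
Hypothesis nu40 : forall x, D x -> 0 < nu4 x.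
Hypothesis nu4_cont : forall x, D x -> {for x, continuous nu4}.
Hypothesis nu_le : forall x, O x -> nu x <= nu4 x.
Hypothesis nu4_le : forall x, D x -> nu4 x <= nu14 x.
Hypotheses (hg : hol setT g) (g0 : g 0 = cone R).
Hypotheses (H0 : H (cst 0)) (HD : forall F G, H F -> H G -> H (fun x => F x + G x)).
Hypothesis HM : forall (c : P) F, H F -> H (fun x => c *c F x).
Local Notation k := (fun y x => ker g (x - y)).
Local Notation Y := (~` closure O).
Hypothesis kI : forall y0 (r : R), 0 < r -> sq y0 (2 * r) `<=` Y -> exists2 A : R, 0 <= A &
  forall x, O x -> (\int[mu]_(w in sq y0 (2 * r)) (`|ker g (x - w)|)%:E <= (A / nu x)%:E)%E.
Hypothesis kY : forall y, Y y -> apx H O nu (fun x => ker g (x - y)).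
Hypothesis decay : forall e : R, 0 < e -> exists2 K : set P, compact K &
  forall x, D x -> ~ K x -> nu4 x <= e * nu14 x.
Hypothesis intD : forall x, O x ->
  (\int[mu]_(y in D) ((eucl (g (x - y)) * nu x / (eucl (x - y) * nu4 y))%:E) <= A%:E)%E.
Hypotheses (hh : hol E h) (hC : forall x, E x -> eucl (h x) * nu14 x <= C) (C0 : 0 <= C).

Let gc x : {for x, continuous g}. Proof. exact: (C1_cont hg.1). Qed.
Let OinD x : O x -> D x. Proof. by move=> /subset_closure /OD. Qed.
Let oY : open Y. Proof. rewrite openC; exact: closed_closure. Qed.

Lemma ker_reflect_hol x : O x -> hol Y (fun y => ker g (x - y)).
Proof.
move=> Ox; have [h1 h2] := ker_hol hg.
have [h3 h4] := C1_reflect x (@open_neq0 R) h1.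
have sub y : Y y -> [set~ (0 : P)] (x - y).
  by move=> yY /eqP; rewrite subr_eq0 => /eqP xy; apply: yY; rewrite -xy; exact: subset_closure.
split; first by apply: C1_sub h3.
by move=> y /sub hy; rewrite h4 // h2 // oppr0.
Qed.

Lemma ker_cmeas x : cmeas (fun y => ker g (x - y)).
Proof. by apply: (cmeas_comp (cmeas_ker gc)); exact: cmeas_reflect. Qed.

Lemma mnu4 : measurable_fun D (fun y => (nu4 y)^-1).
Proof.
apply: cont_measurable_on => // x Dx; apply: cvgV; first by rewrite gt_eqF // nu40.
exact: nu4_cont.
Qed.

Section Truncation.
Variable m : nat.
Hypothesis m0 : (0 < m)%N.
Let mR : 0 < (m%:R : R). Proof. by rewrite ltr0n. Qed.
Local Notation psi := (ccut 0 m%:R).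

(** The factor [1 / m] comes from the gradient of [psi]. The size of [h] is absorbed by the weight
    [nu4] in [intD], since [nu4 <= nu14] on [D]. *)
Lemma truncated_approx : exists2 F, apx H O nu F &
  forall x, O x -> eucl (psi x *c h x - F x) * nu x <= (kappa R)^-1 * (16 * C * A) / m%:R.
Proof.
have k0 := kappa_gt0 R.
(* Only the part of the closure of [O] inside the support of [psi] matters. It is compact, which
   provides the cutoff [chi] even if [O] is unbounded. *)
have cK : compact (sq (0 : P) (2 * m%:R) `&` closure O).
  by apply: compact_closedI; [exact: sq_compact | exact: closed_closure].
have KD : sq (0 : P) (2 * m%:R) `&` closure O `<=` D by move=> x [_ /OD].
have [chi [G [hchi chi01 chi0 [oG KG] G1]]] := compact_cutoff cK oD KD.
pose q w := creal (chi w) *c h w.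
have hqD : C1 D q.
  by apply: (C1M oD); [exact: C1_sub hchi | apply: C1_sub hh.1].
have q0 x : ~ D x -> \near x, q x = 0.
  by move=> /chi0; apply: filterS => w cw; rewrite /q cw cmul0l.
have hq : C1 setT q by exact: (C1_near_zero oD hqD q0).
have [hpsi dpsi] := cut_C1 (0 : P) mR.
pose phi w := psi w *c q w.
have hphi : C1 setT phi by exact: (C1M openT hpsi hq).
have phi_out x : 2 * m%:R < `|x - 0| -> phi x = 0.
  by move=> hx; rewrite /phi (ccut_out mR hx) cmul0l.
pose a w := psi w *c dB q w; pose b w := dB psi w *c q w.
have dphi w : dB phi w = b w + a w by rewrite /phi (dbarM hpsi hq I).
have [i1 e1] : (forall x, cintegrable (fun w => dB phi w *c ker g (x - w))) /\
    (forall x, cint (fun w => dB phi w *c ker g (x - w)) = kappa R *: phi x).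
  split=> x; have [h1 h2] := cauchy_conv x hg hphi phi_out; first exact: h1.
  by rewrite h2 g0 cmul1r.
have ac x : {for x, continuous a}.
  by apply: (cvg_cmul (C1_cont hpsi (I : setT x))); exact: (C1_dbar_cont hq).
have aout x : 2 * m%:R < `|x - 0| -> a x = 0.
  by move=> hx; rewrite /a (ccut_out mR hx) cmul0l.
pose L := sq (0 : P) (2 * m%:R) `&` ~` G.
have aL w : ~ L w -> a w = 0.
  move=> nL; have [/aout //|wm] := ltP (2 * m%:R) `|w - 0|.
  have Gw : G w by apply: contrapT => nG; apply: nL.
  rewrite /a (_ : dB q w = 0) ?cmul0r //.
  rewrite (dbar_near (g := h)); first by apply: hh.2; apply: DE; have [] := G1 w Gw.
  by apply: (open_near oG _ Gw) => y /G1[_ c1]; rewrite /q c1 crealM scale1r.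
have cL : compact L by apply: compact_closedI; [exact: sq_compact | exact: open_closedC].
have LY : L `<=` Y by move=> w [w1 nG] cw; apply: nG; exact: KG.
have ia : cintegrable a by exact: (cintegrable_cont ac aout).
have apA := @apx_integral R H O nu nu0 H0 HD HM Y k oY ker_reflect_hol kI L a cL LY
  (fun y Ly => kY (LY y Ly)) ker_cmeas ia aL.
have iA x : cintegrable (fun w => a w *c ker g (x - w)).
  by have [] := @conv_swap_ker R g a 0 (2 * m%:R) x gc ac aout.
have iB x : cintegrable (fun w => b w *c ker g (x - w)).
  have := cintegrableB (i1 x) (iA x); apply: cintegrable_eq => w.
  by rewrite -cmulBl dphi addrK.
exists (fun x => creal (kappa R)^-1 *c cint (fun w => a w *c ker g (x - w))).
  exact: (apxM nu0 HM).
move=> x Ox; have n0 := nu0 Ox.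
have e2 : psi x *c h x = phi x.
  rewrite /phi /q; have [hx|hx] := ltP (2 * m%:R) `|x - 0|; first by rewrite (ccut_out mR hx) !cmul0l.
  have [|_ ->] := G1 x; last by rewrite crealM scale1r.
  by apply: KG; split => //; exact: subset_closure.
have -> : psi x *c h x - creal (kappa R)^-1 *c cint (fun w => a w *c ker g (x - w)) =
    (kappa R)^-1 *: cint (fun w => b w *c ker g (x - w)).
  rewrite e2 -[phi x]kappaK -(e1 x) crealM -scalerBr -(cintB (i1 x) (iA x)).
  by congr (_ *: _); apply: cint_eq => w; rewrite -cmulBl dphi addrK.
have bD y : ~ D y -> b y = 0.
  by move=> /q0 /nbhs_singleton qy; rewrite /b qy cmul0r.
have bm : cmeas b.
  apply: cmeas_contT => y; apply: (cvg_cmul _ (C1_cont hq (I : setT y))).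
  exact: (C1_dbar_cont hpsi).
have ble y : D y -> eucl (b y) <= 8 * C / m%:R / nu4 y.
  move=> Dy; have n40 := nu40 Dy.
  have hle : eucl (h y) <= C / nu4 y.
    rewrite ler_pdivlMr //; apply: le_trans (hC (DE Dy)).
    by apply: ler_wpM2l; [exact: eucl_ge0 | exact: nu4_le].
  rewrite eucl_cmul /q crealM eucl_scale.
  have -> : 8 * C / m%:R / nu4 y = 2 * (4 / m%:R) * (C / nu4 y) by ring.
  apply: ler_pM; rewrite ?eucl_ge0 ?mulr_ge0 ?eucl_ge0 //.
    by apply: (le_trans (eucl_le_norm _)); rewrite ler_pM2l //; exact: (dcut_bound 0 y mR).
  have /andP[c0 c1] := chi01 y; rewrite ger0_norm //; apply: le_trans hle.
  by rewrite ler_piMl ?eucl_ge0.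
have C80 : 0 <= 8 * C / m%:R by rewrite divr_ge0 ?mulr_ge0 // ltW.
have hI := kernel_integral_le gc (open_measurable2 oD) mnu4 nu40 bm bD ble n0 C80 (intD Ox).
have [_ nI] := eucl_cintegrable (cmeasM bm (ker_cmeas x)) hI.
rewrite eucl_scale gtr0_norm ?invr_gt0 // -ler_pdivlMr //.
have -> : (kappa R)^-1 * (16 * C * A) / m%:R / nu x =
    (kappa R)^-1 * (2 * (8 * C / m%:R * A / nu x)) by ring.
rewrite ler_pM2l ?invr_gt0 //; apply: (le_trans (eucl_le_norm _)).
by rewrite ler_pM2l.
Qed.

End Truncation.

Lemma density : 0 <= A -> apx H O nu h.
Proof.
move=> A0; apply: apx_lim => // e e0; have k0 := kappa_gt0 R.
have e20 : 0 < e / 2 by rewrite divr_gt0.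
have C1' : 0 < 2 * C + 1 by rewrite ltr_wpDl // mulr_ge0.
have [K cK hK] := decay (divr_gt0 e20 C1').
have [M M0 hM] := compact_bound (F := id) cK (fun x _ => cvg_id).
pose Q := (kappa R)^-1 * (16 * C * A).
have Q0 : 0 <= Q by rewrite !mulr_ge0 // invr_ge0 ltW.
(* Beyond [M], so that [psi] is 1 on [K], and beyond [Q / (e / 2)], so that the error of
   [truncated_approx] is at most [e / 2]. *)
pose m := (Num.truncn (Num.max M (Q / (e / 2)))).+1.
have mgt : Num.max M (Q / (e / 2)) < m%:R by exact: truncnS_gt.
have mR : 0 < (m%:R : R) by rewrite ltr0n.
have [F aF bF] := @truncated_approx m isT.
exists F => // x Ox; have n0 := nu0 Ox.
have -> : h x - F x = (h x - ccut 0 m%:R x *c h x) + (ccut 0 m%:R x *c h x - F x).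
  by rewrite addrA subrK.
apply: (@le_trans _ _ ((eucl (h x - ccut 0 m%:R x *c h x) + eucl (ccut 0 m%:R x *c h x - F x)) * nu x)).
  by apply: ler_wpM2r; [exact: ltW | exact: eucl_tri].
rewrite mulrDl [e]splitr; apply: lerD; last first.
  apply: (le_trans (bF x Ox)); rewrite ler_pdivrMr // [leRHS]mulrC -ler_pdivrMr //.
  by apply: ltW; apply: le_lt_trans mgt; rewrite le_max lexx orbT.
rewrite ccutE; have [Kx|nK] := pselect (K x).
  rewrite cut1 // ?scale1r ?subrr ?eucl0 ?mul0r; first exact: ltW.
  apply: ltW; rewrite subr0; apply: (le_lt_trans (hM x Kx)).
  by apply: le_lt_trans mgt; rewrite le_max lexx.
rewrite -[X in eucl (X - _)]scale1r -scalerBl eucl_scale.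
have /andP[c0 c1] := cut_bound 0 m%:R x.
apply: (@le_trans _ _ (eucl (h x) * nu x)).
  apply: ler_wpM2r; first exact: ltW.
  by rewrite ler_piMl ?eucl_ge0 // ger0_norm ?subr_ge0 // lerBlDr lerDl.
have n1 : nu x <= e / 2 / (2 * C + 1) * nu14 x := le_trans (nu_le Ox) (hK x (OinD Ox) nK).
apply: (@le_trans _ _ (e / 2 / (2 * C + 1) * C)).
  apply: le_trans (ler_wpM2l _ (hC (DE (OinD Ox)))); last by rewrite ltW // divr_gt0.
  by rewrite mulrCA; apply: ler_wpM2l => //; exact: eucl_ge0.
rewrite mulrAC ler_pdivrMr // ler_wpM2l ?(ltW e20) //.
move: C0; lra.
Qed.

End Density.

(** * Kernel bounds from bounds on circles *)

Section Annulus.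
Variable R : realType.
Local Notation P := (R * R)%type.
Local Notation mu := (@leb2 R).
Implicit Types (z w u x y p t : P) (F G h v g f phi : P -> P).

(** A Euclidean radial cutoff instead of the square [ccut]: the ring on which it varies has to be
    swept by the Euclidean circles of condition (a)(ii). *)
Definition disc (r1 r2 : R) w : R :=
  step ((r2 ^+ 2 - (w.1 * w.1 + w.2 * w.2)) * (r2 ^+ 2 - r1 ^+ 2)^-1).

Lemma disc_C1 (r1 r2 : R) : 0 < r1 -> r1 < r2 ->
  [/\ C1 setT (fun w => creal (disc r1 r2 w)), disc r1 r2 0 = 1,
      forall w, r2 < `|w| -> disc r1 r2 w = 0 &
      forall w, dB (fun w => creal (disc r1 r2 w)) w != 0 -> r1 < eucl w < r2].
Proof.
move=> r10 r12; have r20 : 0 < r2 := lt_trans r10 r12.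
have q0 : 0 < r2 ^+ 2 - r1 ^+ 2 by rewrite subr_gt0 ltrXn2r ?nnegrE ?ltW.
pose q := (r2 ^+ 2 - r1 ^+ 2)^-1; have qi : 0 < q by rewrite invr_gt0.
pose rad w := (r2 ^+ 2 - (w.1 * w.1 + w.2 * w.2)) * q.
have hr b y : rpd b rad y (- (2 * (if b then y.2 else y.1)) * q).
  have := rpdM (rpdB (rpd_cst b (r2 ^+ 2) y) (rpdD (rpdM (rpd_fst b y) (rpd_fst b y)) (rpdM (rpd_snd b y) (rpd_snd b y)))) (rpd_cst b q y).
  by move/is_derive_eq; apply; case: (b) => /=; ring.
pose D b y : P := creal (dstep (rad y) * (- (2 * (if b then y.2 else y.1)) * q)).
have hD b y : hasp b (fun w => creal (disc r1 r2 w)) y (D b y).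
  by apply: hasp_creal; exact: (rpd_comp (hr b y) (is_derive_step _)).
have c1 y : z.1 @[z --> y] --> y.1 by exact: (cvg_fstP cvg_id).
have c2 y : z.2 @[z --> y] --> y.2 by exact: (cvg_sndP cvg_id).
have cr y : rad z @[z --> y] --> rad y.
  exact: (cvgM (cvgB (cvg_cst (r2 ^+ 2)) (cvgD (cvgM (c1 y) (c1 y)) (cvgM (c2 y) (c2 y)))) (cvg_cst q)).
have cs y : step (rad z) @[z --> y] --> step (rad y).
  exact: (cvg_comp _ _ (cr y) (@step_cont R (rad y))).
have cd y : dstep (rad z) @[z --> y] --> dstep (rad y).
  exact: (cvg_comp _ _ (cr y) (@dstep_cont R (rad y))).
have radE w : rad w = (r2 ^+ 2 - eucl w ^+ 2) * q by rewrite eucl_sq !expr2.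
split.
- apply: (C1I (D := D) openT) => [y _|b y _|b y _].
  + exact: (cvg_prod (cs y) (cvg_cst (0 : R))).
  + exact: hD.
  + case: b.
      exact: (cvg_prod (cvgM (cd y) (cvgM (cvgN (cvgM (cvg_cst (2:R)) (c2 y))) (cvg_cst q))) (cvg_cst (0 : R))).
    exact: (cvg_prod (cvgM (cd y) (cvgM (cvgN (cvgM (cvg_cst (2:R)) (c1 y))) (cvg_cst q))) (cvg_cst (0 : R))).
- apply: step1; rewrite /= mulr0 addr0 subr0 ler_pdivlMr // mul1r lerBlDr lerDl.
  by rewrite exprn_ge0 // ltW.
- move=> w hw; apply: step0; rewrite -/q -/(rad w) radE pmulr_lle0 // subr_le0.
  rewrite lerXn2r ?nnegrE ?eucl_ge0 ?(ltW r20) //; apply: ltW.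
  by apply: (lt_le_trans hw); exact: norm_le_eucl.
- move=> w; apply: contra_neqT => hw.
  suff d0 : dstep (rad w) = 0.
    rewrite (dbarE (hD false w) (hD true w)) /D d0 !mul0r.
    by apply: pair_ext; rewrite /= !mulr0 ?mul0r ?subrr ?addr0 ?mulr0 ?mul0r ?subrr ?addr0.
  have [h1 h2] : dstep 0 = 0 :> R /\ dstep 1 = 0 :> R.
    split; first by case: (step_cases (0:R)) => -[] //; lra.
    by case: (step_cases (1:R)) => -[] //; lra.
  have [e1|e1] := leP (eucl w) r1.
    have : 1 <= rad w.
      rewrite radE /q ler_pdivlMr // mul1r lerD2l lerN2.
      by rewrite lerXn2r ?nnegrE ?eucl_ge0 // ltW.
    by case: (step_cases (rad w)) => -[] //; lra.
  have e2 : r2 <= eucl w by move: hw; rewrite e1 /= -leNgt.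
  have : rad w <= 0.
    rewrite radE pmulr_lle0 // subr_le0.
    by rewrite lerXn2r ?nnegrE ?eucl_ge0 // ltW.
  by case: (step_cases (rad w)) => -[] //; lra.
Qed.

(* A point [w] with [eucl w] near [r] satisfies [eucl (w - s w) = r] for a small [s],
   so moving the centre along [s w] makes the circles sweep an annulus. *)
Lemma circle_bound g (W : set P) (nu : P -> R) y0 (r eta M d : R) : hol setT g ->
  0 < eta -> eta < r -> 0 <= M -> (forall z, W z -> 0 < nu z) ->
  (forall z x, W z -> eucl (x - y0) < eta -> forall zeta, eucl (zeta - (z - x)) = r ->
     eucl (g zeta) * nu z <= M) ->
  0 < d -> (forall z, W z -> d <= eucl (z - y0)) ->
  exists C : R, forall z, W z -> eucl (ker g (z - y0)) * nu z <= C.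
Proof.
move=> hg eta0 etar M0 nu0 hM d0 hd; have k0 := kappa_gt0 R.
pose r1 := r - eta; pose r2 := r + eta.
have r10 : 0 < r1 by rewrite subr_gt0.
have r12 : r1 < r2 by rewrite /r1 /r2; lra.
have [hc c0 cout csupp] := disc_C1 r10 r12.
pose chi w := creal (disc r1 r2 w).
have cout' w : r2 < `|w - 0| -> chi w = 0 by rewrite subr0 /chi => /cout ->.
have [T T0 hT] := support_bound (fun x => C1_dbar_cont hc (I : setT x)) (dbar_out cout').
pose m := fine (mu (sq (0 : P) r2)).
have m0 : 0 <= m by apply: fine_ge0; exact: measure_ge0.
exists ((kappa R)^-1 * (4 * T / r1 * M * m) / d) => z Wz; have n0 := nu0 z Wz.
pose p := z - y0.
have [hs1 [_ hs2]] := C1_shift (- p) openT hg.1.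
have hsh : C1 setT (fun w => g (w - - p)) by exact: hs1.
(* Cauchy-Pompeiu at 0 for this function expresses [g p] through the values of [g] on the ring
   [r1 < eucl w < r2] about [p]. *)
pose F w := chi w *c g (w - - p).
have hF : C1 setT F by exact: (C1M openT hc hsh).
have Fout w : r2 < `|w - 0| -> F w = 0 by move=> /cout' h; rewrite /F h cmul0l.
have dF w : dB F w = dB chi w *c g (w - - p).
  by rewrite /F (dbarM hc hsh I) hs2 // hg.2 // cmul0r addr0.
have F0 : F 0 = g p by rewrite /F /chi c0 sub0r opprK cmul1l.
have e := cauchy_conv1 0 hF Fout.
have gp : g p = (kappa R)^-1 *: cint (fun w => dB F w *c cinv (0 - w)) by rewrite e kappaK F0.
have mF : cmeas (fun w => dB F w *c cinv (0 - w)).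
  apply: cmeasM; first by apply: cmeas_contT => x; exact: (C1_dbar_cont hF).
  by apply: (cmeas_comp (cmeas_cinv R)); exact: cmeas_reflect.
have bF w : `|dB F w *c cinv (0 - w)| <= 2 * T / r1 * M / nu z.
  have [h0|h0] := eqVneq (dB chi w) 0.
    rewrite dF h0 !cmul0l normr0; apply: divr_ge0; last exact: ltW.
    by rewrite mulr_ge0 // divr_ge0 ?mulr_ge0 // ltW.
  have /andP[w1 w2] := csupp w h0.
  have ew0 : 0 < eucl w := lt_trans r10 w1.
  apply: (le_trans (norm_le_eucl _)); rewrite dF !eucl_cmul eucl_cinv sub0r euclN.
  have g1 : eucl (g (w - - p)) * nu z <= M.
    pose s := r / eucl w - 1.
    apply: (hM z (y0 + s *: w) Wz).
      rewrite addrC addKr eucl_scale /s.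
      have -> : r / eucl w - 1 = (r - eucl w) / eucl w by field; rewrite gt_eqF.
      rewrite normrM normfV (gtr0_norm ew0) divfK ?gt_eqF // ltr_norml.
      by rewrite /r1 /r2 in w1 w2; apply/andP; split; lra.
    have -> : w - - p - (z - (y0 + s *: w)) = (1 + s) *: w.
      by rewrite /p scalerDl scale1r; move: (s *: w) => v; apply: pair_ext => /=; ring.
    rewrite eucl_scale /s addrC subrK ger0_norm; first by rewrite divfK // gt_eqF.
    by rewrite divr_ge0 ?eucl_ge0 // ltW // (lt_trans eta0).
  have g2 : eucl (g (w - - p)) <= M / nu z by rewrite ler_pdivlMr.
  have -> : 2 * T / r1 * M / nu z = 2 * T * (M / nu z) * r1^-1 by ring.
  apply: ler_pM; rewrite ?mulr_ge0 ?eucl_ge0 ?invr_ge0 ?eucl_ge0 //; last first.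
    by rewrite lef_pV2 ?posrE // ltW.
  apply: ler_pM; rewrite ?eucl_ge0 //.
  by apply: (le_trans (eucl_le_norm _)); rewrite ler_pM2l //; exact: hT.
have oF w : r2 < `|w - 0| -> dB F w *c cinv (0 - w) = 0.
  by move=> hw; rewrite (dbar_out Fout) // cmul0l.
have hI := norm_cint_bounded mF bF oF.
have gn : eucl (g p) * nu z <= (kappa R)^-1 * (4 * T / r1 * M * m).
  rewrite gp eucl_scale gtr0_norm ?invr_gt0 // -[X in X <= _]mulrA ler_pM2l ?invr_gt0 // -ler_pdivlMr //.
  apply: (le_trans (eucl_le_norm _)).
  have -> : 4 * T / r1 * M * m / nu z = 2 * (2 * T / r1 * M / nu z * m) by ring.
  by rewrite ler_pM2l.
rewrite /ker eucl_cmul eucl_cinv mulrAC.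
have dz := hd z Wz.
apply: ler_pM; rewrite ?mulr_ge0 ?invr_ge0 ?eucl_ge0 ?(ltW n0) //.
by rewrite lef_pV2 ?posrE // (lt_le_trans d0).
Qed.

End Annulus.

(** * Neighbourhoods and distances to boundaries *)

Section Geometry.
Variable R : realType.
Local Notation P := (R * R)%type.
Implicit Types (z w u x y p t : P) (F G h v g f phi : P -> P).

Lemma open_continuous_at (U : set P) (nu : P -> R) x : open U -> {within U, continuous nu} ->
  U x -> {for x, continuous nu}.
Proof. by move=> oU; rewrite continuous_open_subspace // => h Ux; apply: h; rewrite inE. Qed.

Lemma dist_le (M N : set P) (d : R) x y : (d%:E <= dist M N)%E -> M x -> N y -> d <= eucl (x - y).
Proof.
move=> h Mx Ny; rewrite -lee_fin; apply: (le_trans h); apply: ereal_inf_lbound.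
by exists x => //; exists y.
Qed.

(** A limit point of [M] outside [N] would be a boundary point of [N], at positive distance from
    [M]. An infinite distance allows any radius, here 1. *)
Lemma closure_sub_of_dist (M N : set P) : open N -> M `<=` N -> (0 < dist M (bd N))%E ->
  closure M `<=` N.
Proof.
move=> oN MN d0 x cx; apply: contrapT => nNx.
have bx : bd N x.
  split; first exact: (closure_subset MN).
  by move=> /interior_subset.
have [d dpos hd] : exists2 d : R, 0 < d & (d%:E <= dist M (bd N))%E.
  move: d0; case: (dist M (bd N)) => [r|_|//]; first by rewrite lte_fin => r0; exists r.
  by exists 1 => //; rewrite leey.
have : nbhs x [set y | `|y - x| < d / 2] by apply/square_nbhs; exists (d / 2); rewrite ?divr_gt0.
move=> /cx[y [My /= xy]]; have := dist_le hd My bx.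
have := eucl_le_norm (y - x); move: xy; move: (eucl _) `|y - x| => a b; lra.
Qed.

(** The segment from [x] to a point of the square avoids the boundary of [N], so its intersection
    with [N] is open and closed in it. *)
Lemma square_in_of_bd (N : set P) x (r : R) : open N -> N x -> 0 <= r ->
  (forall y, bd N y -> r < `|x - y|) -> sq x r `<=` N.
Proof.
move=> oN Nx r0 hb w hw.
pose f (t : R) : P := x + t *: (w - x).
pose S := f @` `[0, 1].
have cS : connected S.
  apply: connected_continuous_connected; first exact: segment_connected.
  apply: continuous_subspaceT => t; apply: cvgD; first exact: cvg_cst.
  under eq_fun do rewrite -crealM.
  rewrite -crealM; apply: (cvg_cmul _ (cvg_cst (w - x))).
  exact: (cvg_prod cvg_id (cvg_cst (0 : R))).
have Ssq y : S y -> `|y - x| <= r.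
  move=> [t]; rewrite /= in_itv /= => /andP[t0 t1] <-; rewrite /f addrC addKr normrZ ger0_norm //.
  by rewrite (le_trans _ hw) // ler_piMl.
have Sx : S x by exists 0; rewrite /= ?in_itv /= ?lexx ?ler01 // /f scale0r addr0.
have Sw : S w by exists 1; rewrite /= ?in_itv /= ?lexx ?ler01 // /f scale1r addrC subrK.
suff E : S `&` N = S by have : (S `&` N) w by [rewrite E]; case.
apply: cS; first by exists x.
  by exists N.
exists (closure N); first exact: closed_closure.
apply/seteqP; split => y [Sy h]; split => //; first exact: subset_closure.
apply: contrapT => nN; have := Ssq y Sy; rewrite leNgt distrC hb //.
by split => // /interior_subset.
Qed.

End Geometry.

(** * The Mittag-Leffler argument *)

Section Sequences.
Variable R : realType.
Local Notation P := (R * R)%type.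

(** The intervals of radius [2 * c / 2 ^+ k] about [a k] are nested, and their common point is the
    limit with the stated rate. *)
Lemma geometric_real (a : nat -> R) (c : R) m :
  (forall k, (m <= k)%N -> `|a k.+1 - a k| <= c / 2 ^+ k) ->
  exists l, forall k, (m <= k)%N -> `|l - a k| <= 2 * c / 2 ^+ k.
Proof.
move=> H; have e k : 2 * c / 2 ^+ k = 2 * (c / 2 ^+ k) by rewrite mulrA.
have s k : c / 2 ^+ k.+1 = c / 2 ^+ k / 2 by rewrite exprS invfM mulrA mulrAC.
pose al k := a (k + m)%N - 2 * c / 2 ^+ (k + m); pose be k := a (k + m)%N + 2 * c / 2 ^+ (k + m).
have h1 : {homo al : i j / (i <= j)%N >-> i <= j}.
  apply/nondecreasing_seqP => k; rewrite /al addSn !e s.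
  have := H (k + m)%N (leq_addl _ _); rewrite ler_norml => /andP[h _]; lra.
have h2 : {homo be : i j / (i <= j)%N >-> j <= i}.
  apply/nonincreasing_seqP => k; rewrite /be addSn !e s.
  have := H (k + m)%N (leq_addl _ _); rewrite ler_norml => /andP[_ h]; lra.
have h3 k : al k <= be k.
  rewrite /al /be !e; have : 0 <= c / 2 ^+ (k + m).
    exact: le_trans (normr_ge0 _) (H _ (leq_addl _ _)).
  lra.
have [l hl] := nested h1 h2 h3; exists l => k mk.
have := hl (k - m)%N; rewrite /al /be subnK // => /andP[l1 l2].
by rewrite ler_norml; apply/andP; split; lra.
Qed.

Lemma geometric_plane (a : nat -> P) (c : R) m :
  (forall k, (m <= k)%N -> `|a k.+1 - a k| <= c / 2 ^+ k) ->
  exists l, forall k, (m <= k)%N -> `|l - a k| <= 2 * c / 2 ^+ k.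
Proof.
move=> H.
have [l1 h1] := @geometric_real (fun k => (a k).1) c m (fun k mk => le_trans (norm1_le (a k.+1 - a k)) (H k mk)).
have [l2 h2] := @geometric_real (fun k => (a k).2) c m (fun k mk => le_trans (norm2_le (a k.+1 - a k)) (H k mk)).
by exists (l1, l2) => k mk; apply: normP_le => /=; [exact: h1 | exact: h2].
Qed.

Lemma cvg_geometric (a : nat -> P) l (c : R) m :
  (forall k, (m <= k)%N -> `|l - a k| <= c / 2 ^+ k) -> a @ \oo --> l.
Proof.
move=> H; apply/cvgrPdist_lt => e e0.
exists (maxn m (Num.truncn (c / e)).+1) => // k /=; rewrite geq_max => /andP[mk ck].
apply: (le_lt_trans (H k mk)); rewrite ltr_pdivrMr ?exprn_gt0 // mulrC -ltr_pdivrMr //.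
apply: (lt_le_trans (truncnS_gt _)).
by rewrite -natrX ler_nat (leq_trans ck) // ltnW // ltn_expl.
Qed.

End Sequences.

(** * Weighted spaces and density on the exhaustion *)

Section Exhaustion.
Variable R : realType.
Local Notation P := (R * R)%type.
Local Notation mu := (@leb2 R).
Local Notation mset A := (measurable (A : set (measurableTypeR R * measurableTypeR R))).
Implicit Types (z w u x y p t : P) (F G h v f phi : P -> P).

Variables (Omega : set P) (Om : nat -> set P) (nu : nat -> P -> R).
Hypothesis HOmega_open : open Omega.
Hypothesis HOm_open : forall n, open (Om n).
Hypothesis HOm_incr : forall n, Om n `<=` Om n.+1.
Hypothesis HOmega_union : Omega = \bigcup_n Om n.
Hypothesis Hd_pos : forall n k, (n < k)%N -> (0 < dist (Om n) (bd (Om k)))%E.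
Hypothesis Hnu_pos : forall n x, Omega x -> 0 < nu n x.
Hypothesis Hnu_cont : forall n, {within Omega, continuous (nu n)}.
Hypothesis Hnu_incr : forall n x, Omega x -> nu n x <= nu n.+1 x.

Lemma Om_Omega n x : Om n x -> Omega x.
Proof. by move=> h; rewrite HOmega_union; exists n. Qed.

Lemma Om_le m n : (m <= n)%N -> Om m `<=` Om n.
Proof.
move=> /subnK <-; elim: (n - m)%N => [//|k IH]; rewrite addSn.
by apply: (subset_trans IH); exact: HOm_incr.
Qed.

Lemma nu_mono m n x : (m <= n)%N -> Omega x -> nu m x <= nu n x.
Proof.
move=> /subnK <- Ox; elim: (n - m)%N => [//|k IH]; rewrite addSn.
exact: le_trans IH (Hnu_incr _ Ox).
Qed.

Lemma nu_cont n x : Omega x -> {for x, continuous (nu n)}.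
Proof. by move=> Ox; exact: (open_continuous_at HOmega_open (@Hnu_cont n) Ox). Qed.

Lemma nu_pos n m x : Om m x -> 0 < nu n x.
Proof. by move=> /Om_Omega; exact: Hnu_pos. Qed.

Arguments nu_cont n {x} _.
Arguments nu_pos n {m x} _.

Lemma closure_Om m n : (m < n)%N -> closure (Om m) `<=` Om n.
Proof. by move=> mn; apply: closure_sub_of_dist; [| exact: Om_le (ltnW mn) | exact: Hd_pos]. Qed.

Lemma nu_inv_loc n x : Omega x -> exists M : R, \forall y \near x, (nu n y)^-1 <= M.
Proof.
move=> Ox; have n0 := Hnu_pos n Ox; exists (2 / nu n x).
have /cvgrPdist_lt /(_ (nu n x / 2)) := nu_cont n Ox; rewrite divr_gt0 // => /(_ isT).
apply: filterS => y; rewrite ltr_norml => /andP[_ h].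
have h2 : nu n x / 2 < nu n y by lra.
by rewrite -invf_div lef_pV2 ?posrE ?divr_gt0 ?(ltW h2) // (lt_trans _ h2) // divr_gt0.
Qed.

Definition weighted n F := exists2 C : R, 0 <= C & forall x, Om n x -> eucl (F x) * nu n x <= C.

Lemma weighted_le m n F : (m <= n)%N -> weighted n F -> weighted m F.
Proof.
move=> mn [C C0 h]; exists C => // x Ox; apply: le_trans (h x (Om_le mn Ox)).
by apply: ler_wpM2l; [exact: eucl_ge0 | exact: nu_mono (Om_Omega Ox)].
Qed.

Lemma weightedD n F G : weighted n F -> weighted n G -> weighted n (fun x => F x + G x).
Proof.
move=> [C C0 hF] [D D0 hG]; exists (C + D); first exact: addr_ge0.
move=> x Ox; rewrite (le_trans _ (lerD (hF x Ox) (hG x Ox))) // -mulrDl.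
by apply: ler_wpM2r; [exact: ltW (nu_pos _ Ox) | exact: eucl_tri].
Qed.

Lemma weightedM n (c : P) F : weighted n F -> weighted n (fun x => c *c F x).
Proof.
move=> [C C0 hF]; exists (eucl c * C); first by rewrite mulr_ge0 ?eucl_ge0.
by move=> x Ox; rewrite eucl_cmul -mulrA; apply: ler_wpM2l; [exact: eucl_ge0 | exact: hF].
Qed.

Definition holw n F := hol (Om n) F /\ weighted n F.

Lemma holw0 n : holw n (cst 0).
Proof. by split; [exact: hol_cst | exists 0 => // x _; rewrite eucl0 mul0r]. Qed.

Lemma holwD n F G : holw n F -> holw n G -> holw n (fun x => F x + G x).
Proof. by move=> [h1 h2] [h3 h4]; split; [exact: holD | exact: weightedD]. Qed.

Lemma holwM n (c : P) F : holw n F -> holw n (fun x => c *c F x).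
Proof. by move=> [h1 h2]; split; [apply: holM => //; exact: hol_cst | exact: weightedM]. Qed.

Lemma measurable_nu_inv n m : measurable_fun (Om m) (fun y => (nu n y)^-1).
Proof.
apply: cont_measurable_on => // x Dx; have Ox := Om_Omega Dx.
by apply: cvgV; [rewrite gt_eqF // Hnu_pos | exact: nu_cont].
Qed.

Variables (g : nat -> P -> P) (I1 I2 : nat -> nat) (X : nat -> set P) (Rn rn : nat -> R).
Variables (A2 : nat -> P -> R) (I4 : nat -> nat) (A4 : nat -> R).
Hypothesis Hg : forall n, entire (g n) /\ g n 0 = cone R.
Hypothesis HI : forall n, (n < I1 n)%N /\ (n < I2 n)%N.
Hypothesis Hai : forall n (eps : R), 0 < eps -> exists K : set P,
  [/\ compact K, K `<=` closure (Om n) & forall x, (Om n `\` K) x -> nu n x <= eps * nu (I1 n) x].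
Hypothesis Haii : forall n, [/\ open (X n) /\ X n `<=` ~` closure (Om (I2 n)),
  0 < Rn n /\ ((2 * Rn n)%:E < dist (X n) (Om (I2 n)))%E,
  Rn n < rn n,
  (forall x, [set a + b | a in X n & b in eball 0 (Rn n)] x -> 0 < A2 n x)
    /\ (forall x, X n x -> exists M : R, \forall y \near x, A2 n y <= M) &
  (forall z x, Om (I2 n) z -> [set a + b | a in X n & b in eball 0 (Rn n)] x ->
    (ereal_sup [set (eucl (g n zeta) * nu (I2 n) z)%:E |
        zeta in [set zeta | (eucl (zeta - (z - x)) = rn n)%R]] <= (A2 n x)%:E)%E)].
Hypothesis Haiii : forall n (K : set P), compact K -> exists2 A3 : R, 0 < A3 &
  forall x, Om n x ->
    (\int[mu]_(y in K) ((eucl (g n (x - y)) * nu n x / eucl (x - y))%:E) <= A3%:E)%E.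
Hypothesis Hb : forall n, [/\ (n < I4 n)%N, 0 < A4 n & forall x, Om n x ->
  (\int[mu]_(y in Om (I4 n))
    ((eucl (g (I1 (I4 n)) (x - y)) * nu n x / (eucl (x - y) * nu (I4 n) y))%:E) <= (A4 n)%:E)%E].
Hypothesis Hc : forall n (M : set P), closed M -> M `<=` closure (Om n) ->
  forall N : set P, (exists2 x, (~` M) x & N = connected_component (~` M) x) ->
    N `&` ~` closure (Om n) !=set0 -> N `&` X (I1 (I4 n)) !=set0.
Hypothesis HI214 : forall n, (I1 (I4 n.+1) <= I2 (I1 (I4 n)))%N.

Local Notation I14 n := (I1 (I4 n)).
Local Notation I214 n := (I2 (I1 (I4 n))).

Lemma n_I4 n : (n < I4 n)%N. Proof. by have [] := Hb n. Qed.
Lemma I4_I14 n : (I4 n < I14 n)%N. Proof. by have [] := HI (I4 n). Qed.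
Lemma n_I14 n : (n < I14 n)%N. Proof. exact: ltn_trans (n_I4 n) (I4_I14 n). Qed.
Lemma I14_I214 n : (I14 n < I214 n)%N. Proof. by have [] := HI (I14 n). Qed.

Lemma hol_g n : hol setT (g n). Proof. by apply: entire_hol; have [] := Hg n. Qed.

(** Condition (a)(iii) is used at the index [I14 n], to which the kernel belongs, with the constant
    1 on the square as source; monotonicity then lowers the weight to [nu n]. *)
Lemma kernel_integral_sq n y0 (r : R) : exists2 A : R, 0 <= A &
  forall x, Om n x -> (\int[mu]_(w in sq y0 (2 * r)) (`|ker (g (I14 n)) (x - w)|)%:E <= (A / nu n x)%:E)%E.
Proof.
have [A A0 hA] := Haiii (I14 n) (@sq_compact R y0 (2 * r)).
have gc x : {for x, continuous (g (I14 n))} := C1_cont (hol_g _).1 (I : setT x).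
exists A; first exact: ltW.
move=> x Ox; have Ox14 := Om_le (ltnW (n_I14 n)) Ox; have n0 := nu_pos n Ox; have n1 := nu_pos (I14 n) Ox.
have mS := @measurable_square R y0 (2 * r).
pose F := cext (sq y0 (2 * r)) (cst (cone R)).
have hI : (\int[mu]_(y in sq y0 (2 * r)) ((eucl (g (I14 n) (x - y)) * nu (I14 n) x / (eucl (x - y) * 1))%:E) <= A%:E)%E.
  by apply: le_trans (hA x Ox14); rewrite le_eqVlt; apply/orP; left; apply/eqP; apply: eq_integral => y _; rewrite mulr1.
have h1 := @kernel_integral_le R (sq y0 (2 * r)) (g (I14 n)) (cst 1) F x A (nu (I14 n) x) 1 gc mS.
have {}h1 : (\int[mu]_y ((eucl (F y *c ker (g (I14 n)) (x - y)))%:E) <= (1 * A / nu (I14 n) x)%:E)%E.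
  apply: h1 => //.
  - exact: (measurable_cst ((1 : R)^-1)).
  - by apply: cmeas_cext => //; exact: cmeas_cst.
  - by move=> y; exact: cext_out.
  - by move=> y Sy; rewrite /F cext_in // divr1 -[leRHS]sqrtr1 /eucl /= expr1n expr0n addr0.
apply: (@le_trans _ _ (1 * A / nu (I14 n) x)%:E); last first.
  rewrite lee_fin mul1r; apply: ler_wpM2l; first exact: ltW.
  by rewrite lef_pV2 ?posrE //; apply: (nu_mono _ (Om_Omega Ox)); exact: ltnW (n_I14 n).
apply: le_trans h1; rewrite integral_mkcond; apply: ge0_le_integral => //.
- by move=> y _; rewrite patchE; case: ifP.
- apply/(measurable_restrictT _ mS); apply/measurable_EFinP; apply: measurable_funTS; apply: cmeas_norm.
  by apply: (cmeas_comp (cmeas_ker gc)); exact: cmeas_reflect.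
- apply/measurable_EFinP; apply: measurable_eucl; apply: cmeasM.
    by apply: cmeas_cext => //; exact: cmeas_cst.
  by apply: (cmeas_comp (cmeas_ker gc)); exact: cmeas_reflect.
- move=> y _; rewrite patchE; case: ifPn => [|_]; last by rewrite lee_fin eucl_ge0.
  by rewrite inE => Sy; rewrite /F cext_in // cmul1l lee_fin norm_le_eucl.
Qed.

Lemma holw_kernel n y0 : X (I14 n) y0 -> holw (I214 n) (fun x => ker (g (I14 n)) (x - y0)).
Proof.
move=> Xy; have [[oX XC] [R0 hR] Rr [A2pos A2loc] hsup] := Haii (I14 n).
set N := I14 n in Xy oX XC R0 hR Rr A2pos A2loc hsup *.
have [h1 h2] := hol_shift y0 (@open_neq0 R) (ker_hol (hol_g N)).
have sub x : Om (I2 N) x -> [set x | [set~ (0 : P)] (x - y0)] x.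
  by move=> Ox /eqP; rewrite subr_eq0 => /eqP xy; apply: (XC y0 Xy); rewrite -xy; exact: subset_closure.
split; first exact: (hol_sub sub (conj h1 h2)).
have [M /square_nbhs[d d0 hd]] := A2loc y0 Xy.
have [C hC] : exists C : R, forall z, Om (I2 N) z -> eucl (ker (g N) (z - y0)) * nu (I2 N) z <= C.
  (* Within [d] of [y0] the function [A2] is bounded by [M], within [Rn N] the centres are
     admissible, and the points of [Om (I2 N)] are at distance at least [2 * Rn N] from [y0]. *)
  apply: (@circle_bound R (g N) (Om (I2 N)) (nu (I2 N)) y0 (rn N) (Num.min d (Rn N)) (Num.max M 0) (2 * Rn N)).
  - exact: hol_g.
  - by rewrite lt_min d0.
  - by rewrite gt_min Rr orbT.
  - by rewrite le_max lexx orbT.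
  - by move=> z Oz; exact: nu_pos Oz.
  - move=> z x Oz; rewrite lt_min => /andP[x1 x2] zeta hz.
    have Xx : [set a + b | a in X N & b in eball 0 (Rn N)] x.
      by exists y0 => //; exists (x - y0); rewrite ?/eball /= ?subr0 // addrC subrK.
    have := hsup z x Oz Xx => hs.
    have : ((eucl (g N zeta) * nu (I2 N) z)%:E <= (A2 N x)%:E)%E.
      by apply: le_trans hs; apply: ereal_sup_ubound; exists zeta.
    rewrite lee_fin => /le_trans; apply.
    by rewrite le_max hd // (le_lt_trans (norm_le_eucl _)).
  - by rewrite mulr_gt0.
  - by move=> z Oz; rewrite -euclN opprB; exact: (dist_le (ltW hR)).
exists (Num.max C 0); first by rewrite le_max lexx orbT.
by move=> x Ox; rewrite le_max hC.
Qed.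

Lemma apx_kernel n y : (~` closure (Om n)) y ->
  apx (holw (I214 n)) (Om n) (nu n) (fun x => ker (g (I14 n)) (x - y)).
Proof.
move=> Yy; have oY : open (~` closure (Om n)) by rewrite openC; exact: closed_closure.
(* Condition (c) with [M] the whole closure of [Om n]: the component of [y] contains a pole [z] in
   the open set [X (I14 n)], around which all kernels are admissible. *)
have [z [Nz Xz]] : connected_component (~` closure (Om n)) y `&` X (I14 n) !=set0.
  have Ny := connected_component_refl Yy.
  apply: (Hc (@closed_closure _ (Om n)) (@subset_refl _ (closure (Om n)))); first by exists y.
  by exists y.
have [[oX _] _ _ _ _] := Haii (I14 n).
apply: (@apx_connected R (holw (I214 n)) (Om n) (nu n) _ (holw0 _) (@holwD _) (@holwM _) (~` closure (Om n))
  (fun y x => ker (g (I14 n)) (x - y)) oY _ _ (connected_component (~` closure (Om n)) y) z) => //.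
- by move=> x Ox; exact: nu_pos Ox.
- by move=> x Ox; apply: ker_reflect_hol => //; exact: hol_g.
- by move=> y0 r _ _; exact: kernel_integral_sq.
- exact: component_connected.
- exact: connected_component_sub.
- apply: (open_near oX _ Xz) => w Xw; apply: apx_id; last exact: holw_kernel.
- exact: connected_component_refl.
Qed.

Lemma density_at n h : holw (I14 n) h -> apx (holw (I214 n)) (Om n) (nu n) h.
Proof.
move=> [hh [C C0 hC]]; have [nI4 A40 hb] := Hb n.
have [_ g0] := Hg (I14 n).
apply: (@density R (Om n) (Om (I4 n)) (Om (I14 n)) (nu n) (nu (I4 n)) (nu (I14 n)) (g (I14 n)) (A4 n) C h
   (holw (I214 n)) (@HOm_open (I4 n))).
- exact: closure_Om.
- by apply: Om_le; exact: ltnW (I4_I14 n).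
- by move=> x Ox; exact: nu_pos Ox.
- by move=> x Ox; exact: nu_pos Ox.
- by move=> x Ox; apply: nu_cont; exact: Om_Omega Ox.
- by move=> x Ox; apply: (nu_mono _ (Om_Omega Ox)); exact: ltnW.
- by move=> x Ox; apply: (nu_mono _ (Om_Omega Ox)); exact: ltnW (I4_I14 n).
- exact: hol_g.
- exact: g0.
- exact: holw0.
- exact: holwD.
- exact: holwM.
- by move=> y0 r _ _; exact: kernel_integral_sq.
- exact: apx_kernel.
- by move=> e /(Hai (I4 n))[K [cK _ hK]]; exists K => // x Dx nK; exact: hK.
- exact: hb.
- exact: hh.
- exact: hC.
- exact: C0.
- exact: ltW.
Qed.

Lemma seminorm_bound n m F : (seminorm Om nu n m F < +oo)%E -> exists2 C : R, 0 <= C &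
  forall (b : nat * nat) x, (b.1 + b.2 <= m)%N -> Om n x -> eucl (pbeta b F x) * nu n x <= C.
Proof.
move=> h; exists (Num.max 0 (fine (seminorm Om nu n m F))); first by rewrite le_max lexx.
move=> b x bm Ox; rewrite le_max; apply/orP; right.
have : ((eucl (pbeta b F x) * nu n x)%:E <= seminorm Om nu n m F)%E.
  by apply: ereal_sup_ubound; exists x => //; exists b.
by move: h; case: (seminorm Om nu n m F) => [r|//|].
Qed.

(** * Solutions on the exhaustion and their limit *)

Section Equation.
Variable f : P -> P.
Hypotheses (fs : smooth_on Omega f) (fb : forall n m, (seminorm Om nu n m f < +oo)%E).

Definition solution n v := [/\ C1 (Om n) v, forall x, Om n x -> dB v x = f x & weighted n v].

Lemma solution_le m n v : (m <= n)%N -> solution n v -> solution m v.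
Proof.
move=> mn [h1 h2 h3]; split; [exact: C1_sub (Om_le mn) h1 | | exact: weighted_le h3].
by move=> x /(Om_le mn); exact: h2.
Qed.

(** The difference is written with [- cone R] as a factor, to match the sums and multiples under
    which the spaces are closed. *)
Lemma solution_sub n v v' : solution n v -> solution n v' ->
  holw n (fun x => v x + (- cone R) *c v' x).
Proof.
move=> [h1 h2 h3] [h4 h5 h6]; split; last by apply: weightedD => //; exact: weightedM.
have e x : Om n x -> v x - v' x = v x + (- cone R) *c v' x by rewrite cmulNl cmul1l.
apply: (hol_eq (@HOm_open n) e); split; first exact: (C1B (@HOm_open n) h1 h4).
by move=> x Ox; rewrite (dbarB (@HOm_open n) h1 h4 Ox) h2 // h5 // subrr.
Qed.

Lemma solution_add n v F : solution n v -> holw n F -> solution n (fun x => v x + F x).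
Proof.
move=> [h1 h2 h3] [[h4 h5] h6]; split; [exact: (C1D (@HOm_open n) h1 h4) | | exact: weightedD].
by move=> x Ox; rewrite (dbarD h1 h4 Ox) h2 // h5 // addr0.
Qed.

Lemma solution_exists n : exists v, solution n v.
Proof.
have [nI4 A40 hb] := Hb n; have [_ g0] := Hg (I14 n); have k0 := kappa_gt0 R.
have [C C0 hC] := seminorm_bound (fb (I4 n) 0).
have fD : C1 (Om (I4 n)) f by apply: smooth_C1; apply: smooth_sub fs => x; exact: Om_Omega.
have gc x : {for x, continuous (g (I14 n))} := C1_cont (hol_g _).1 (I : setT x).
pose F := cext (Om (I4 n)) f.
have mF : cmeas F by apply: cmeas_cont => // x Dx; exact: (C1_cont fD).
have hB x : Om n x -> (\int[mu]_y ((eucl (F y *c ker (g (I14 n)) (x - y)))%:E) <= (C * A4 n / nu n x)%:E)%E.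
  move=> Ox; apply: (kernel_integral_le gc (open_measurable2 (@HOm_open (I4 n))) (@measurable_nu_inv (I4 n) (I4 n)) _ mF _ _ _ C0 (hb x Ox)).
  - by move=> y Oy; exact: nu_pos Oy.
  - by move=> y; exact: cext_out.
  - move=> y Oy; rewrite /F cext_in // ler_pdivlMr; last exact: nu_pos Oy.
    exact: (hC (0%N, 0%N) y).
  - exact: nu_pos Ox.
have Bloc x : Om n x -> exists M : R, \forall y \near x, C * A4 n / nu n y <= M.
  move=> /Om_Omega /(nu_inv_loc n)[M hM]; exists (C * A4 n * M); move: hM; apply: filterS => y hy.
  by apply: ler_wpM2l => //; rewrite mulr_ge0 // ltW.
have [h1 h2] := local_solution (@HOm_open (I4 n)) (@HOm_open n) (Om_le (ltnW nI4)) (hol_g _) g0 fD hB Bloc.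
eexists; split; [exact: h1 | exact: h2 |].
exists ((kappa R)^-1 * (2 * (C * A4 n))).
  by rewrite !mulr_ge0 ?invr_ge0 // ltW.
move=> x Ox; have n0 := nu_pos n Ox.
have mH : cmeas (fun y => F y *c ker (g (I14 n)) (x - y)).
  by apply: cmeasM => //; apply: (cmeas_comp (cmeas_ker gc)); exact: cmeas_reflect.
have [_ hI] := eucl_cintegrable mH (hB x Ox).
rewrite eucl_scale gtr0_norm ?invr_gt0 // -[X in X <= _]mulrA ler_pM2l ?invr_gt0 // -ler_pdivlMr //.
by rewrite (le_trans (eucl_le_norm _)) // -[leRHS]mulrA ler_pM2l.
Qed.

(** A solution [w] with a bound on [Om (I214 n)] is corrected by a holomorphic [F] on the same set,
    close to [w - v] on [Om n]. Nothing is lost by the correction, and [I14 n.+1 <= I214 n] makes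
    the result a valid start for the next step. *)
Lemma solution_step n v : solution (I14 n) v -> exists2 v', solution (I14 n.+1) v' &
  forall x, Om n x -> eucl (v' x - v x) * nu n x <= 1 / 2 ^+ n.
Proof.
move=> hv; have [w hw] := solution_exists (I214 n).
have hw' := solution_le (ltnW (I14_I214 n)) hw.
have e0 : 0 < 1 / 2 ^+ n :> R by rewrite divr_gt0 // exprn_gt0.
have [F hF FE] := density_at (solution_sub hw' hv) e0.
exists (fun x => w x + (- cone R) *c F x).
  by apply: (solution_le (HI214 n)); apply: solution_add => //; exact: holwM.
move=> x Ox; apply: le_trans (FE x Ox).
by rewrite !cmulNl !cmul1l addrAC.
Qed.

Lemma solution_sequence : exists v : nat -> P -> P, forall n, solution (I14 n) (v n) /\
  forall x, Om n x -> eucl (v n.+1 x - v n x) * nu n x <= 1 / 2 ^+ n.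
Proof.
(* [choice] needs a total successor; a pair that is not a solution gets the dummy value [cst 0], and
   the invariant [hv] excludes this case. *)
have next (q : nat * (P -> P)) : exists v', solution (I14 q.1) q.2 -> solution (I14 q.1.+1) v' /\
    forall x, Om q.1 x -> eucl (v' x - q.2 x) * nu q.1 x <= 1 / 2 ^+ q.1.
  have [hq|nq] := pselect (solution (I14 q.1) q.2); last by exists (cst 0).
  by have [v' h1 h2] := solution_step hq; exists v'.
have [N hN] := choice next.
have [v0 hv0] := solution_exists (I14 0).
pose v := nat_rect (fun _ => P -> P) v0 (fun n v => N (n, v)).
have hv n : solution (I14 n) (v n).
  by elim: n => [//|n IH]; have [] := hN (n, v n) IH.
by exists v => n; split => //; have [] := hN (n, v n) (hv n).
Qed.

(** On [Om m] the limit [u] differs from the solution [v m] by a locally bounded limit of the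
    holomorphic functions [v k - v m], so it inherits the equation; the weighted distance to [v m]
    is bounded, so it inherits the bound. *)
Lemma global_solution : exists v, [/\ C1 Omega v, forall x, Omega x -> dB v x = f x &
  forall n, weighted n v].
Proof.
have [v hv] := solution_sequence.
(* The [k]-th increment is small for the larger weight [nu k], hence for [nu m], so the same
   sequence converges geometrically in every norm. *)
have inc x m k : Om m x -> (m <= k)%N -> `|v k.+1 x - v k x| <= (nu m x)^-1 / 2 ^+ k.
  move=> Ox mk; have Okx := Om_le mk Ox; have [_ h] := hv k.
  have n0 := nu_pos m Ox; have n1 := nu_pos k Okx.
  apply: (le_trans (norm_le_eucl _)); have := h x Okx; rewrite -ler_pdivlMr // => h2.
  apply: (le_trans h2); rewrite div1r mulrC; apply: ler_wpM2r; first by rewrite invr_ge0 exprn_ge0.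
  by rewrite lef_pV2 ?posrE //; exact: nu_mono mk (Om_Omega Ox).
(* The limit is found with one index [m0] and satisfies the estimate for every [m] with [x] in
   [Om m], by uniqueness of limits. *)
have lim x : exists l, Omega x -> forall m, Om m x -> forall k, (m <= k)%N ->
    `|l - v k x| <= 2 * (nu m x)^-1 / 2 ^+ k.
  have [Ox|nO] := pselect (Omega x); last by exists 0.
  have [m0 _ Ox0] : (\bigcup_n Om n) x by rewrite -HOmega_union.
  have [l hl] := geometric_plane (fun k => inc x m0 k Ox0).
  exists l => _ m Oxm k mk; have [l' hl'] := geometric_plane (fun k => inc x m k Oxm).
  by rewrite (cvg_plane_unique (cvg_geometric hl) (cvg_geometric hl')); exact: hl'.
have [u hu] := choice lim; exists u.
(* One factor 2 comes from the geometric sum and one from [eucl_le_norm]. *)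
have dist m x : Om m x -> eucl (u x - v m x) * nu m x <= 4.
  move=> Ox; have n0 := nu_pos m Ox; rewrite -ler_pdivlMr //.
  apply: (le_trans (eucl_le_norm _)); have := hu x (Om_Omega Ox) m Ox m (leqnn m).
  have : 2 * (nu m x)^-1 / 2 ^+ m <= 2 * (nu m x)^-1.
    by rewrite ler_piMr ?mulr_ge0 ?invr_ge0 ?(ltW n0) // invf_le1 ?exprn_gt0 // exprn_ege1 // ler1n.
  move: `|_ - _| (nu m x)^-1 (_ / _) => a b c; lra.
have m14 m : (m <= I14 m)%N := ltnW (n_I14 m).
have solm k m : (m <= k)%N -> solution m (v k).
  by move=> mk; apply: solution_le (hv k).1; exact: leq_trans mk (m14 k).
have holm m : hol (Om m) (fun x => u x - v m x).
  apply: (@hol_limit R (Om m) (fun k x => v (k + m)%N x + (- cone R) *c v m x) _ (@HOm_open m)).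
  - by move=> k; have [] := solution_sub (solm (k + m)%N m (leq_addl _ _)) (solm m m (leqnn m)).
  - move=> x Ox; have [M /square_nbhs[d d0 hd]] := nu_inv_loc m (Om_Omega Ox).
    have [r r0 hr] := open_square (@HOm_open m) Ox.
    exists (Num.min d r); first by rewrite lt_min d0.
    exists (4 * M) => k y; rewrite lt_min => /andP[/hd yM /hr Oy].
    have n0 := nu_pos m Oy; have b0 : 0 <= (nu m y)^-1 by rewrite invr_ge0 ltW.
    have le2 j : (m <= j)%N -> `|u y - v j y| <= 2 * (nu m y)^-1.
      move=> mj; apply: (le_trans (hu y (Om_Omega Oy) m Oy j mj)).
      by rewrite ler_piMr ?mulr_ge0 // invf_le1 ?exprn_gt0 // exprn_ege1 // ler1n.
    have h1 := le2 _ (leq_addl k m); have h2 := le2 m (leqnn m).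
    rewrite cmulNl cmul1l; have := ler_distD (u y) (v (k + m)%N y) (v m y).
    rewrite (distrC _ (u y)) => h3; lra.
  - move=> x Ox; have -> : u x - v m x = u x + (- cone R) *c v m x by rewrite cmulNl cmul1l.
    apply: cvgD; last exact: cvg_cst.
    apply: (@cvg_geometric R (fun k => v (k + m)%N x) (u x) (2 * (nu m x)^-1) 0) => k _.
    apply: (le_trans (hu x (Om_Omega Ox) m Ox (k + m)%N (leq_addl _ _))).
    apply: ler_wpM2l; first by rewrite mulr_ge0 // invr_ge0; exact: ltW (nu_pos m Ox).
    by rewrite lef_pV2 ?posrE ?exprn_gt0 // ler_weXn2l ?ler1n // leq_addr.
have loc m : C1 (Om m) u /\ forall x, Om m x -> dB u x = f x.
  have [h1 h2 _] := solm m m (leqnn m); have [h3 h4] := holm m.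
  have e x : Om m x -> u x - v m x + v m x = u x by rewrite subrK.
  split; first by exact: (C1_eq (@HOm_open m) e (C1D (@HOm_open m) h3 h1)).
  move=> x Ox; rewrite -(dbar_near (open_near (@HOm_open m) e Ox)).
  by rewrite (dbarD h3 h1 Ox) h4 // h2 // add0r.
have inOm x : Omega x -> exists m, Om m x by rewrite {1}HOmega_union => -[m _ ?]; exists m.
split.
- by split => x /inOm[m Ox]; have [h _] := loc m; exact: (C1P h).
- by move=> x /inOm[m Ox]; have [_] := loc m; exact.
move=> m; have [_ _ [C C0 hC]] := solm m m (leqnn m).
exists (4 + C); first exact: addr_ge0.
move=> x Ox; rewrite -[u x](subrK (v m x)).
apply: (le_trans (ler_wpM2r (ltW (nu_pos m Ox)) (eucl_tri _ _))).
by rewrite mulrDl lerD //; [exact: dist | exact: hC].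
Qed.

Hypothesis HW : forall k, exists2 rho : R, 0 < rho &
  (forall x, Om k x ->
     (rho%:E < ereal_inf [set (maxnorm (x - y))%:E | y in bd (Om k.+1)])%E) /\
  forall n, exists J : nat, exists2 C : R, 0 < C & forall x, Om k x ->
     (ereal_sup [set (nu n (x + z))%:E | z in [set z | (maxnorm z <= rho)%R]]
       <= C%:E * ereal_inf [set (nu J (x + z))%:E | z in [set z | (maxnorm z <= rho)%R]])%E.

(** Condition W in the form that the gradient estimate needs: one radius for all [x] in [Om n], and
    one index [p] large enough both for the square to lie in [Om p] and for [nu p] to dominate
    [nu J]. *)
Lemma weight_comparison n : exists2 r : R, 0 < r & exists p : nat, exists2 C : R, 0 < C &
  forall x, Om n x -> sq x (2 * r) `<=` Om p /\
    forall w, sq x (2 * r) w -> nu n x <= C * nu p w.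
Proof.
have [rho r0 [hbd hw]] := HW n; have [J [C C0 hC]] := hw n.
exists (rho / 2); first by rewrite divr_gt0.
pose p := maxn n.+1 J; exists p, C => // x Ox; rewrite mulrC divfK ?pnatr_eq0 //.
have sub : sq x rho `<=` Om n.+1.
  apply: square_in_of_bd => //; [exact: HOm_incr | exact: ltW |].
  move=> y hy; rewrite -lte_fin; apply: (lt_le_trans (hbd x Ox)); apply: ereal_inf_lbound.
  by exists y.
have subp : sq x rho `<=` Om p by move=> y hy; apply: (Om_le (leq_maxl n.+1 J)); exact: sub.
split => // w hwx.
have h1 : ((nu n x)%:E <= C%:E * (nu J w)%:E)%E.
  apply: (@le_trans _ _ (ereal_sup [set (nu n (x + z))%:E | z in [set z | (maxnorm z <= rho)%R]])).
    apply: ereal_sup_ubound; exists 0; last by rewrite addr0.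
    by change (`|0 : P| <= rho); rewrite normr0 ltW.
  apply: (le_trans (hC x Ox)); apply: lee_wpmul2l; first by rewrite lee_fin ltW.
  by apply: ereal_inf_lbound; exists (w - x); [exact: hwx | rewrite addrC subrK].
move: h1; rewrite -EFinM lee_fin => /le_trans; apply; apply: ler_wpM2l; first exact: ltW.
by apply: nu_mono; [exact: leq_maxr | exact: Om_Omega (subp w hwx)].
Qed.

(* Removing the outermost derivative preserves the order fixed by [pbeta], so that
   the symmetry of mixed derivatives is not needed. *)
Lemma pbeta_split (b : nat * nat) m : (b.1 + b.2 <= m.+1)%N -> (b.1 + b.2 <= m)%N \/
  exists c (b' : nat * nat), (b'.1 + b'.2 <= m)%N /\ forall F, pbeta b F = pD c (pbeta b' F).
Proof.
case: b => [[|i] [|j]] /= h; try by left.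
- by right; exists true, (0%N, j); split => // F; rewrite pDE.
- by right; exists false, (i, 0%N); split => // F; rewrite pDE.
- by right; exists false, (i, j.+1); split => // F; rewrite pDE.
Qed.

Lemma surjectivity : exists u : P -> P, EV Omega Om nu u /\ forall x, Omega x -> dbar u x = f x.
Proof.
have [u [hu1 hu2 hu3]] := global_solution.
have [su du] := regularity HOmega_open hu1 hu2 fs.
exists u; split; last by move=> x Ox; rewrite -dB_dbar hu2.
split; first exact: su.
have Cs b : C1 Omega (pbeta b u) by apply: ((smooth_onP _ _).1 su).
have Cf b : C1 Omega (pbeta b f) by apply: ((smooth_onP _ _).1 fs).
have dE b x : Omega x -> dB (pbeta b u) x = pbeta b f x by exact: du.
(* The induction on the order [m] runs over all [n] at once, since each further derivative on [Om n]
   costs the passage to the larger index [p]. *)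
have bound m : forall n, exists2 C : R, 0 <= C & forall (b : nat * nat) x, (b.1 + b.2 <= m)%N ->
    Om n x -> eucl (pbeta b u x) * nu n x <= C.
  elim: m => [n|m IH n].
    by have [C C0 hC] := hu3 n; exists C => // -[[|i] [|j]] //= x _; exact: hC.
  have [r r0 [p [K K0 hK]]] := weight_comparison n.
  have [G G0 hG] := gradient_estimate r0.
  have [C C0 hC] := IH p; have [C' C'0 hC'] := IH n.
  have [D D0 hD] := seminorm_bound (fb p m.+1).
  pose M := (C + D) * K.
  have M0 : 0 <= M by rewrite mulr_ge0 ?addr_ge0 // ltW.
  have GM : 0 <= 2 * (G * M) by rewrite mulr_ge0 // mulr_ge0 // ltW.
  exists (C' + 2 * (G * M)); first exact: addr_ge0.
  move=> b x bm Ox; have n0 := nu_pos n Ox.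
  have [bm'|[c [b' [bm' e]]]] := pbeta_split bm.
    by apply: (le_trans (hC' b x bm' Ox)); rewrite lerDl.
  have [sp hnu] := hK x Ox.
  have spO : sq x (2 * r) `<=` Omega by move=> w /sp; exact: Om_Omega.
  have hdB : C1 Omega (dB (pbeta b' u)).
    by apply: (C1_eq HOmega_open _ (Cf b')) => w Ow; rewrite dE.
  (* A bound in the weight [nu p] at [w] becomes one by the inverse of [nu n] at the centre [x], as
     [nu n x <= K * nu p w]: a constant on the square, as the gradient estimate requires. *)
  have conv (E : R) F w : 0 <= E -> E <= C + D -> sq x (2 * r) w ->
      eucl (F w) * nu p w <= E -> `|F w| <= M / nu n x.
    move=> E0 EC hw h; have np := nu_pos p (sp w hw).
    apply: (le_trans (norm_le_eucl _)); rewrite ler_pdivlMr //.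
    apply: (@le_trans _ _ (eucl (F w) * (K * nu p w))).
      by apply: ler_wpM2l; [exact: eucl_ge0 | exact: hnu].
    rewrite mulrCA mulrC /M; apply: ler_wpM2r; first exact: ltW.
    exact: le_trans h EC.
  have CD : C <= C + D by rewrite lerDl.
  have DC : D <= C + D by rewrite lerDr.
  have b'm1 : (b'.1 + b'.2 <= m.+1)%N := leqW bm'.
  have h := hG Omega (pbeta b' u) x (M / nu n x) c HOmega_open spO (Cs b') hdB.
  have {}h : `|pD c (pbeta b' u) x| <= G * (M / nu n x).
    apply: h => w hw; have Ow := spO w hw; split.
    - by apply: (conv C) => //; exact: hC bm' (sp w hw).
    - by rewrite (dE b' w Ow); apply: (conv D) => //; exact: hD b'm1 (sp w hw).
    - rewrite (pd_near c (open_near HOmega_open (dE b') Ow)) -e.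
      by apply: (conv D) => //; exact: hD bm (sp w hw).
  rewrite e -ler_pdivlMr //; apply: (le_trans (eucl_le_norm _)).
  apply: (@le_trans _ _ (2 * (G * (M / nu n x)))); first by rewrite ler_pM2l.
  have -> : 2 * (G * (M / nu n x)) = 2 * (G * M) / nu n x by rewrite !mulrA.
  by apply: ler_wpM2r; [rewrite invr_ge0 ltW | rewrite lerDr].
move=> n m; have [C C0 hC] := bound m n.
apply: (@le_lt_trans _ _ C%:E); last by rewrite ltry.
apply: ge_ereal_sup => _ [x Ox [b bm <-]]; rewrite lee_fin; exact: hC.
Qed.

End Equation.
End Exhaustion.

Theorem theorem4p8 (R : realType) (Omega : set (R * R))
  (Om : nat -> set (R * R)) (nu : nat -> R * R -> R)
  (* standing setup *)
  (HOmega_open : open Omega)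
  (HOm_open : forall n, open (Om n))
  (HOm_nonempty : forall n, Om n !=set0)
  (HOm_neqT : forall n, Om n <> setT)
  (HOm_incr : forall n, Om n `<=` Om n.+1)
  (HOmega_union : Omega = \bigcup_n Om n)
  (Hd_pos : forall n k, (n < k)%N -> (0 < dist (Om n) (bd (Om k)))%E)
  (Hnu_pos : forall n x, Omega x -> 0 < nu n x)
  (Hnu_cont : forall n, {within Omega, continuous (nu n)})
  (Hnu_incr : forall n x, Omega x -> nu n x <= nu n.+1 x)
  (* Condition W *)
  (HW : forall k, exists2 rho : R, 0 < rho &
     (forall x, Om k x ->
        (rho%:E < ereal_inf [set (maxnorm (x - y))%:E | y in bd (Om k.+1)])%E) /\
     forall n, exists J1 J2 : nat, exists C1 C2 : R,
       [/\ (n <= J1)%N, (n <= J2)%N, 0 < C1, 0 < C2 &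
        forall x, Om k x ->
          (ereal_sup [set (nu n (x + z))%:E | z in [set z | (maxnorm z <= rho)%R]]
            <= C1%:E * ereal_inf [set (nu J1 (x + z))%:E | z in [set z | (maxnorm z <= rho)%R]])%E
          /\ nu n x <= C2 * (1 + eucl x ^+ 2) ^- 2 * nu J2 x])
  (* Condition D (a), (b), (c), and the assumption I214(n) >= I14(n+1) *)
  (HD : exists (g : nat -> R * R -> R * R) (I1 I2 : nat -> nat)
          (X : nat -> set (R * R)) (Rn rn : nat -> R) (A2 : nat -> R * R -> R)
          (I4 : nat -> nat) (A4 : nat -> R),
     [/\
      (* (a) *)
      forall n,
        [/\ entire (g n) /\ g n 0 = cone R, (n < I1 n)%N /\ (n < I2 n)%N,
         (* (a)(i) *)
         (forall eps : R, 0 < eps -> exists K : set (R * R),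
            [/\ compact K, K `<=` closure (Om n) &
                forall x, (Om n `\` K) x -> nu n x <= eps * nu (I1 n) x]),
         (* (a)(ii) *)
         [/\ open (X n) /\ X n `<=` ~` closure (Om (I2 n)),
             0 < Rn n /\ ((2 * Rn n)%:E < dist (X n) (Om (I2 n)))%E,
             Rn n < rn n /\ ((rn n)%:E < dist (X n) (Om (I2 n)) - (Rn n)%:E)%E,
             (forall x, [set a + b | a in X n & b in eball 0 (Rn n)] x -> 0 < A2 n x)
             /\ (forall x, X n x -> exists M : R, \forall y \near x, A2 n y <= M) &
             (forall z x, Om (I2 n) z ->
                [set a + b | a in X n & b in eball 0 (Rn n)] x ->
                (ereal_sup [set (eucl (g n zeta) * nu (I2 n) z)%:E |
                             zeta in [set zeta | (eucl (zeta - (z - x)) = rn n)%R]]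
                  <= (A2 n x)%:E)%E)] &
         (* (a)(iii) *)
         (forall K : set (R * R), compact K -> exists2 A3 : R, 0 < A3 &
            forall x, Om n x ->
              (\int[@leb2 R]_(y in K)
                  ((eucl (g n (x - y)) * nu n x / eucl (x - y))%:E) <= A3%:E)%E)],
      (* (b) *)
      forall n,
        [/\ (n < I4 n)%N, 0 < A4 n &
         forall k p : nat,
           (k, p) = (I4 n, n) \/ (k, p) = (I1 (I4 n), I1 (I4 n)) ->
           forall x, Om p x ->
             (\int[@leb2 R]_(y in Om (I4 n))
                ((eucl (g (I1 (I4 n)) (x - y)) * nu p x / (eucl (x - y) * nu k y))%:E)
               <= (A4 n)%:E)%E],
      (* (c) *)
      (forall n (M : set (R * R)), closed M -> M `<=` closure (Om n) ->
         forall N : set (R * R),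
           (exists2 x, (~` M) x & N = connected_component (~` M) x) ->
           N `&` ~` closure (Om n) !=set0 ->
           N `&` X (I1 (I4 n)) !=set0) &
      (* I214(n) >= I14(n+1) *)
      (forall n, (I1 (I4 n.+1) <= I2 (I1 (I4 n)))%N)])
  (* -ln nu_n subharmonic on Omega *)
  (Hsubh : forall n, subharmonic_on Omega (fun x => - ln (nu n x))) :
  (* dbar : EV(Omega) -> EV(Omega) is surjective *)
  forall f : R * R -> R * R, EV Omega Om nu f ->
    exists u : R * R -> R * R, EV Omega Om nu u /\ forall x, Omega x -> dbar u x = f x.
Proof.
move=> f [fs fb]; have [g [I1 [I2 [X [Rn [rn [A2 [I4 [A4 [Ha Hb Hc HI]]]]]]]]]] := HD.
apply: (@surjectivity R Omega Om nu HOmega_open HOm_open HOm_incr HOmega_union Hd_pos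
  Hnu_pos Hnu_cont Hnu_incr g I1 I2 X Rn rn A2 I4 A4 _ _ _ _ _ _ Hc HI f fs fb _).
- by move=> n; have [] := Ha n.
- by move=> n; have [] := Ha n.
- by move=> n; have [] := Ha n.
- by move=> n; have [_ _ _ [h1 h2 [h3 _] h4 h5] _] := Ha n; split.
- by move=> n; have [] := Ha n.
- by move=> n; have [h1 h2 h3] := Hb n; split => //; apply: (h3 (I4 n) n); left.
- move=> k; have [rho r0 [h1 h2]] := HW k; exists rho => //; split => // n.
  have [J1 [J2 [C1 [C2 [_ _ c0 _ h]]]]] := h2 n; exists J1, C1 => // x Ox.
  by have [] := h x Ox.
Qed.
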